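(* Let $(\Omega,\mathcal{G},\mathbb{P})$ be a probability space, $L^0=L^0(\Omega,\mathcal{G},\mathbb{P})$, and let $(\mathcal{K}_\alpha)_{\alpha>0}$ be a family of subsets of $L^0_+$ such that $aX+bY\in\mathcal{K}_{a\alpha+b\beta}$ for all $a,b\in\mathbb{R}_+$, $\alpha,\beta>0$ with $a\alpha+b\beta>0$ and all $X\in\mathcal{K}_\alpha$, $Y\in\mathcal{K}_\beta$. Set $\mathcal{B}_\alpha:=(\mathcal{K}_\alpha-L^0_+)\cap L^0_+$ for $\alpha>0$ and $\mathcal{B}:=\mathcal{B}_1$. Then the following statements are equivalent: (i) $\mathcal{K}_1$ satisfies NUPBR. (ii) $\mathcal{K}_1$ satisfies NAA$_1$. (iii) $\mathcal{K}_1$ satisfies NA$_1$. (iv) $\bigcap_{\alpha>0}\mathcal{B}_\alpha=\{0\}$. (v) There exists an equivalent probability measure $\mathbb{Q}\approx\mathbb{P}$ such that $\mathcal{B}$ is $L^1(\mathbb{Q})$-bounded. (vi) There exists an equivalent probability measure $\mathbb{Q}\approx\mathbb{P}$ with bounded Radon-Nikodym derivative $\frac{d\mathbb{Q}}{d\mathbb{P}}$ such that $\mathcal{B}$ is $L^1(\mathbb{Q})$-bounded. (vii) $\mathcal{B}$ has the permutation invariant von Weizsäcker property with respect to almost sure convergence. (viii) $\mathcal{B}$ has the permutation invariant von Weizsäcker property with respect to convergence in probability. (ix) $\mathcal{B}$ has the subsequence invariant von Weizsäcker property with respect to almost sure convergence. (x) $\mathcal{B}$ has the subsequence invariant von Weizsäcker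 property with respect to convergence in probability. (xi) $\mathcal{B}$ has the Banach Saks property with respect to almost sure convergence. (xii) $\mathcal{B}$ has the Banach Saks property with respect to convergence in probability. (xiii) For every sequence $(X_n)_{n\in\mathbb{N}}\subset\mathcal{B}$ there exist a subsequence $(X_{n_k})_{k\in\mathbb{N}}$ and a probability measure $\mu$ on $\mathbb{R}_+$ with its Borel $\sigma$-algebra such that the laws of $X_{n_k}$ under $\mathbb{P}$ converge weakly to $\mu$ as $k\to\infty$.
   Context: $L^0$ is the space of $\mathbb{P}$-a.s. equivalence classes of real-valued random variables, ordered by $X\leq Y$ iff $\mathbb{P}(X\leq Y)=1$, with the topology of convergence in probability; $L^0_+=\{X\in L^0:X\geq0\}$; $\mathbb{R}_+=[0,\infty)$. A subset $\mathcal{B}\subset L^0$ is topologically bounded if for every neighborhood $U$ of zero there is $\alpha>0$ with $\mathcal{B}\subset\alpha U$; sequentially bounded if $\alpha_nX_n\to0$ for every $(X_n)\subset\mathcal{B}$ and every real sequence $\alpha_n\to0$. $p_{\mathcal{B}}(X):=\inf\{\alpha>0:X\in\alpha\mathcal{B}\}\in[0,\infty]$. $\mathcal{K}_1$ satisfies NUPBR if $\mathcal{B}$ is topologically bounded; NAA$_1$ if $\mathcal{B}$ is sequentially bounded; NA$_1$ if $p_{\mathcal{B}}(X)>0$ for all $X\in L^0_+\setminus\{0\}$. $\mathcal{B}$ is $L^1(\mathbb{Q})$-bounded if $\sup_{X\in\mathcal{B}}\mathbb{E}_{\mathbb{Q}}[X]<\infty$. A sequence $(Y_k)$ is Cesàro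 convergent to $X$ (a.s. or in probability) if $\frac1k\sum_{l=1}^kY_l\to X$ (a.s. or in probability). $\mathcal{B}$ has the Banach Saks property with respect to a.s. convergence (convergence in probability) if every sequence in $\mathcal{B}$ has a subsequence which is a.s. Cesàro convergent (Cesàro convergent in probability) to some (finite) $X\in L^0_+$. $\mathcal{B}$ has the permutation invariant (respectively subsequence invariant) von Weizsäcker property with respect to a.s. convergence (convergence in probability) if for every sequence $(X_n)\subset\mathcal{B}$ there exist a subsequence $(X_{n_k})_{k\in\mathbb{N}}$ and a (finite) $X\in L^0_+$ such that for every permutation $\pi:\mathbb{N}\to\mathbb{N}$ the sequence $(X_{n_{\pi(k)}})_{k\in\mathbb{N}}$ (respectively for every further subsequence $(n_{k_l})_{l\in\mathbb{N}}$ the sequence $(X_{n_{k_l}})_{l\in\mathbb{N}}$) is a.s. Cesàro convergent (Cesàro convergent in probability) to $X$.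
   Formalization: The sets K_α are assumed nonempty; if all K_α are empty (the only other case the combination axiom allows), B is empty, so (i) holds vacuously while (iv) fails, and the equivalence is false. *)

(* Defs.v *)
From HB Require Import structures.
From mathcomp Require Import all_boot all_order all_algebra.
From mathcomp Require Import all_classical all_reals all_analysis.
From mathcomp Require Import measurable_realfun.

Set Implicit Arguments.
Unset Strict Implicit.
Unset Printing Implicit Defensive.
Import Order.TTheory GRing.Theory Num.Theory.
Import numFieldNormedType.Exports.
Local Open Scope classical_set_scope.
Local Open Scope charge_scope.
Local Open Scope ring_scope.

Definition L0 d (T : measurableType d) (R : realType) (P : probability T R) :
  Type := {mfun_ P, T >-> R}.

Section L0_structure.
Context d (T : measurableType d) (R : realType) (P : probability T R).
Local Open Scope quotient_scope.
Implicit Types (X Y Z : L0 P) (f g : {mfun T >-> R}).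

HB.instance Definition _ := Choice.on (L0 P).
HB.instance Definition _ := EqQuotient.on (L0 P).

Definition L0_fun X : {mfun T >-> R} := repr X.
Coercion L0_fun : L0 >-> MeasurableFun.type.

Definition L0_class f : L0 P := \pi_(L0 P) f.

Lemma L0_classP f : {ae P, forall w, L0_class f w = f w}.
Proof.
have /eqP : L0_fun (L0_class f) = f %[mod {mfun_ P, T >-> R}].
  exact: reprK.
by rewrite eqmodE => /asboolP; apply: filterS => w /(_ I).
Qed.

Lemma L0_eqP X Y : X = Y <-> {ae P, forall w, X w = Y w}.
Proof.
split=> [->|XY]; first exact: aeW.
rewrite -[X]reprK -[Y]reprK; apply/eqP; rewrite eqmodE.
by apply/asboolP; apply: filterS XY => w + _.
Qed.

Definition L0_zero : L0 P := L0_class (cst 0).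
Definition L0_opp X : L0 P := L0_class (- L0_fun X).
Definition L0_add X Y : L0 P := L0_class (L0_fun X + L0_fun Y).
Definition L0_scale (a : R) X : L0 P := L0_class (a *: L0_fun X).

Let zeroE : {ae P, forall w, L0_zero w = 0}.
Proof. exact: L0_classP. Qed.
Let oppE X : {ae P, forall w, L0_opp X w = - X w}.
Proof. exact: L0_classP. Qed.
Let addE X Y : {ae P, forall w, L0_add X Y w = X w + Y w}.
Proof. exact: L0_classP. Qed.
Let scaleE a X : {ae P, forall w, L0_scale a X w = a * X w}.
Proof. exact: L0_classP. Qed.

Let addA : associative L0_add.
Proof.
move=> X Y Z; apply/L0_eqP.
apply: filterS3 (addE X (L0_add Y Z)) (addE (L0_add X Y) Z)
  (filterI (addE Y Z) (addE X Y)) => w -> -> [-> ->].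
by rewrite addrA.
Qed.

Let addC : commutative L0_add.
Proof.
move=> X Y; apply/L0_eqP.
by apply: filterS2 (addE X Y) (addE Y X) => w -> ->; rewrite addrC.
Qed.

Let add0 : left_id L0_zero L0_add.
Proof.
move=> X; apply/L0_eqP.
by apply: filterS2 (addE L0_zero X) zeroE => w -> ->; rewrite add0r.
Qed.

Let addN : left_inverse L0_zero L0_opp L0_add.
Proof.
move=> X; apply/L0_eqP.
apply: filterS3 (addE (L0_opp X) X) (oppE X) zeroE => w -> -> ->.
by rewrite addNr.
Qed.

HB.instance Definition _ := GRing.isZmodule.Build (L0 P) addA addC add0 addN.

Let scaleA a b X : L0_scale a (L0_scale b X) = L0_scale (a * b) X.
Proof.
apply/L0_eqP.
apply: filterS3 (scaleE a (L0_scale b X)) (scaleE b X) (scaleE (a * b) X).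
by move=> w -> -> ->; rewrite mulrA.
Qed.

Let scale1 : left_id 1 L0_scale.
Proof.
by move=> X; apply/L0_eqP; apply: filterS (scaleE 1 X) => w ->; rewrite mul1r.
Qed.

Let scaleDr : right_distributive L0_scale +%R.
Proof.
move=> a X Y; apply/L0_eqP.
apply: filterS3 (filterI (scaleE a (X + Y)) (addE X Y))
  (addE (L0_scale a X) (L0_scale a Y)) (filterI (scaleE a X) (scaleE a Y)).
by move=> w [-> ->] -> [-> ->]; rewrite mulrDr.
Qed.

Let scaleDl X : {morph L0_scale^~ X : a b / a + b}.
Proof.
move=> a b; apply/L0_eqP.
apply: filterS3 (scaleE (a + b) X) (addE (L0_scale a X) (L0_scale b X))
  (filterI (scaleE a X) (scaleE b X)).
by move=> w -> -> [-> ->]; rewrite mulrDl.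
Qed.

HB.instance Definition _ :=
  GRing.Zmodule_isLmodule.Build R (L0 P) scaleA scale1 scaleDr scaleDl.

Lemma L0_0E : {ae P, forall w, (0 : L0 P) w = 0}.
Proof. exact: zeroE. Qed.
Lemma L0_NE X : {ae P, forall w, (- X : L0 P) w = - X w}.
Proof. exact: oppE. Qed.
Lemma L0_DE X Y : {ae P, forall w, (X + Y : L0 P) w = X w + Y w}.
Proof. exact: addE. Qed.
Lemma L0_ZE a X : {ae P, forall w, (a *: X : L0 P) w = a * X w}.
Proof. exact: scaleE. Qed.

(* Convergence in probability is metrised by the Ky Fan metric
   inf {e > 0 : P(|X - Y| >= e) < e}; these are its balls. *)
Definition L0_ball X (e : R) : set (L0 P) :=
  [set Y | (P [set w | (e <= `|X w - Y w|)%R] < e%:E)%E].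

Let measurable_gap X Y (e : R) : measurable [set w | e <= `|X w - Y w|].
Proof.
rewrite -[X in measurable X]setTI.
rewrite (_ : [set w | _] = (fun w => `|X w - Y w|) @^-1` `[e, +oo[); last first.
  by apply/seteqP; split=> w /=; rewrite in_itv /= andbT.
have mXY : measurable_fun setT (fun w => `|X w - Y w|).
  by apply: measurableT_comp => //; exact: measurable_funB.
exact: mXY.
Qed.

Let ball_center X (e : R) : 0 < e -> L0_ball X e X.
Proof.
move=> e0; rewrite /L0_ball /= (_ : [set w | _] = set0) ?measure0 ?lte_fin//.
by apply/seteqP; split=> w //=; rewrite subrr normr0 leNgt e0.
Qed.

Let ball_sym X Y (e : R) : L0_ball X e Y -> L0_ball Y e X.
Proof.
by rewrite /L0_ball /=; under eq_set do rewrite distrC.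
Qed.

Let ball_triangle X Y Z e1 e2 :
  L0_ball X e1 Y -> L0_ball Y e2 Z -> L0_ball X (e1 + e2) Z.
Proof.
rewrite /L0_ball /= => XY YZ; rewrite EFinD.
apply: le_lt_trans (lteD XY YZ).
apply: le_trans (measureU2 P (measurable_gap X Y e1) (measurable_gap Y Z e2)).
apply: le_measure; rewrite ?inE //; [exact: measurableU|].
move=> w /= h; apply/orP; rewrite -implyNb -ltNge; apply/implyP => h1.
rewrite leNgt; apply/negP => h2; move: h; rewrite leNgt => /negP; apply.
by rewrite (le_lt_trans (ler_distD (Y w) _ _))// ltrD.
Qed.

Let ent : set_system (L0 P * L0 P) := entourage_ L0_ball.
Let nbhs_L0 (X : L0 P) : set_system (L0 P) := nbhs_ ent X.
Let nbhs_L0E : nbhs_L0 = nbhs_ ent. Proof. by []. Qed.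
HB.instance Definition _ := hasNbhs.Build (L0 P) nbhs_L0.
Let entE : ent = entourage_ L0_ball. Proof. by []. Qed.
HB.instance Definition _ := @Nbhs_isPseudoMetric.Build R (L0 P)
  ent nbhs_L0E L0_ball ball_center ball_sym ball_triangle entE.

Lemma L0_cvgP (X_ : nat -> L0 P) X : X_ @ \oo --> X <->
  forall e : R, 0 < e -> P [set w | e <= `|X w - X_ n w|] @[n --> \oo] --> 0%E.
Proof.
split=> [/cvg_ballP XX e e0|XX].
- apply/fine_cvgP; split; first by apply: nearW => n; exact: fin_num_measure.
  apply/cvgr0Pnorm_lt => r r0.
  have m0 : 0 < Num.min e r by rewrite lt_min e0.
  apply: filterS (XX _ m0) => n; rewrite [ball _ _ _]/(L0_ball _ _ _)/= => h.
  rewrite ger0_norm ?fine_ge0//; apply: (@lt_le_trans _ _ (Num.min e r)).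
    rewrite -lte_fin fineK ?fin_num_measure//; apply: le_lt_trans h.
    apply: le_measure; rewrite ?inE// => w /=; apply: le_trans.
    by rewrite ge_min lexx.
  by rewrite ge_min lexx orbT.
- apply/cvg_ballP => e e0; have /fine_cvgP[_ /cvgr0Pnorm_lt/(_ _ e0)] := XX e e0.
  apply: filterS => n; rewrite ger0_norm ?fine_ge0// => h.
  rewrite [ball _ _ _]/(L0_ball _ _ _)/= -[ltLHS]fineK ?fin_num_measure//.
Qed.

End L0_structure.

Section boundedness.
Context (R : realType) (V : preTopologicalLmodType R).
Implicit Type B : set V.

Definition topologically_bounded B : Prop :=
  forall U : set V, nbhs 0 U ->
    exists2 a : R, 0 < a & B `<=` [set a *: X | X in U].

Definition sequentially_bounded B : Prop :=
  forall (X_ : nat -> V) (a : nat -> R), (forall n, B (X_ n)) ->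
    a n @[n --> \oo] --> 0 -> a n *: X_ n @[n --> \oo] --> 0.

Definition gauge B (X : V) : \bar R :=
  ereal_inf [set a%:E | a in
    [set a : R | 0 < a /\ [set a *: Y | Y in B] X]].

End boundedness.

Section market.
Context d (T : measurableType d) (R : realType) (P : probability T R).
Implicit Types (X Y Z : L0 P) (K B : set (L0 P)).

Definition L0_le X Y : Prop := P [set w | X w <= Y w] = 1%E.

Definition L0_plus : set (L0 P) := [set X | L0_le 0 X].

Definition solid_hull K : set (L0 P) :=
  [set X - Y | X in K & Y in L0_plus] `&` L0_plus.

Definition NUPBR K : Prop := topologically_bounded (solid_hull K).

Definition NAA1 K : Prop := sequentially_bounded (solid_hull K).

Definition NA1 K : Prop :=
  forall X, L0_plus X -> X <> 0 -> (0 < gauge (solid_hull K) X)%E.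

Definition equivalent_probability (Q : probability T R) : Prop :=
  P `<< Q /\ Q `<< P.

Definition bounded_density (Q : probability T R) : Prop :=
  exists M : R, {ae P, forall w,
    (`|('d (charge_of_finite_measure Q) '/d P)%R w| <= M%:E)%E}.

(* Only meaningful for Q `<< P, where it does not depend on the choice of
   representatives. *)
Definition L1_bounded (Q : probability T R) B : Prop :=
  (ereal_sup [set 'E_Q[L0_fun X] | X in B] < +oo)%E.

Definition as_cvg (Y_ : nat -> L0 P) X : Prop :=
  {ae P, forall w, Y_ n w @[n --> \oo] --> X w}.

Definition prob_cvg (Y_ : nat -> L0 P) X : Prop := Y_ @ \oo --> X.

(* Sequences are indexed from 0, so this is the mean of the first k + 1 terms. *)
Definition cesaro_mean (Y_ : nat -> L0 P) (k : nat) : L0 P :=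
  k.+1%:R^-1 *: \sum_(l < k.+1) Y_ l.

Definition subsequence (n_ : nat -> nat) : Prop :=
  {homo n_ : i j / (i < j)%N}.

Section cesaro_properties.
Variable mode_cvg : (nat -> L0 P) -> L0 P -> Prop.

Definition banach_saks B : Prop :=
  forall X_ : nat -> L0 P, (forall n, B (X_ n)) ->
    exists2 n_, subsequence n_ &
    exists2 X, L0_plus X & mode_cvg (cesaro_mean (X_ \o n_)) X.

Definition permutation_von_weizsacker B : Prop :=
  forall X_ : nat -> L0 P, (forall n, B (X_ n)) ->
    exists2 n_, subsequence n_ &
    exists2 X, L0_plus X &
      forall pi_ : nat -> nat, bijective pi_ ->
        mode_cvg (cesaro_mean (X_ \o (n_ \o pi_))) X.

Definition subsequence_von_weizsacker B : Prop :=
  forall X_ : nat -> L0 P, (forall n, B (X_ n)) ->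
    exists2 n_, subsequence n_ &
    exists2 X, L0_plus X &
      forall k_ : nat -> nat, subsequence k_ ->
        mode_cvg (cesaro_mean (X_ \o (n_ \o k_))) X.

End cesaro_properties.

Definition law X : probability R R := distribution P (L0_fun X).

End market.

Section weak_convergence.
Context (R : realType).

Definition Rplus : set R := `[0, +oo[%classic.

(* A probability measure on R_+ is represented by a Borel probability measure
   mu on the line with mu Rplus = 1, and a continuous function on R_+ by any
   f : R -> R whose restriction to R_+ is continuous. *)
Definition weak_cvg_Rplus (mu_ : nat -> probability R R)
    (mu : probability R R) : Prop :=
  forall f : R -> R, {within Rplus, continuous f} ->
    (exists M : R, forall x, Rplus x -> `|f x| <= M) ->
    (\int[mu_ k]_(x in Rplus) (f x)%:E)%E @[k --> \oo] -->
      (\int[mu]_(x in Rplus) (f x)%:E)%E.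

Definition laws_weakly_precompact d (T : measurableType d)
    (P : probability T R) (B : set (L0 P)) : Prop :=
  forall X_ : nat -> L0 P, (forall n, B (X_ n)) ->
    exists2 n_, subsequence n_ &
    exists2 mu : probability R R, mu Rplus = 1%E &
      weak_cvg_Rplus (fun k => law (X_ (n_ k))) mu.

End weak_convergence.

(* Main.v *)
(* The hub is (iv). Given (iv), minimise E[1 / (1 + X)] over the convex set B:
   Z_n = 1 / (1 + X_n) is L^2-Cauchy along a minimising sequence, hence converges
   a.s. to some Z. On {Z = 0} the X_n tend to infinity, so by solidity the
   indicator of a non-null part of {Z = 0} would lie in every B_alpha; thus Z > 0,
   and the first-order condition bounds E[X Z^2] uniformly over B. The density
   proportional to Z^2 gives (vi), and also tightness, hence (i), and (xiii) by
   Helly's selection principle.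

   Given (v), all von Weizsaecker properties follow from a Komlos theorem in which
   one subsequence works for all injections sigma of the indices. Truncations
   min(X_n, p) have weak L^2-limits b_p along an ultrafilter, which increase to a
   finite B; a sparse subsequence makes the differences min(X_n, p) - b_p nearly
   orthogonal. This is insensitive to the order of the terms, and Etemadi's proof
   of the strong law needs nothing more.

   Conversely, if X <> 0 lies in every B_alpha, the sequence n X in B has no Cesaro
   convergent and no weakly convergent subsequence. *)

Require Import Defs.
From HB Require Import structures.
From mathcomp Require Import all_boot all_order all_algebra.
From mathcomp Require Import all_classical all_reals all_analysis.
From mathcomp Require Import measurable_realfun.
From mathcomp Require Import ring lra.

Set Implicit Arguments.
Unset Strict Implicit.
Unset Printing Implicit Defensive.
Import Order.TTheory GRing.Theory Num.Theory.
Import numFieldNormedType.Exports.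
Local Open Scope classical_set_scope.
Local Open Scope ring_scope.

(** * Expectations of bounded functions *)

(** [B] is not closed, so the infimum of E[1 / (1 + X)] need not be attained, and only the functions
    1 / (1 + X_n), not the X_n, have a limit. What rescues the argument is that 1 / x on [[1, +oo[]
    has a modulus of convexity expressed by the increments of its own values. The first-order
    condition is tested at approximate minimisers, with step 2^-n against an error 4^-n, and Fatou's
    lemma carries it to the limit. The weight Z^2 comes from minus the derivative of 1 / (1 + x).

    In the Komlos theorem the terms have no common law. The part of identical distribution is played
    by the limits [H p] of the second moments of the truncations, whose sum weighted by (p + 1)^-2
    is bounded by a multiple of the L^1 bound. A single ultrafilter supplies these limits and the
    weak limits for all levels at once, so that levels can be compared; a true subsequence is drawn
    only at the end, by imposing finitely many conditions on each new index. Near orthogonality is a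
    condition on pairs of indices, unlike the martingale differences of the classical proof, which
    refer to an order. *)

Section bounded_measurable.
Context d (T : measurableType d) (R : realType).
Implicit Types f g : T -> R.

(** The bound holds everywhere and no measure is mentioned, so members are integrable under every
    probability and [Rintegral] is linear on them without further side conditions. *)
Definition bounded_measurable f :=
  measurable_fun setT f /\ exists M, forall w, `|f w| <= M.

Lemma bounded_measurable_cst (c : R) : bounded_measurable (fun=> c).
Proof. by split; [exact: measurable_cst | exists `|c|]. Qed.

Lemma bounded_measurableD f g : bounded_measurable f -> bounded_measurable g ->
  bounded_measurable (fun w => f w + g w).
Proof.
move=> [mf [M fM]] [mg [N gN]]; split; first exact: measurable_funD.
by exists (M + N) => w; rewrite (le_trans (ler_normD _ _))// lerD.
Qed.

Lemma bounded_measurableM f g : bounded_measurable f -> bounded_measurable g ->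
  bounded_measurable (fun w => f w * g w).
Proof.
move=> [mf [M fM]] [mg [N gN]]; split; first exact: measurable_funM.
by exists (M * N) => w; rewrite normrM ler_pM.
Qed.

Lemma bounded_measurableN f : bounded_measurable f ->
  bounded_measurable (fun w => - f w).
Proof.
move=> [mf [M fM]]; split; first exact: measurableT_comp.
by exists M => w; rewrite normrN.
Qed.

Lemma bounded_measurableB f g : bounded_measurable f -> bounded_measurable g ->
  bounded_measurable (fun w => f w - g w).
Proof. by move=> bf bg; apply/bounded_measurableD/bounded_measurableN. Qed.

Lemma bounded_measurable_norm f : bounded_measurable f ->
  bounded_measurable (fun w => `|f w|).
Proof.
move=> [mf [M fM]]; split; first exact: measurableT_comp.
by exists M => w; rewrite normr_id.
Qed.

Lemma bounded_measurable_sqr f : bounded_measurable f ->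
  bounded_measurable (fun w => f w ^+ 2).
Proof.
move=> bf; under [X in bounded_measurable X]eq_fun do rewrite expr2.
exact: bounded_measurableM.
Qed.

Lemma bounded_measurable_sum (I : Type) (r : seq I) (F : I -> T -> R) :
  (forall i, bounded_measurable (F i)) ->
  bounded_measurable (fun w => \sum_(i <- r) F i w).
Proof.
move=> bF; elim: r => [|i r IH].
  under [X in bounded_measurable X]eq_fun do rewrite big_nil.
  exact: bounded_measurable_cst.
under [X in bounded_measurable X]eq_fun do rewrite big_cons.
exact: bounded_measurableD.
Qed.

Lemma bounded_measurable_itv f (a b : R) : measurable_fun setT f ->
  (forall w, a <= f w <= b) -> bounded_measurable f.
Proof.
move=> mf fab; split=> //; exists (`|a| + `|b|) => w.
have /andP[h1 h2] := fab w.
have := ler_norm b; have := ler_norm (- a); rewrite normrN => h3 h4.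
have := normr_ge0 a; have := normr_ge0 b => h5 h6.
by rewrite ler_norml; apply/andP; split; lra.
Qed.

Lemma bounded_measurable_indic (A : set T) : measurable A ->
  bounded_measurable (fun w => \1_A w : R).
Proof.
move=> mA; apply: (@bounded_measurable_itv _ 0 1) => [|w].
  exact: measurable_indic.
by rewrite indicE; case: (_ \in _); rewrite ?ler01 ?lexx.
Qed.

End bounded_measurable.

Section bounded_expectation.
Context d (T : measurableType d) (R : realType) (P : probability T R).
Implicit Types f g : T -> R.

Lemma bounded_integrable f : bounded_measurable f ->
  P.-integrable setT (EFin \o f).
Proof.
move=> [mf [M fM]]; apply: (@le_integrable _ _ _ _ _ _ _ (EFin \o cst M)) => //.
- exact/measurable_EFinP.
- move=> w _ /=; rewrite lee_fin; apply: le_trans (fM w) (ler_norm _).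
- by apply/finite_measure_integrable_cst.
Qed.

Lemma bounded_RintegralE f : bounded_measurable f ->
  (\int[P]_w (f w)%:E)%E = (\int[P]_w f w)%:E.
Proof.
move=> bf; rewrite /Rintegral fineK//.
exact: integrable_fin_num (bounded_integrable bf).
Qed.

Lemma bounded_RintegralD f g : bounded_measurable f -> bounded_measurable g ->
  \int[P]_w (f w + g w) = \int[P]_w f w + \int[P]_w g w.
Proof. by move=> bf bg; rewrite RintegralD//; exact: bounded_integrable. Qed.

Lemma bounded_RintegralB f g : bounded_measurable f -> bounded_measurable g ->
  \int[P]_w (f w - g w) = \int[P]_w f w - \int[P]_w g w.
Proof. by move=> bf bg; rewrite RintegralB//; exact: bounded_integrable. Qed.

Lemma bounded_RintegralZ f (a : R) : bounded_measurable f ->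
  \int[P]_w (a * f w) = a * \int[P]_w f w.
Proof. by move=> bf; rewrite RintegralZl//; exact: bounded_integrable. Qed.

Lemma Rintegral_probability_cst (a : R) : \int[P]_w a = a.
Proof.
have := @Rintegral_cst _ _ _ P setT measurableT a => ->.
by rewrite [X in fine X](@probability_setT _ _ _ P) mulr1.
Qed.

Lemma bounded_le_Rintegral f g : bounded_measurable f -> bounded_measurable g ->
  (forall w, f w <= g w) -> \int[P]_w f w <= \int[P]_w g w.
Proof.
by move=> bf bg fg; apply: le_Rintegral => //; exact: bounded_integrable.
Qed.

Lemma bounded_Rintegral_sum (I : Type) (r : seq I) (F : I -> T -> R) :
  (forall i, bounded_measurable (F i)) ->
  \int[P]_w (\sum_(i <- r) F i w) = \sum_(i <- r) \int[P]_w F i w.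
Proof.
move=> bF; elim: r => [|i r IH].
  under eq_Rintegral do rewrite big_nil.
  by rewrite Rintegral_probability_cst big_nil.
under eq_Rintegral do rewrite big_cons.
rewrite bounded_RintegralD ?IH ?big_cons//.
exact: bounded_measurable_sum.
Qed.

Lemma ae_eq_Rintegral f g : bounded_measurable f -> bounded_measurable g ->
  {ae P, forall w, f w = g w} -> \int[P]_w f w = \int[P]_w g w.
Proof.
move=> [mf _] [mg _] fg; congr fine; apply: ae_eq_integral => //.
- exact/measurable_EFinP.
- exact/measurable_EFinP.
- by apply: filterS fg => w /= -> _.
Qed.

Lemma bounded_dominated_cvg (f_ : nat -> T -> R) f M :
  (forall n, measurable_fun setT (f_ n)) -> measurable_fun setT f ->
  (forall n w, `|f_ n w| <= M) -> {ae P, forall w, f_ n w @[n --> \oo] --> f w} ->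
  \int[P]_w f_ n w @[n --> \oo] --> \int[P]_w f w.
Proof.
move=> mf_ mf fM cf.
have [fi _ cvg] : [/\ P.-integrable setT (EFin \o f),
    (\int[P]_w `|(EFin \o f_ n) w - (EFin \o f) w|)%E @[n --> \oo] --> 0%E &
    (\int[P]_w (EFin \o f_ n) w)%E @[n --> \oo] --> (\int[P]_w (EFin \o f) w)%E].
  apply: (@dominated_convergence _ _ _ P setT measurableT (fun n => EFin \o f_ n)
     (EFin \o f) (EFin \o cst M)) => //.
  - by move=> n; exact/measurable_EFinP.
  - exact/measurable_EFinP.
  - apply: filterS cf => w cw _; apply: cvg_EFin => //.
    exact: nearW.
  - exact: finite_measure_integrable_cst.
  - by apply: aeW => w n _ /=; rewrite lee_fin.
apply: fine_cvg; rewrite /Rintegral fineK//.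
exact: integrable_fin_num fi.
Qed.

End bounded_expectation.

Lemma sum_half_le (R : realType) N : \sum_(i < N) (2^-1 : R) ^+ i <= 2.
Proof.
suff -> : \sum_(i < N) (2^-1 : R) ^+ i = 2 - 2 * 2^-1 ^+ N.
  by rewrite lerBlDr lerDl mulr_ge0// exprn_ge0// invr_ge0.
elim: N => [|N IH]; first by rewrite big_ord0 expr0; lra.
by rewrite big_ord_recr/= IH exprS; lra.
Qed.

(** * Almost sure convergence from summable integrals *)

Section ae_series.
Context d (T : measurableType d) (R : realType) (P : probability T R).

(** Monotone convergence bounds the integral of the sum of the [|g j|] by [C], so this sum is finite
    almost everywhere. The lemma stands in for Borel-Cantelli: terms with summable integrals tend to
    0 almost surely. *)
Lemma ae_cvg_series (g : nat -> T -> R) (C : R) :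
  (forall j, bounded_measurable (g j)) ->
  (forall N, \sum_(j < N) \int[P]_w `|g j w| <= C) ->
  {ae P, forall w, cvgn (series (fun j => g j w))}.
Proof.
move=> bg gC.
pose F w := (\sum_(0 <= j <oo) `|g j w|%:E)%E.
have mg j : measurable_fun setT (fun w => `|g j w|%:E).
  by apply/measurable_EFinP; case: (bounded_measurable_norm (bg j)).
have mF : measurable_fun setT F by apply: ge0_emeasurable_sum.
have intF : P.-integrable setT F.
  apply/integrableP; split=> //.
  rewrite (eq_integral F); last first.
    by move=> w _; rewrite gee0_abs// nneseries_ge0.
  rewrite integral_nneseries//.
  apply: le_lt_trans (ltry C); apply: lime_le.
    by apply: is_cvg_nneseries => j _ _; exact: integral_ge0.
  apply: nearW => N; rewrite big_mkord.
  under eq_bigr do rewrite (bounded_RintegralE P (bounded_measurable_norm (bg _))).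
  by rewrite sumEFin lee_fin gC.
apply: filterS (integrable_ae measurableT intF) => w /(_ I) Fw.
apply: normed_cvg; apply: nondecreasing_is_cvgn.
  by apply: nondecreasing_series => j _ _; exact: normr_ge0.
exists (fine (F w)) => _ [N _ <-].
rewrite -lee_fin fineK// /series/= -sumEFin.
exact: nneseries_lim_ge.
Qed.

Lemma ae_cvg_telescope (f_ : nat -> T -> R) (C : R) :
  (forall n, bounded_measurable (f_ n)) ->
  (forall N, \sum_(n < N) \int[P]_w `|f_ n.+1 w - f_ n w| <= C) ->
  {ae P, forall w, cvgn (fun n => f_ n w)}.
Proof.
move=> bf fC.
have bg n : bounded_measurable (fun w => f_ n.+1 w - f_ n w)
  by exact: bounded_measurableB.
apply: filterS (ae_cvg_series bg fC) => w cw.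
rewrite (_ : (fun n => f_ n w) = fun n => f_ 0%N w + series (telescope (f_ ^~ w)) n).
  by apply: is_cvgD; [exact: is_cvg_cst|exact: cw].
by apply/funext => n; rewrite -eq_sum_telescope.
Qed.

(** The upper limit is measurable whether or not the sequence converges; [fine] and the maximum with
    0 keep its values real and nonnegative on the exceptional null set too. *)
Lemma ae_cvg_limit (f_ : nat -> T -> R) :
  (forall n, measurable_fun setT (f_ n)) -> (forall n w, 0 <= f_ n w) ->
  {ae P, forall w, cvgn (fun n => f_ n w)} ->
  exists f : T -> R, [/\ measurable_fun setT f, forall w, 0 <= f w &
    {ae P, forall w, f_ n w @[n --> \oo] --> f w}].
Proof.
move=> mf f0 cf; exists (fun w => Num.max 0 (fine (limn_esup (fun n =>
  (f_ n w)%:E)))); split.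
- apply: measurable_maxr => //.
  apply: measurableT_comp => //; apply: measurable_fun_limn_esup => n.
  exact/measurable_EFinP.
- by move=> w; rewrite le_max lexx.
- apply: filterS cf => w cw.
  have /cvg_limn_einf_sup[_ ->]/= : (f_ n w)%:E @[n --> \oo] --> (limn (f_ ^~ w))%:E.
    by apply: cvg_EFin => //; exact: nearW.
  by rewrite max_r//; apply: limr_ge => //; exact: nearW.
Qed.

(* Approximate minimisers of a uniformly convex functional form an [L^2]-Cauchy
   sequence, hence converge almost surely along a fast enough choice. *)
Lemma ae_cvg_minimizers (C : set (T -> R)) (M m : R) (phi : (T -> R) -> R) :
  C !=set0 ->
  (forall f, C f -> measurable_fun setT f /\ forall w, 0 <= f w <= M) ->
  (forall f, C f -> m <= phi f) ->
  (forall f g, C f -> C g -> exists2 h, C h &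
    phi h <= (phi f + phi g) / 2 - (\int[P]_w (f w - g w) ^+ 2) / 4) ->
  exists (f_ : nat -> T -> R) (f : T -> R),
    [/\ measurable_fun setT f /\ (forall w, 0 <= f w <= M),
        forall n, C (f_ n), forall n g, C g -> phi (f_ n) <= phi g + 4^-1 ^+ n &
        {ae P, forall w, f_ n w @[n --> \oo] --> f w}].
Proof.
move=> [f0 Cf0] CM Cm Cmid.
have phi_inf : has_inf (phi @` C).
  by split; [exists (phi f0), f0 | exists m => _ [f Cf <-]; exact: Cm].
have pos4 n : 0 < 4^-1 ^+ n :> R by rewrite exprn_gt0// invr_gt0.
have /choice[f_ /all_and2[Cf_ f_inf]] n :
    exists f, C f /\ phi f < inf (phi @` C) + 4^-1 ^+ n.
  have [_ [f Cf <-] fn] := inf_adherent (pos4 n) phi_inf.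
  by exists f.
have infle g : C g -> inf (phi @` C) <= phi g.
  by move=> Cg; apply: ge_inf; [exact: phi_inf.2|exists g].
have bC f : C f -> bounded_measurable f.
  by move=> /CM[mf fM]; exact: bounded_measurable_itv fM.
pose g n w := f_ n.+1 w - f_ n w.
have bg n : bounded_measurable (g n) by apply: bounded_measurableB; exact: bC.
(* The competitor [h] stays above the infimum while both ends are within [4^-1 ^+ n] of it, so the
   quadratic gain is at most [4^-1 ^+ n]. *)
have g2 n : \int[P]_w (g n w) ^+ 2 <= 4 * 4^-1 ^+ n.
  have [h Ch hle] := Cmid _ _ (Cf_ n.+1) (Cf_ n).
  have := infle _ Ch; have := f_inf n; have := f_inf n.+1; rewrite exprS.
  have := pos4 n; rewrite -/(g n); lra.
(* Young's inequality [|x| <= (2 ^+ n * x ^+ 2 + 2^-1 ^+ n) / 2] turns the bound 4 of [g2] into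
   [(4 + 1) / 2]. *)
have g1 n : \int[P]_w `|g n w| <= 5 / 2 * 2^-1 ^+ n.
  have h w : `|g n w| <= 2^-1 * (2 ^+ n * (g n w) ^+ 2) + 2^-1 * 2^-1 ^+ n.
    have p2 : 0 < 2 ^+ n :> R by rewrite exprn_gt0.
    rewrite exprVn -[(g n w) ^+ 2]real_normK ?num_real//.
    have : 0 <= (2 ^+ n * `|g n w| - 1) ^+ 2 by exact: sqr_ge0.
    set x := `|_|; set y := 2 ^+ n => h; rewrite -subr_ge0.
    have -> : 2^-1 * (y * x ^+ 2) + 2^-1 / y - x = 2^-1 / y * (y * x - 1) ^+ 2.
      by field; rewrite gt_eqF.
    by rewrite mulr_ge0// mulr_ge0// invr_ge0 ltW.
  apply: le_trans (bounded_le_Rintegral P _ _ h) _.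
  - exact: bounded_measurable_norm.
  - apply: bounded_measurableD; last exact: bounded_measurable_cst.
    do 2 (apply: bounded_measurableM; first exact: bounded_measurable_cst).
    exact: bounded_measurable_sqr.
  have b2 : bounded_measurable (fun w => 2 ^+ n * g n w ^+ 2).
    apply: bounded_measurableM; first exact: bounded_measurable_cst.
    exact: bounded_measurable_sqr.
  rewrite bounded_RintegralD; last 2 first.
    by apply: bounded_measurableM => //; exact: bounded_measurable_cst.
    exact: bounded_measurable_cst.
  rewrite Rintegral_probability_cst !bounded_RintegralZ//;
    last exact: bounded_measurable_sqr.
  have := g2 n; have p2 : 0 < 2 ^+ n :> R by rewrite exprn_gt0.
  rewrite -(ler_pM2l p2) => g2n;
    apply: (@le_trans _ _ (2^-1 * (2 ^+ n * (4 * 4^-1 ^+ n)) + 2^-1 * 2^-1 ^+ n)).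
    by rewrite lerD2r ler_pM2l.
  rewrite !exprVn (_ : 4 = 2 ^+ 2 :> R) ?exprM; last by rewrite expr2 -natrM.
  rewrite -exprM mulnC exprM.
  set y := 2 ^+ n; rewrite le_eqVlt; apply/orP; left; apply/eqP; field.
  by rewrite gt_eqF.
have cf : {ae P, forall w, cvgn (fun n => f_ n w)}.
  apply: (@ae_cvg_telescope _ 5) => [n|N]; first by apply: bC.
  apply: (@le_trans _ _ (\sum_(i < N) 5 / 2 * 2^-1 ^+ i)).
    by apply: ler_sum => i _; exact: g1.
  by rewrite -mulr_sumr; have := sum_half_le R N; lra.
have [||f [mf f0' cff]] := ae_cvg_limit _ _ cf.
- by move=> n; have [] := CM _ (Cf_ n).
- by move=> n w; have [_ /(_ w)/andP[]] := CM _ (Cf_ n).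
have M0 : 0 <= M by have [_ /(_ point)/andP[]] := CM _ Cf0; exact: le_trans.
(* Clipping at [M] changes the limit on a null set only and makes the bound hold everywhere. *)
exists f_, (fun w => Num.min (f w) M); split => //.
- split; first exact: measurable_minr.
  by move=> w; rewrite le_min f0' M0 ge_min lexx orbT.
- move=> n g' Cg'; rewrite (le_trans (ltW (f_inf n)))// lerD2r; exact: infle.
- apply: filterS cff => w cw; rewrite min_l//.
  rewrite -(cvg_lim _ cw)//; apply: limr_le; first by apply/cvg_ex; exists (f w).
  by apply: nearW => n; have [_ /(_ w)/andP[]] := CM _ (Cf_ n).
Qed.

End ae_series.

(** * Weak limits along an ultrafilter *)

(** Compactness of [[- M, M]] gives a cluster point of the image filter, and an ultrafilter
    converges to each of its cluster points. *)
Lemma ultrafilter_cvg_bounded (R : realType) (I : Type) (U : set_system I)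
    {UU : UltraFilter U} (a : I -> R) (M : R) :
  (forall n, `|a n| <= M) -> cvg (a @ U).
Proof.
move=> aM.
have aU : (a @ U) `[- M, M]%classic by apply: (@filterE _ U) => n /=;
  rewrite in_itv/= -ler_norml.
have [l [_ al]] := @segment_compact R (- M) M (a @ U) _ aU.
apply/cvg_ex; exists l => V lV.
have [//|aVC] := in_ultra_setVsetC (a @^-1` V) UU.
by have [x [/= nVx Vx]] := al (~` V) V aVC lV.
Qed.

Section weak_limit.
Context d (T : measurableType d) (R : realType) (P : probability T R).
Context (U : set_system nat) {UU : UltraFilter U}.
Variables (f_ : nat -> T -> R) (M : R).
Hypothesis mf_ : forall n, measurable_fun setT (f_ n).
Hypothesis f_M : forall n w, 0 <= f_ n w <= M.

Let bf n : bounded_measurable (f_ n).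
Proof. exact: bounded_measurable_itv (f_M n). Qed.

Let bounded_cvg (g : nat -> T -> R) (K : R) :
  (forall n, bounded_measurable (g n)) -> (forall n w, `|g n w| <= K) ->
  cvg (\int[P]_w g n w @[n --> U]).
Proof.
move=> bg gK; apply: (@ultrafilter_cvg_bounded _ _ _ _ _ K) => n.
have K0 : \int[P]_w K = K by exact: Rintegral_probability_cst.
apply: le_trans (le_normr_Rintegral measurableT (bounded_integrable P (bg n))) _.
rewrite -[leRHS]K0; apply: bounded_le_Rintegral => //.
  exact: bounded_measurable_norm.
exact: bounded_measurable_cst.
Qed.

(** The asymptotic squared L^2 distance from the sequence to [g]. It exceeds its value at the weak
    limit by the squared distance of [g] to that limit, so the weak limit is its minimiser. *)
Let dist (g : T -> R) : R := lim (\int[P]_w (f_ n w - g w) ^+ 2 @[n --> U]).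

Let dist_cvg (g : T -> R) : bounded_measurable g ->
  \int[P]_w (f_ n w - g w) ^+ 2 @[n --> U] --> dist g.
Proof.
move=> bg; have [mg [N gN]] := bg.
apply: (@bounded_cvg (fun n w => (f_ n w - g w) ^+ 2) ((M + N) ^+ 2)) => [n|n w].
  by apply: bounded_measurable_sqr; exact: bounded_measurableB.
rewrite normrX lerXn2r ?nnegrE//.
  by have /andP[? ?] := f_M n w; have := gN w; have := normr_ge0 (g w); lra.
rewrite (le_trans (ler_normB _ _))// lerD//.
by have /andP[h1 h2] := f_M n w; rewrite ger0_norm.
Qed.

(** By the parallelogram identity, which passes to [dist], approximate minimisers of [dist]
    converge; stationarity at their limit [b] says that [f_ n - b] is asymptotically orthogonal to
    every bounded [g]. *)
Lemma ultrafilter_weak_limit : exists b : T -> R,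
  [/\ measurable_fun setT b, forall w, 0 <= b w <= M &
   forall g, bounded_measurable g ->
     \int[P]_w ((f_ n w - b w) * g w) @[n --> U] --> 0].
Proof.
have M0 : 0 <= M by have /andP[] := f_M 0%N point; exact: le_trans.
pose C := [set g : T -> R | measurable_fun setT g /\ forall w, 0 <= g w <= M].
have bC g : C g -> bounded_measurable g by move=> [mg gM];
  exact: bounded_measurable_itv gM.
have [|||f g Cf Cg|g_ [b [[mb bM] Cg_ g_min cg]]] :=
    @ae_cvg_minimizers _ _ _ P C M 0 dist.
- by exists (fun=> 0); split=> // w; rewrite lexx.
- by [].
- move=> g /bC bg; apply: limr_ge; first by apply/cvg_ex; exists (dist g);
    exact: dist_cvg.
  by apply: nearW => n; apply: Rintegral_ge0 => w _; exact: sqr_ge0.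
- pose h w := (f w + g w) / 2.
  have Ch : C h.
    split; first by apply: measurable_funM => //; apply: measurable_funD;
      [case: Cf|case: Cg].
    move=> w; have [_ /(_ w)/andP[]] := Cf; have [_ /(_ w)/andP[]] := Cg.
    by rewrite /h => h1 h2 h3 h4; apply/andP; split; lra.
  exists h => //.
  suff -> : dist h = (dist f + dist g) / 2 - (\int[P]_w (f w - g w) ^+ 2) / 4 by [].
  have bh := bC _ Ch; have {}bf' := bC _ Cf; have bg := bC _ Cg.
  have cE : (\int[P]_w (f_ n w - f w) ^+ 2 + \int[P]_w (f_ n w - g w) ^+ 2) / 2
      - (\int[P]_w (f w - g w) ^+ 2) / 4 @[n --> U] -->
      (dist f + dist g) / 2 - (\int[P]_w (f w - g w) ^+ 2) / 4.
    apply: cvgB; last exact: cvg_cst.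
    by apply: cvgM; [apply: cvgD; exact: dist_cvg|exact: cvg_cst].
  apply: cvg_lim => //; apply: cvg_trans cE; apply: near_eq_cvg; apply: nearW => n.
  have s1 : bounded_measurable (fun w => (f_ n w - f w) ^+ 2).
    by apply: bounded_measurable_sqr; exact: bounded_measurableB.
  have s2 : bounded_measurable (fun w => (f_ n w - g w) ^+ 2).
    by apply: bounded_measurable_sqr; exact: bounded_measurableB.
  have s3 : bounded_measurable (fun w => (f w - g w) ^+ 2).
    by apply: bounded_measurable_sqr; exact: bounded_measurableB.
  have c := @bounded_measurable_cst.
  rewrite -bounded_RintegralD// ![_ / _]mulrC -!bounded_RintegralZ//;
    last exact: bounded_measurableD.
  rewrite -bounded_RintegralB//; [|by apply: bounded_measurableM => //;
    exact: bounded_measurableD|exact: bounded_measurableM].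
  by apply: eq_Rintegral => w _; rewrite /h; field.
have bb : bounded_measurable b by exact: bounded_measurable_itv bM.
(* On functions with values in [[0, M]], [dist] is Lipschitz for the L^1 norm with constant [2 * M],
   so it passes to the limit of the approximate minimisers [g_]. *)
have dist_b g : C g -> dist b <= dist g.
  move=> Cg.
  have L1 : \int[P]_w `|b w - g_ k w| @[k --> \oo] --> 0.
    rewrite -[X in _ --> X](Rintegral_probability_cst P).
    apply: (@bounded_dominated_cvg _ _ _ _ _ _ (M + M)).
    - by move=> k; apply: measurableT_comp => //; apply: measurable_funB => //;
        case: (Cg_ k).
    - exact: measurable_cst.
    - move=> k w; rewrite normr_id (le_trans (ler_normB _ _))//.
      have /andP[? ?] := bM w; have [_ /(_ w)/andP[? ?]] := Cg_ k.
      by rewrite !ger0_norm// lerD.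
    - apply: filterS cg => w cw; rewrite -(normr0 R) -(subrr (b w)).
      by apply: cvg_norm; apply: cvgB => //; exact: cvg_cst.
  have bound k : dist b <= dist g + 4^-1 ^+ k + 2 * M * \int[P]_w `|b w - g_ k w|.
    have bk := bC _ (Cg_ k).
    apply: (@le_trans _ _ (dist (g_ k) + 2 * M * \int[P]_w `|b w - g_ k w|));
      last first.
      by rewrite lerD2r g_min.
    set c := _ * Rintegral _ _ _.
    have cE : \int[P]_w (f_ n w - g_ k w) ^+ 2 + c @[n --> U] --> dist (g_ k) + c.
      by apply: cvgD; [exact: dist_cvg|exact: cvg_cst].
    apply: (ler_cvg_to (dist_cvg bb) cE); apply: nearW => n; rewrite /c.
    rewrite -bounded_RintegralZ; last
      by apply/bounded_measurable_norm/bounded_measurableB.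
    have s1 : bounded_measurable (fun w => (f_ n w - g_ k w) ^+ 2).
      by apply: bounded_measurable_sqr; exact: bounded_measurableB.
    have s2 : bounded_measurable (fun w => 2 * M * `|b w - g_ k w|).
      apply: bounded_measurableM; first exact: bounded_measurable_cst.
      by apply/bounded_measurable_norm/bounded_measurableB.
    rewrite -bounded_RintegralD//; apply: bounded_le_Rintegral.
    - by apply: bounded_measurable_sqr; exact: bounded_measurableB.
    - exact: bounded_measurableD.
    - move=> w; have /andP[? ?] := bM w; have [_ /(_ w)/andP[? ?]] := Cg_ k.
      have /andP[? ?] := f_M n w.
      rewrite -lerBlDl (_ : _ - _ = (b w - g_ k w) * (b w + g_ k w - 2 * f_ n w));
        last by ring.
      rewrite (le_trans (ler_norm _))// normrM mulrC ler_wpM2r//.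
      by rewrite ler_norml; apply/andP; split; lra.
  have : dist g + 4^-1 ^+ k + 2 * M * \int[P]_w `|b w - g_ k w| @[k --> \oo] --> dist g + 0 + 2 * M * 0.
    apply: cvgD; last by apply: cvgM => //; exact: cvg_cst.
    apply: cvgD; first exact: cvg_cst.
    by apply: cvg_expr; rewrite ger0_norm ?invr_ge0// invf_lt1 ?ltr1n.
  rewrite mulr0 !addr0 => /(ler_cvg_to (cvg_cst (dist b))); apply.
  by apply: nearW.
exists b; split => // g bg.
have [mg [N gN]] := bg.
pose ip n := \int[P]_w ((f_ n w - b w) * g w).
have bip n : bounded_measurable (fun w => (f_ n w - b w) * g w).
  by apply: bounded_measurableM => //; exact: bounded_measurableB.
have cip : cvg (ip n @[n --> U]).
  apply: (@bounded_cvg (fun n w => (f_ n w - b w) * g w) ((M + M) * N)) => // n w.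
  rewrite normrM ler_pM// (le_trans (ler_normB _ _))//.
  have /andP[? ?] := bM w; have /andP[? ?] := f_M n w.
  by rewrite !ger0_norm// lerD.
set L := lim (ip n @[n --> U]); suff <- : L = 0 by exact: cip.
pose A := \int[P]_w (g w) ^+ 2.
have A0 : 0 <= A by apply: Rintegral_ge0 => w _; exact: sqr_ge0.
(* Clipping a competitor to [[0, M]] brings it closer to every [f_ n], so [b]
   also beats the unconstrained perturbations [b + t g]. *)
have var t : 2 * t * L <= t ^+ 2 * A.
  pose h w := Num.max 0 (Num.min (b w + t * g w) M).
  have Ch : C h.
    split.
      apply: measurable_maxr => //; apply: measurable_minr => //.
      by apply: measurable_funD => //; exact: measurable_funM.
    by move=> w; rewrite /h le_max lexx/= ge_max M0 ge_min lexx orbT.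
  have bt : bounded_measurable (fun w => b w + t * g w).
    by apply: bounded_measurableD => //; apply: bounded_measurableM => //;
      exact: bounded_measurable_cst.
  have h1 := dist_b _ Ch.
  have h2 : dist h <= dist (fun w => b w + t * g w).
    apply: (ler_cvg_to (dist_cvg (bC _ Ch)) (dist_cvg bt)); apply: nearW => n.
    apply: bounded_le_Rintegral.
    - by apply/bounded_measurable_sqr/bounded_measurableB => //; exact: bC.
    - exact/bounded_measurable_sqr/bounded_measurableB.
    - move=> w; rewrite -[leLHS]real_normK ?num_real// -[leRHS]real_normK ?num_real//.
      rewrite lerXn2r ?nnegrE//.
      have /andP[? ?] := f_M n w; rewrite /h; set x := b w + t * g w.
      rewrite /Num.max /Num.min.
      have := ler_norm (f_ n w - x); have := ler_norm (- (f_ n w - x)).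
      rewrite normrN; have := normr_ge0 (f_ n w - x); move: `|f_ n w - x| => y ? ? ?.
      by rewrite ler_norml; case: (ltP x M) => ?; case: ltP => ?; apply/andP; split;
        lra.
  have h3 : dist (fun w => b w + t * g w) = dist b - 2 * t * L + t ^+ 2 * A.
    have cE : \int[P]_w (f_ n w - b w) ^+ 2 - 2 * t * ip n + t ^+ 2 * A @[n --> U] -->
        dist b - 2 * t * L + t ^+ 2 * A.
      apply: cvgD; last exact: cvg_cst.
      by apply: cvgB; [exact: dist_cvg|apply: cvgM; [exact: cvg_cst|exact: cip]].
    apply: cvg_lim => //; apply: cvg_trans cE; apply: near_eq_cvg; apply: nearW => n.
    rewrite /ip /A -!bounded_RintegralZ//; last exact: bounded_measurable_sqr.
    have s1 : bounded_measurable (fun w => (f_ n w - b w) ^+ 2).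
      exact/bounded_measurable_sqr/bounded_measurableB.
    have s2 : bounded_measurable (fun w => 2 * t * ((f_ n w - b w) * g w)).
      by apply: bounded_measurableM => //; exact: bounded_measurable_cst.
    have s3 : bounded_measurable (fun w => t ^+ 2 * g w ^+ 2).
      by apply: bounded_measurableM;
        [exact: bounded_measurable_cst|exact: bounded_measurable_sqr].
    rewrite -bounded_RintegralB// -bounded_RintegralD//;
      last exact: bounded_measurableB.
    by apply: eq_Rintegral => w _; ring.
  by move: h1 h2; rewrite h3; lra.
apply/eqP; rewrite -sqrf_eq0; apply/eqP.
have A1 : 0 < A + 1 by lra.
(* The nearly optimal step [L / (A + 1)], where the 1 covers [A = 0], turns [var] into
   [2 * (A + 1) <= A] unless [L = 0]. *)
have := var (L / (A + 1)); have := sqr_ge0 L; rewrite le_eqVlt => /predU1P[//|L2].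
rewrite (_ : 2 * (L / (A + 1)) * L = (2 * (A + 1)) * (L ^+ 2 / (A + 1) ^+ 2));
  last by field; rewrite gt_eqF.
rewrite (_ : (L / (A + 1)) ^+ 2 * A = A * (L ^+ 2 / (A + 1) ^+ 2)); last by field;
  rewrite gt_eqF.
rewrite ler_pM2r; last by rewrite divr_gt0// exprn_gt0.
by move=> ?; lra.
Qed.

End weak_limit.

(** * The Komlos theorem for injections *)

Section real_sequences.
Context (R : realType).

(* Etemadi's sandwich: every large [k] lies between [s * 2 ^ j] and
   [(s + 1) * 2 ^ j] for some large [s], so monotone sums need to be controlled
   along these sequences only, where second moments are summable. *)
Lemma cvg_mean_dyadic (S : nat -> R) (b : R) :
  (forall k, 0 <= S k) -> {homo S : m n / (m <= n)%N >-> m <= n} ->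
  (forall s, S (s.+1 * 2 ^ j)%N / (s.+1 * 2 ^ j)%:R @[j --> \oo] --> b) ->
  S k.+1 / k.+1%:R @[k --> \oo] --> b.
Proof.
move=> S0 Snd Sb.
have b0 : 0 <= b.
  have := Sb 0%N => h; rewrite -(cvg_lim _ h)//.
  apply: limr_ge; first by apply/cvg_ex; exists b.
  by apply: nearW => j; rewrite divr_ge0.
apply/cvgrPdist_le => e e0.
have e2 : 0 < e / 2 by rewrite divr_gt0.
(* Replacing [s] by [s + 1] in an endpoint costs [(b + e / 2) / s], which is at most [e / 2] once
   [s > r]. *)
have [r rbig] : exists r : nat, b + e / 2 <= e / 2 * r.+1%:R.
  exists (Num.bound ((b + e / 2) / (e / 2))).
  rewrite [leRHS]mulrC -ler_pdivrMr//;
    apply: (@le_trans _ _ (Num.bound ((b + e / 2) / (e / 2)))%:R).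
    by apply: ltW; apply: archi_boundP; rewrite divr_ge0 ?addr_ge0// ltW.
  by rewrite ler_nat.
have /choice[N_ N_P] s : exists N, forall j, (N <= j)%N ->
    `|b - S (s.+1 * 2 ^ j)%N / (s.+1 * 2 ^ j)%:R| <= e / 2.
  by have /cvgrPdist_le/(_ _ e2)[N _ NP] := Sb s; exists N => j /NP.
pose N := (\max_(s < (2 * r.+1).+1) N_ s)%N.
exists (r.+1 * 2 ^ N)%N => //= k0 kN; set k := k0.+1.
have {}kN : (r.+1 * 2 ^ N <= k)%N by rewrite (leq_trans kN).
(* The largest [j] with [r.+1 * 2 ^ j <= k]: the quotient [s] of [k] by [2 ^ j] then lies in [[r.+1,
   2 * r.+1[], so finitely many sequences, controlled by [N], suffice. *)
pose j := trunc_log 2 (k %/ r.+1).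
have qN : (2 ^ N <= k %/ r.+1)%N by rewrite leq_divRL// mulnC.
have q0 : (0 < k %/ r.+1)%N by rewrite (leq_trans _ qN)// expn_gt0.
have /andP[j1 j2] := trunc_log_bounds (isT : 1 < 2)%N q0.
have Nj : (N <= j)%N by exact: trunc_log_max.
have {}j1 : (r.+1 * 2 ^ j <= k)%N by move: j1; rewrite leq_divRL// mulnC.
have {}j2 : (k < r.+1 * 2 ^ j.+1)%N by move: j2; rewrite ltn_divLR// mulnC.
have t0 : (0 < 2 ^ j)%N by rewrite expn_gt0.
pose s := (k %/ 2 ^ j)%N.
have rs : (r.+1 <= s)%N by rewrite leq_divRL.
have s2r : (s < 2 * r.+1)%N by rewrite ltn_divLR// (leq_trans j2)// expnS mulnCA mulnA.
have sk : (s * 2 ^ j <= k)%N by rewrite leq_trunc_div.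
have ks : (k <= s.+1 * 2 ^ j)%N by rewrite ltnW// ltn_ceil.
have Ns i : (i <= 2 * r.+1)%N -> `|b - S (i.+1 * 2 ^ j)%N / (i.+1 * 2 ^ j)%:R| <= e / 2.
  move=> ir; apply: N_P; apply: leq_trans Nj.
  exact: (@leq_bigmax _ (fun i : 'I_(2 * r.+1).+1 =>
    N_ i) (Ordinal (ir : (i < (2 * r.+1).+1)%N))).
have lo := Ns s.-1 (leq_trans (leq_pred _) (ltnW s2r)).
rewrite prednK in lo; last exact: leq_trans rs.
have hi := Ns s (ltnW s2r).
have t0R : 0 < (2 ^ j)%:R :> R by rewrite ltr0n.
have sR : r.+1%:R <= s%:R :> R by rewrite ler_nat.
have r0R : 0 < r.+1%:R :> R by rewrite ltr0n.
have s0R : 0 < s%:R :> R by apply: lt_le_trans sR.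
have kR : 0 < k%:R :> R by rewrite ltr0n.
have skR : s%:R * (2 ^ j)%:R <= k%:R :> R by rewrite -natrM ler_nat.
have ksR : k%:R <= (s%:R + 1) * (2 ^ j)%:R :> R by rewrite natr1 -natrM ler_nat.
move: lo hi; rewrite !ler_distl !natrM -[s.+1%:R]natr1 => /andP[lo1 lo2] /andP[hi1 hi2].
have Slo := Snd _ _ sk; have Shi := Snd _ _ ks.
set t : R := (2 ^ j)%:R in t0R skR ksR lo1 lo2 hi1 hi2.
have s1R : 0 < s%:R + 1 :> R by rewrite addr_gt0.
move: lo1 lo2 hi1 hi2.
set Sl := S (s * _)%N in Slo *; set Sh := S (_ * _)%N in Shi *.
move=> _ lo2 hi1 _.
have {}hi1 : Sh <= (b + e / 2) * ((s%:R + 1) * t).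
  by rewrite -ler_pdivrMr ?mulr_gt0//; lra.
have {}lo2 : (b - e / 2) * (s%:R * t) <= Sl.
  by rewrite -ler_pdivlMr ?mulr_gt0//; lra.
have rt : (b + e / 2) * t <= e / 2 * (s%:R * t).
  rewrite mulrA ler_pM2r//; apply: le_trans rbig _.
  by rewrite ler_pM2l.
apply/andP; split.
- rewrite lerBlDr ler_pdivrMr//.
  apply: le_trans Shi _; apply: le_trans hi1 _.
  apply: (@le_trans _ _ ((b + e) * (s%:R * t))); last by rewrite ler_wpM2l//; lra.
  rewrite -subr_ge0.
  have -> : (b + e) * (s%:R * t) - (b + e / 2) * ((s%:R + 1) * t) =
    e / 2 * (s%:R * t) - (b + e / 2) * t by field.
  by rewrite subr_ge0.
- rewrite -lerBlDr ler_pdivlMr//.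
  have [be|be] := leP 0 (b - e); last by rewrite (le_trans _ (S0 _))// nmulr_rle0// ltW.
  apply: (@le_trans _ _ ((b - e) * ((s%:R + 1) * t))); first by rewrite ler_wpM2l.
  apply: le_trans Slo; apply: le_trans lo2; rewrite -subr_ge0.
  have -> : (b - e / 2) * (s%:R * t) - (b - e) * ((s%:R + 1) * t) =
    e / 2 * (s%:R * t) - (b + e / 2) * t + (3 / 2 * e) * t by field.
  by rewrite addr_ge0 ?subr_ge0// !mulr_ge0// ltW.
Qed.

(** For fixed [i], the weights of the sums that contain [v i] form a geometric progression of ratio
    1/4 whose first term is at most [i.+1%:R ^- 2]; hence the factor 4/3. *)
Lemma sum_dyadic_mean_le (v : nat -> R) (V : R) (s : nat) :
  (forall i, 0 <= v i) ->
  (forall N, \sum_(i < N) v i / i.+1%:R ^+ 2 <= V) ->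
  forall J, \sum_(j < J) (\sum_(i < s.+1 * 2 ^ j) v i) / (s.+1 * 2 ^ j)%:R ^+ 2
    <= 4 / 3 * V.
Proof.
move=> v0 vV J.
pose A j := (\sum_(i < s.+1 * 2 ^ j) v i) / (s.+1 * 2 ^ j)%:R ^+ 2.
have V0 : 0 <= V by have := vV 0%N; rewrite big_ord0.
have A0 j : 0 <= A j by rewrite divr_ge0 ?sumr_ge0// exprn_ge0.
case: J => [|J]; first by rewrite big_ord0 mulr_ge0.
(* [A J / 3] is the rest of the geometric series, the later contribution of the [v i] already
   counted; with it the induction closes. *)
suff : \sum_(j < J.+1) A j + A J / 3 <=
    4 / 3 * \sum_(i < s.+1 * 2 ^ J) v i / i.+1%:R ^+ 2.
  move=> h; have := vV (s.+1 * 2 ^ J)%N; have := A0 J.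
  by rewrite -/(\sum_(j < J.+1) A j); move: h; lra.
have term i N : (i < N)%N -> v i / N%:R ^+ 2 <= v i / i.+1%:R ^+ 2.
  move=> iN; have N0 : (0 < N)%N by exact: leq_ltn_trans iN.
  rewrite ler_wpM2l// lef_pV2 ?posrE ?exprn_gt0 ?ltr0n//.
  by rewrite lerXn2r ?nnegrE// ler_nat.
elim: J => [|J IH].
  rewrite big_ord1.
  have : A 0%N <= \sum_(i < s.+1 * 2 ^ 0) v i / i.+1%:R ^+ 2.
    by rewrite /A mulr_suml; apply: ler_sum => i _; exact: term.
  lra.
rewrite big_ord_recr/=.
set B := \sum_(i < s.+1 * 2 ^ J.+1) _; set B0 := \sum_(i < s.+1 * 2 ^ J) _ in IH.
have step : A J.+1 <= A J / 4 + (B - B0).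
  have JJ : (s.+1 * 2 ^ J <= s.+1 * 2 ^ J.+1)%N
    by rewrite leq_mul2l leq_exp2l// leqnSn orbT.
  have ordE (w : nat -> R) N : \sum_(i < N) w i = \sum_(0 <= i < N) w i
    by rewrite big_mkord.
  rewrite /B /B0 (ordE (fun i => v i / i.+1%:R ^+ 2) (s.+1 * 2 ^ J.+1)%N).
  rewrite (big_cat_nat (leq0n _) JJ)/= -(ordE (fun i => v i / i.+1%:R ^+ 2)).
  rewrite [X in _ <= _ + X]addrAC subrr add0r.
  rewrite /A ordE (big_cat_nat (leq0n _) JJ)/= mulrDl.
  apply: lerD.
    rewrite big_mkord expnS mulnCA natrM exprMn le_eqVlt; apply/orP; left; apply/eqP.
    by field; rewrite !pnatr_eq0 expn_eq0/= -?natr1 ?pnatr_eq0 ?natr1 ?pnatr_eq0.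
  by rewrite mulr_suml; apply: ler_sum_nat => i /andP[_ iJ]; exact: term.
move: IH step; lra.
Qed.

Lemma sum_injective_le (u : nat -> R) (C : R) (sigma : nat -> nat) :
  (forall i, 0 <= u i) -> (forall N, \sum_(i < N) u i <= C) ->
  injective sigma -> forall k, \sum_(i < k) u (sigma i) <= C.
Proof.
move=> u0 uC sI k.
pose N := (\max_(i < k) sigma i).+1.
apply: le_trans (uC N).
have hN (i : 'I_k) : (sigma i < N)%N.
  by rewrite ltnS; exact: (@leq_bigmax _ (fun i : 'I_k => sigma i)).
pose h (i : 'I_k) : 'I_N := Ordinal (hN i).
have hI : injective h by move=> i j [/sI]; exact: val_inj.
rewrite (eq_bigr (fun i => u (h i)))//.
rewrite -(big_imset (fun a : 'I_N => u a) (in2W hI)) big_mkcond.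
by apply: ler_sum => a _; case: ifP.
Qed.

Lemma injective_cvg_infty (sigma : nat -> nat) : injective sigma ->
  forall M, exists K, forall i, (K <= i)%N -> (M <= sigma i)%N.
Proof.
move=> sI; elim=> [|M [K KM]]; first by exists 0%N.
have [[i0 i0M]|nM] := pselect (exists i, sigma i = M).
  exists (maxn K i0.+1) => i; rewrite geq_max => /andP[Ki i0i].
  rewrite ltn_neqAle KM// andbT; apply/eqP => Mi.
  by move: i0i; rewrite (sI i i0) ?ltnn// -Mi.
exists K => i Ki; rewrite ltn_neqAle KM// andbT; apply/eqP => Mi.
by apply: nM; exists i.
Qed.

(** Terms with [p.+1 <= x] equal 1 and there are at most [x] of them; the others add up to [x ^+ 2]
    times a tail of the inverse squares, again of order [x]. The right-hand side is truncated too,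
    so that only truncated means occur after integration. *)
Lemma sum_truncated_sqr_le (x : R) : 0 <= x -> forall N,
  \sum_(p < N) (Num.min x p.+1%:R) ^+ 2 / p.+1%:R ^+ 2 <= 3 * Num.min x N%:R.
Proof.
move=> x0 N.
pose f (N : nat) : R := \sum_(p < N) (Num.min x p.+1%:R) ^+ 2 / p.+1%:R ^+ 2.
(* The subtracted [x ^+ 2 / N%:R] reserves room for the terms still to come. *)
suff [h1 h2] : (N%:R <= x -> f N <= N%:R) /\ (x < N%:R -> f N <= 3 * x - x ^+ 2 / N%:R).
  rewrite -/(f N); have [xN|xN] := ltP x N%:R.
    by rewrite (le_trans (h2 xN))// lerBlDr lerDl divr_ge0// sqr_ge0.
  by rewrite (le_trans (h1 xN))// ler_peMl// ler1n.
elim: N => [|N [h1 h2]].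
  by split=> [_|]; [rewrite /f big_ord0|rewrite ltNge x0].
rewrite /f !big_ord_recr/= -/(f N).
have N1 : 0 < N.+1%:R :> R by rewrite ltr0n.
split=> [Nx|xN].
  rewrite min_r// divff ?expf_neq0 ?gt_eqF// -natr1 lerD2r h1//.
  by apply: le_trans Nx; rewrite ler_nat.
rewrite min_l ?(ltW xN)//.
have q1 : x / N.+1%:R <= 1 by rewrite ler_pdivrMr// mul1r ltW.
have q0 : 0 <= x / N.+1%:R by rewrite divr_ge0// ltW.
have [Nx|Nx] := leP N%:R x.
  have := h1 Nx.
  have e1 : x ^+ 2 / N.+1%:R ^+ 2 <= x.
    rewrite (_ : _ / _ = x * (x / N.+1%:R * N.+1%:R^-1)); last by field; rewrite gt_eqF.
    by rewrite ler_piMr// mulr_ile1// ?invr_ge0// invf_le1// ler1n.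
  have e2 : x ^+ 2 / N.+1%:R <= x.
    by rewrite expr2 -mulrA ler_piMr.
  by move: e1 e2 Nx; move: (_ / _) (_ / _) (f N) N%:R => a b c k; lra.
have N0 : 0 < N%:R :> R by exact: le_lt_trans Nx.
apply: le_trans (lerD (h2 Nx) (lexx _)) _.
rewrite -subr_ge0.
have -> : 3 * x - x ^+ 2 / N.+1%:R - (3 * x - x ^+ 2 / N%:R + x ^+ 2 / N.+1%:R ^+ 2) =
   x ^+ 2 * (N%:R^-1 / N.+1%:R ^+ 2).
  have n1 : N.+1%:R = N%:R + 1 :> R by rewrite natr1.
  by rewrite n1 in N1 *; field; rewrite !gt_eqF.
by rewrite mulr_ge0 ?sqr_ge0// divr_ge0 ?invr_ge0 ?exprn_ge0// ltW.
Qed.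

Lemma sum_inv_sqr_le N : \sum_(i < N) (i.+1%:R ^+ 2)^-1 <= 2 :> R.
Proof.
suff : \sum_(i < N.+1) (i.+1%:R ^+ 2)^-1 <= 2 - N.+1%:R^-1 :> R.
  rewrite big_ord_recr/= => h.
  apply: le_trans (le_trans _ h) _; first by rewrite lerDl invr_ge0 exprn_ge0.
  by rewrite gerBl invr_ge0.
elim: N => [|N IH]; first by rewrite big_ord1 expr1n invr1; lra.
rewrite big_ord_recr/=; apply: le_trans (lerD IH (lexx _)) _.
have N1 : 0 < N.+1%:R :> R by rewrite ltr0n.
have N2 : 0 < N.+2%:R :> R by rewrite ltr0n.
rewrite -subr_ge0 (_ : _ - _ = N.+1%:R^-1 / N.+2%:R ^+ 2).
  by rewrite divr_ge0 ?invr_ge0 ?exprn_ge0// ltW.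
have n2 : N.+2%:R = N.+1%:R + 1 :> R by rewrite natr1.
by rewrite n2 in N2 *; move: N1 N2; move: N.+1%:R => a a0 a1; field; rewrite !gt_eqF.
Qed.

End real_sequences.

Lemma filter_forall_leq (I : Type) (F : set_system I) {FF : Filter F}
    (Q : nat -> I -> Prop) (b : nat) :
  (forall p, \forall n \near F, Q p n) ->
  \forall n \near F, forall p, (p <= b)%N -> Q p n.
Proof.
move=> QF; elim: b => [|b IH].
  by apply: filterS (QF 0%N) => n Qn p; rewrite leqn0 => /eqP ->.
apply: filterS2 IH (QF b.+1) => n IHn Qn p.
by rewrite leq_eqVlt => /predU1P[->//|]; exact: IHn.
Qed.

(** Each new index has to satisfy conditions against all earlier ones. They are finitely many and
    each holds along [F], which contains the cofinite sets, so an admissible larger index exists. *)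
Lemma increasing_selection (F : set_system nat) {FF : ProperFilter F}
    (A0 : nat -> nat -> Prop) (A : nat -> nat -> nat -> Prop) :
  \oo `<=` F ->
  (forall b, \forall n \near F, A0 b n) ->
  (forall b m, \forall n \near F, A b m n) ->
  exists n_, [/\ subsequence n_, forall b, A0 b (n_ b) &
    forall a b, (a < b)%N -> A b (n_ a) (n_ b)].
Proof.
move=> ooF FA0 FA.
(* The condition is imposed against every number up to the last index, chosen or not, so the
   recursion has to remember only that index. *)
have /choice[nxt nxtP] (bm : nat * nat) : exists n, [/\ A0 bm.1 n, (bm.2 < n)%N &
    forall m, (m <= bm.2)%N -> A bm.1 m n].
  apply: (@filter_ex _ F).
  have Fgt : F [set n | (bm.2 < n)%N] by apply: ooF; exact: nbhs_infty_gt.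
  by apply: filterS3 (FA0 bm.1) Fgt (filter_forall_leq bm.2 (FA bm.1)) => n.
pose n_ := fix n_ b := if b is b'.+1 then nxt (b, n_ b') else nxt (0%N, 0%N).
have n_S b : (n_ b < n_ b.+1)%N by have [] := nxtP (b.+1, n_ b).
have n_lt : subsequence n_ by apply: (homo_ltn ltn_trans).
exists n_; split=> // [[|b]|a [//|b]]; first by have [] := nxtP (0%N, 0%N).
  by have [] := nxtP (b.+1, n_ b).
rewrite ltnS => ab; have [_ _] := nxtP (b.+1, n_ b); apply.
by rewrite leq_eqVlt in ab; case/predU1P: ab => [->//|/n_lt/ltnW].
Qed.

(** * Truncations, their weak limits, and the strong law along injections *)

Section komlos.
Context d (T : measurableType d) (R : realType) (P : probability T R).
Variables (f_ : nat -> T -> R) (C : R).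
Hypothesis mf_ : forall n, measurable_fun setT (f_ n).
Hypothesis f0 : forall n w, 0 <= f_ n w.
Hypothesis fC : forall n p, \int[P]_w Num.min (f_ n w) p.+1%:R <= C.

Let g p n w : R := Num.min (f_ n w) p.+1%:R.

Let g_itv p n w : 0 <= g p n w <= p.+1%:R.
Proof. by rewrite /g le_min f0 ler0n/= ge_min lexx orbT. Qed.

Let mg p n : measurable_fun setT (g p n).
Proof. exact: measurable_minr. Qed.

Let bg p n : bounded_measurable (g p n).
Proof. exact: bounded_measurable_itv (g_itv p n). Qed.

Let C0 : 0 <= C.
Proof. by apply: le_trans (fC 0%N 0%N); apply: Rintegral_ge0 => w _;
  have /andP[] := g_itv 0 0 w. Qed.

Context (U : set_system nat) {UU : UltraFilter U}.

Let H p : R := lim (\int[P]_w (g p n w) ^+ 2 @[n --> U]).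

Let H_cvg p : \int[P]_w (g p n w) ^+ 2 @[n --> U] --> H p.
Proof.
apply: (@ultrafilter_cvg_bounded _ _ _ _ _ (p.+1%:R ^+ 2)) => n.
rewrite ger0_norm; last by apply: Rintegral_ge0 => w _; exact: sqr_ge0.
rewrite -[leRHS](Rintegral_probability_cst P); apply: bounded_le_Rintegral.
- exact: bounded_measurable_sqr.
- exact: bounded_measurable_cst.
- by move=> w; have /andP[? ?] := g_itv p n w; rewrite lerXn2r ?nnegrE.
Qed.

Let isH_cvg p : cvg (\int[P]_w (g p n w) ^+ 2 @[n --> U]).
Proof. by apply/cvg_ex; exists (H p); exact: H_cvg. Qed.

Let H0 p : 0 <= H p.
Proof.
by apply: limr_ge => //; apply: nearW => n; apply: Rintegral_ge0 => w _; exact: sqr_ge0.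
Qed.

Let H_nd p q : (p <= q)%N -> H p <= H q.
Proof.
move=> pq; apply: (ler_cvg_to (@H_cvg p) (@H_cvg q)); apply: nearW => n.
apply: bounded_le_Rintegral => [||w];
  [exact: bounded_measurable_sqr|exact: bounded_measurable_sqr|].
have /andP[? ?] := g_itv p n w; have /andP[? ?] := g_itv q n w.
rewrite lerXn2r ?nnegrE// /g le_min ge_min lexx/= ge_min.
by rewrite ler_nat ltnS pq orbT.
Qed.

(** Obtained by integrating [sum_truncated_sqr_le] and passing to the limit; this replaces the
    summability of truncated variances in Etemadi's proof. *)
Let H_sum N : \sum_(p < N) H p / p.+1%:R ^+ 2 <= 3 * C.
Proof.
have cS : \sum_(p < N) (\int[P]_w (g p n w) ^+ 2) / p.+1%:R ^+ 2 @[n --> U] -->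
    \sum_(p < N) H p / p.+1%:R ^+ 2.
  apply: cvg_big => [|p _]; first exact: add_continuous.
  by apply: cvgM; [exact: H_cvg|exact: cvg_cst].
rewrite -(cvg_lim _ cS)//; apply: limr_le.
  by apply/cvg_ex; exists (\sum_(p < N) H p / p.+1%:R ^+ 2).
apply: nearW => n; case: N {cS} => [|N]; first by rewrite big_ord0 mulr_ge0.
have bh (p : 'I_N.+1) : bounded_measurable (fun w => p.+1%:R ^- 2 * (g p n w) ^+ 2).
  by apply: bounded_measurableM;
    [exact: bounded_measurable_cst|exact: bounded_measurable_sqr].
under eq_bigr => p _ do rewrite mulrC -(bounded_RintegralZ P _ (bounded_measurable_sqr (bg p n))).
rewrite -bounded_Rintegral_sum//.
apply: (@le_trans _ _ (3 * \int[P]_w g N n w)); last by rewrite ler_pM2l//; exact: fC.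
rewrite -bounded_RintegralZ//; apply: bounded_le_Rintegral.
- exact: bounded_measurable_sum.
- by apply: bounded_measurableM => //; exact: bounded_measurable_cst.
- move=> w; under eq_bigr do rewrite mulrC.
  exact: sum_truncated_sqr_le.
Qed.

Variable b_ : nat -> T -> R.
Hypothesis mb_ : forall p, measurable_fun setT (b_ p).
Hypothesis b_itv : forall p w, 0 <= b_ p w <= p.+1%:R.
Hypothesis b_weak : forall p h, bounded_measurable h ->
  \int[P]_w ((g p n w - b_ p w) * h w) @[n --> U] --> 0.

Let bb p : bounded_measurable (b_ p).
Proof. exact: bounded_measurable_itv (b_itv p). Qed.

(** In [(g - b)^2 = g^2 - 2 (g - b) b - b^2] the middle term vanishes along [U] and the last one
    helps. The slack 1 is 1/3 for the first term plus twice 1/3 for the second. *)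
Let b_sqr p : \forall n \near U, \int[P]_w (g p n w - b_ p w) ^+ 2 <= H p + 1.
Proof.
have c1 := @H_cvg p; have c2 := @b_weak p _ (bb p).
have h1 : 0 < 1 / 3 :> R by [].
have /cvgrPdist_lt/(_ _ h1) n1 := c1.
have /cvgrPdist_lt/(_ _ h1) n2 := c2.
apply: filterS2 n1 n2 => n; rewrite sub0r normrN => n1 n2.
have s1 : bounded_measurable (fun w => g p n w ^+ 2) by exact: bounded_measurable_sqr.
have s2 : bounded_measurable (fun w => 2 * ((g p n w - b_ p w) * b_ p w)).
  apply: bounded_measurableM; first exact: bounded_measurable_cst.
  by apply: bounded_measurableM => //; exact: bounded_measurableB.
have s3 : bounded_measurable (fun w => (g p n w - b_ p w) * b_ p w).
  by apply: bounded_measurableM => //; exact: bounded_measurableB.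
apply: (@le_trans _ _ (\int[P]_w (g p n w ^+ 2 - 2 * ((g p n w - b_ p w) * b_ p w)))).
  apply: bounded_le_Rintegral.
  - by apply: bounded_measurable_sqr; exact: bounded_measurableB.
  - exact: bounded_measurableB.
  - move=> w; rewrite -subr_ge0; set x := g p n w; set y := b_ p w.
    have -> : x ^+ 2 - 2 * ((x - y) * y) - (x - y) ^+ 2 = y ^+ 2 by ring.
    exact: sqr_ge0.
rewrite bounded_RintegralB// bounded_RintegralZ//.
move: n1 n2; rewrite ltr_distl ltr_norml => /andP[? ?] /andP[? ?]; lra.
Qed.

Let b_mean p : \int[P]_w b_ p w <= C.
Proof.
have b1 : bounded_measurable (fun=> 1 : R) := @bounded_measurable_cst _ T R 1.
have c1 : \int[P]_w b_ p w + \int[P]_w ((g p n w - b_ p w) * 1) @[n --> U] --> \int[P]_w b_ p w + 0.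
  by apply: cvgD; [exact: cvg_cst|exact: b_weak].
rewrite addr0 in c1; rewrite -(cvg_lim _ c1)//.
apply: limr_le; first by apply/cvg_ex; exists (\int[P]_w b_ p w).
apply: nearW => n; rewrite -bounded_RintegralD//; last first.
  by apply: bounded_measurableM => //; exact: bounded_measurableB.
apply: le_trans (fC n p); rewrite le_eqVlt; apply/orP; left; apply/eqP.
by apply: eq_Rintegral => w _; rewrite /g; ring.
Qed.

(** Testing both weak limits against the indicator of the set where the inequality fails bounds the
    integral of the positive part of [b_ p - b_ p.+1] by 0. *)
Let b_nd p : {ae P, forall w, b_ p w <= b_ p.+1 w}.
Proof.
pose h w : R := Num.max (b_ p w - b_ p.+1 w) 0.
pose A := [set w | 0 < b_ p w - b_ p.+1 w].
have mA : measurable A.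
  rewrite -[A]setTI; rewrite (_ : A = (fun w => b_ p w - b_ p.+1 w) @^-1` `]0, +oo[).
    by apply: (measurable_funB (mb_ p) (mb_ p.+1)) => //.
  by apply/seteqP; split => w /=; rewrite in_itv/= andbT.
have bA := bounded_measurable_indic R mA.
have hE w : h w = (b_ p w - b_ p.+1 w) * \1_A w.
  rewrite /h indicE; case: (boolP (w \in A)); rewrite ?inE /A/=.
    by move=> /ltW ?; rewrite max_l// mulr1.
  by rewrite notin_setE/= => /negP; rewrite -leNgt => ?; rewrite max_r// mulr0.
have bh : bounded_measurable h.
  rewrite (_ : h = fun w => (b_ p w - b_ p.+1 w) * \1_A w); last exact/funext.
  by apply: bounded_measurableM => //; exact: bounded_measurableB.
have h0 w : 0 <= h w by rewrite le_max lexx orbT.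
have inth : \int[P]_w h w <= 0.
  have c : \int[P]_w ((g p.+1 n w - b_ p.+1 w) * \1_A w) -
      \int[P]_w ((g p n w - b_ p w) * \1_A w) @[n --> U] --> (0 - 0 : R).
    by apply: cvgB; exact: b_weak.
  rewrite subr0 in c; rewrite -(cvg_lim _ c)//.
  apply: limr_ge; first by apply/cvg_ex; exists 0.
  apply: nearW => n.
  have bgb q : bounded_measurable (fun w => (g q n w - b_ q w) * \1_A w).
    by apply: bounded_measurableM => //; exact: bounded_measurableB.
  rewrite -bounded_RintegralB//; apply: bounded_le_Rintegral => //.
    exact: bounded_measurableB.
  move=> w; rewrite hE -subr_ge0.
  have -> : (g p.+1 n w - b_ p.+1 w) * \1_A w - (g p n w - b_ p w) * \1_A w -
    (b_ p w - b_ p.+1 w) * \1_A w = (g p.+1 n w - g p n w) * \1_A w by ring.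
  rewrite mulr_ge0 ?indicE// subr_ge0 /g le_min ge_min lexx/= ge_min.
  by rewrite ler_nat leqnSn orbT.
have : ae_eq P setT (EFin \o h) (cst 0).
  apply/ae_eq_integral_abs => //; first by apply/measurable_EFinP; case: bh.
  under eq_integral do rewrite /= ger0_norm//.
  rewrite bounded_RintegralE//; congr EFin; apply/eqP; rewrite eq_le inth/=.
  by apply: Rintegral_ge0.
apply: filterS => w /(_ I)/= [] hw0.
by rewrite -subr_le0 -hw0 le_max lexx.
Qed.

Let b_cvg : {ae P, forall w, cvgn (fun p => b_ p w)}.
Proof.
have bB p : bounded_measurable (fun w => b_ p.+1 w - b_ p w)
  by exact: bounded_measurableB.
apply: (@ae_cvg_telescope _ _ _ P _ C) => // N.
under eq_bigr => p _.
  rewrite (@ae_eq_Rintegral _ _ _ P _ (fun w => b_ p.+1 w - b_ p w)); last 3 first.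
    exact: bounded_measurable_norm.
    exact: bB.
    by apply: filterS (b_nd p) => w ?; rewrite ger0_norm// subr_ge0.
  rewrite bounded_RintegralB//; over.
rewrite /= -(big_mkord xpredT (fun p =>
  \int[P]_w b_ p.+1 w - \int[P]_w b_ p w)) telescope_sumr//.
apply: le_trans (b_mean N); rewrite gerBl.
by apply: Rintegral_ge0 => w _; have /andP[] := b_itv 0%N w.
Qed.

Section path.
Variable n_ : nat -> nat.
Hypothesis n_sqr : forall b p, (p <= b)%N -> \int[P]_w (g p (n_ b) w) ^+ 2 <= H p + 1.
Hypothesis n_dev : forall b p, (p <= b)%N ->
  \int[P]_w (g p (n_ b) w - b_ p w) ^+ 2 <= H p + 1.
Hypothesis n_cross : forall a b, (a < b)%N -> forall p q, (p <= b)%N -> (q <= b)%N ->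
  `|\int[P]_w ((g p (n_ a) w - b_ p w) * (g q (n_ b) w - b_ q w))| <= 4^-1 ^+ b.

Variable B : T -> R.
Hypothesis b_B : {ae P, forall w, b_ p w @[p --> \oo] --> B w}.

Variable sigma : nat -> nat.
Hypothesis sigmaI : injective sigma.

(* Capping the level at the position [i] keeps the second moments summable, and
   capping it at the index [sigma i] leaves finitely many levels to decorrelate
   when [n_ (sigma i)] is chosen. Each level occurs at most twice. *)
Let m i := minn i (sigma i).
Let D i w := g (m i) (n_ (sigma i)) w - b_ (m i) w.

Let bD i : bounded_measurable (D i).
Proof. exact: bounded_measurableB. Qed.

(** A budget for second moments: [H i + 1] for a diagonal term, and 4, the square of a geometric
    sum, to cover the cross terms. In [V], [3 * C] comes from [H_sum] and 10 is 5 times the bound 2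
    on the inverse squares. *)
Let v i := H i + 5.

Let V := 3 * C + 10.

Let v_sum N : \sum_(i < N) v i / i.+1%:R ^+ 2 <= V.
Proof.
under eq_bigr do rewrite /v mulrDl.
rewrite big_split/=; apply: lerD; first exact: H_sum.
rewrite -mulr_sumr (_ : 10 = 5 * 2); last by ring.
by rewrite ler_pM2l// sum_inv_sqr_le.
Qed.

(** [n_cross] bounds by the larger index alone; weakening this to a product lets the double sum
    factor into a square, in whatever order [sigma] lists the indices. *)
Let D_cross i j : i != j -> \int[P]_w (D i w * D j w) <= 2^-1 ^+ sigma i * 2^-1 ^+ sigma j.
Proof.
wlog ij : i j / (sigma i < sigma j)%N.
  move=> ih ne; case: (ltngtP (sigma i) (sigma j)) => [h|h|/sigmaI h]; first exact: ih.
    rewrite mulrC; under eq_Rintegral do rewrite mulrC.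
    by apply: ih; rewrite // eq_sym.
  by rewrite h eqxx in ne.
move=> _; rewrite (le_trans (ler_norm _))// (le_trans (n_cross ij _ _))//.
- by rewrite /m (leq_trans (geq_minr _ _))// ltnW.
- by rewrite /m geq_minr.
- rewrite (_ : 4 = 2 * 2) ?invfM ?exprMn; last by rewrite -natrM.
  rewrite ler_pM2r ?exprn_gt0//; apply: ler_wiXn2l; rewrite ?invf_le1 ?ler1n//.
  exact: ltnW.
Qed.

(** Diagonal terms use [m i <= i] and monotonicity of [H]. All cross terms together cost at most 4,
    charged to the spare 4 in [v], present at least once since [0 < k]. *)
Let T_sqr k : (0 < k)%N -> \int[P]_w (\sum_(i < k) D i w) ^+ 2 <= \sum_(i < k) v i.
Proof.
move=> k0.
have bDD i j : bounded_measurable (fun w => D i w * D j w)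
  by exact: bounded_measurableM.
under eq_Rintegral do rewrite expr2 mulr_suml.
under eq_Rintegral do under eq_bigr do rewrite mulr_sumr.
rewrite bounded_Rintegral_sum; last by move=> i; apply: bounded_measurable_sum.
under eq_bigr do rewrite bounded_Rintegral_sum//.
pose e i : R := 2^-1 ^+ sigma i.
have e0 i : 0 <= e i by rewrite exprn_ge0.
apply: (@le_trans _ _ (\sum_(i < k) (H i + 1 + \sum_(j < k) e i * e j))).
  apply: ler_sum => i _; rewrite (bigD1 i)//= lerD//.
    have /n_dev : (m i <= sigma i)%N by rewrite geq_minr.
    under eq_Rintegral do rewrite expr2.
    by move/le_trans; apply; rewrite lerD2r H_nd// /m geq_minl.
  rewrite [leRHS](bigD1 i)//= -[leLHS]add0r lerD ?mulr_ge0//.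
  by apply: ler_sum => j ji; rewrite D_cross// eq_sym.
rewrite big_split/=; under [X in _ + X]eq_bigr do rewrite -mulr_sumr.
rewrite -mulr_suml; set E := \sum_(i < k) e i.
have E2 : E <= 2.
  by apply: (@sum_injective_le _ (fun a => 2^-1 ^+ a)) => //; exact: sum_half_le.
have E0 : 0 <= E by exact: sumr_ge0.
have EE : E * E <= 4 by rewrite (_ : 4 = 2 * 2 :> R) ?ler_pM//; ring.
rewrite (_ : \sum_(i < k) v i = \sum_(i < k) (H i + 1) + \sum_(i < k) 4); last first.
  by rewrite -big_split/=; apply: eq_bigr => i _; rewrite /v; ring.
rewrite lerD2l (le_trans EE)// sumr_const card_ord.
by rewrite -[leRHS]mulr_natr ler_peMr// ler1n.
Qed.

Let T_cvg s : {ae P, forall w,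
  (\sum_(i < s.+1 * 2 ^ j) D i w) / (s.+1 * 2 ^ j)%:R @[j --> \oo] --> 0}.
Proof.
pose h j w := ((\sum_(i < s.+1 * 2 ^ j) D i w) / (s.+1 * 2 ^ j)%:R) ^+ 2.
have bh j : bounded_measurable (h j).
  apply: bounded_measurable_sqr; apply: bounded_measurableM;
    last exact: bounded_measurable_cst.
  exact: bounded_measurable_sum.
have : {ae P, forall w, cvgn (series (fun j => h j w))}.
  apply: (@ae_cvg_series _ _ _ P _ (4 / 3 * V)) => // N.
  apply: le_trans (sum_dyadic_mean_le s _ v_sum N); last by move=> i; rewrite addr_ge0.
  apply: ler_sum => j _.
  under eq_Rintegral do rewrite ger0_norm ?sqr_ge0// /h expr_div_n mulrC.
  rewrite bounded_RintegralZ; last by apply: bounded_measurable_sqr;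
    exact: bounded_measurable_sum.
  rewrite mulrC ler_wpM2r ?invr_ge0 ?exprn_ge0//.
  by rewrite T_sqr// muln_gt0/= expn_gt0.
apply: filterS => w /cvg_series_cvg_0 h0.
apply/cvgrPdist_lt => e e0.
have e20 : 0 < e ^+ 2 by rewrite exprn_gt0.
have /cvgrPdist_lt/(_ _ e20) := h0.
apply: filterS => j; by rewrite !sub0r !normrN /h normrX ltr_pXn2r// nnegrE ltW.
Qed.

(** Where truncation acts, [g (m i)] equals its cap and [h i = 1]. The integrals of [h i] are
    summable because [m i] is [i] or [sigma i], so [h i] tends to 0 and truncation eventually
    stops. *)
Let trunc_near : {ae P, forall w, \forall i \near \oo,
  f_ (n_ (sigma i)) w = g (m i) (n_ (sigma i)) w}.
Proof.
pose h i w := (m i).+1%:R ^- 2 * (g (m i) (n_ (sigma i)) w) ^+ 2.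
have bs i : bounded_measurable (fun w => (g (m i) (n_ (sigma i)) w) ^+ 2).
  exact: bounded_measurable_sqr.
have bh i : bounded_measurable (h i).
  by apply: bounded_measurableM => //; exact: bounded_measurable_cst.
have h0 i w : 0 <= h i w by rewrite mulr_ge0 ?sqr_ge0// invr_ge0 exprn_ge0.
pose u p := v p / p.+1%:R ^+ 2.
have u0 p : 0 <= u p by rewrite divr_ge0 ?exprn_ge0// addr_ge0.
have : {ae P, forall w, cvgn (series (fun j => h j w))}.
  apply: (@ae_cvg_series _ _ _ P _ (V + V)) => // N.
  apply: (@le_trans _ _ (\sum_(i < N) (u i + u (sigma i)))); last first.
    rewrite big_split/=; apply: lerD; first exact: v_sum.
    by apply: (@sum_injective_le _ u V sigma).
  apply: ler_sum => i _.
  under eq_Rintegral do rewrite (ger0_norm (h0 _ _)).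
  rewrite /h bounded_RintegralZ//.
  apply: (@le_trans _ _ (u (m i))); last first.
    by rewrite /m; case: leqP => _; rewrite ?lerDl ?lerDr; exact: u0.
  rewrite mulrC ler_wpM2r ?invr_ge0 ?exprn_ge0//.
  rewrite (le_trans (n_sqr (geq_minr _ _)))// lerD2l.
  by rewrite ler1n.
apply: filterS => w /cvg_series_cvg_0/cvgrPdist_lt/(_ _ ltr01).
apply: filterS => i; rewrite sub0r normrN ltr_norml => /andP[_].
rewrite /h mulrC ltr_pdivrMr ?exprn_gt0// mul1r ltr_pXn2r ?nnegrE//; last first.
  by have /andP[] := g_itv (m i) (n_ (sigma i)) w.
by rewrite /g /Num.min; case: ifP => // _; rewrite ltxx.
Qed.

(** The terms are eventually [D i + b_ (m i)]. The means of [D i] vanish along dyadic sequences,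
    those of [b_ (m i)] converge because [m i] tends to infinity, and nonnegativity of the sum
    passes from dyadic sequences to all [k]. *)
Lemma injective_mean_cvg : {ae P, forall w,
  k.+1%:R^-1 * \sum_(l < k.+1) f_ (n_ (sigma l)) w @[k --> \oo] --> B w}.
Proof.
have aT : {ae P, forall w s, (\sum_(i < s.+1 * 2 ^ j) D i w) / (s.+1 * 2 ^ j)%:R
    @[j --> \oo] --> 0} by apply: ae_foralln => s; exact: T_cvg.
apply: filterS3 aT trunc_near b_B => w Tw fg bw.
pose Y i := g (m i) (n_ (sigma i)) w.
have minf (M : nat) : \forall i \near \oo, (M <= m i)%N.
  have [K KM] := injective_cvg_infty sigmaI M.
  exists (maxn M K) => // i /=; rewrite geq_max => /andP[Mi Ki].
  by rewrite leq_min Mi KM.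
have bm : b_ (m i) w @[i --> \oo] --> B w.
  apply/cvgrPdist_lt => e e0; have /cvgrPdist_lt/(_ _ e0)[N _ NP] := bw.
  by apply: filterS (minf N) => i; exact: NP.
have means (a : nat -> R) (l : R) : a @ \oo --> l ->
    k.+1%:R^-1 * \sum_(i < k.+1) a i @[k --> \oo] --> l.
  move=> /cesaro; rewrite /arithmetic_mean/= => ca.
  by under eq_cvg do rewrite -(big_mkord xpredT a).
have cY : (\sum_(i < k.+1) Y i) / k.+1%:R @[k --> \oo] --> B w.
  apply: (@cvg_mean_dyadic _ (fun k => \sum_(i < k) Y i)).
  - by move=> k; apply: sumr_ge0 => i _; have /andP[] := g_itv (m i) (n_ (sigma i)) w.
  - move=> k l kl; rewrite -(big_mkord xpredT Y) -(big_mkord xpredT Y).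
    rewrite (big_cat_nat (leq0n _) kl)/= lerDl sumr_ge0// => i _.
    by have /andP[] := g_itv (m i) (n_ (sigma i)) w.
  - move=> s.
    (* [means] averages [k.+1] terms, hence the predecessor. *)
    have dy : (s.+1 * 2 ^ j).-1 @[j --> \oo] --> \oo.
      apply/cvgnyPge => A; exists A => // j /= Aj.
      rewrite -ltnS prednK ?muln_gt0 ?expn_gt0//.
      by rewrite (leq_ltn_trans Aj)// (leq_trans (ltn_expl j (ltnSn 1)))// leq_pmull.
    have c1 : (s.+1 * 2 ^ j)%:R^-1 * \sum_(i < s.+1 * 2 ^ j) b_ (m i) w @[j --> \oo] --> B w.
      have := cvg_comp _ _ dy (means _ _ bm).
      apply: cvg_trans; apply: near_eq_cvg; apply: nearW => j /=.
      by rewrite prednK// muln_gt0 expn_gt0.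
    have c2 : (\sum_(i < s.+1 * 2 ^ j) D i w) / (s.+1 * 2 ^ j)%:R +
        (s.+1 * 2 ^ j)%:R^-1 * \sum_(i < s.+1 * 2 ^ j) b_ (m i) w @[j --> \oo] --> B w.
      by rewrite -[X in _ --> X]add0r; apply: cvgD => //; exact: Tw.
    apply: cvg_trans c2.
    apply: near_eq_cvg; apply: nearW => j /=.
    rewrite [X in _ + X]mulrC -mulrDl -big_split/=; congr (_ / _).
    by apply: eq_bigr => i _; rewrite /D subrK.
have c0 : f_ (n_ (sigma i)) w - Y i @[i --> \oo] --> 0.
  apply: cvg_near_cst; apply: filterS fg => i; rewrite /Y => <-.
  by rewrite subrr.
have c3 : (\sum_(i < k.+1) Y i) / k.+1%:R +
    k.+1%:R^-1 * \sum_(i < k.+1) (f_ (n_ (sigma i)) w - Y i) @[k --> \oo] --> B w.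
  by rewrite -[X in _ --> X]addr0; apply: cvgD => //; exact: (means _ _ c0).
apply: cvg_trans c3.
apply: near_eq_cvg; apply: nearW => k /=.
rewrite [X in X + _]mulrC -mulrDr -big_split/=; congr (_ * _).
by apply: eq_bigr => i _; rewrite addrC subrK.
Qed.

End path.

Lemma komlos_weak_limits : \oo `<=` U ->
  exists2 n_, subsequence n_ & exists B : T -> R,
    [/\ measurable_fun setT B, forall w, 0 <= B w &
      forall sigma : nat -> nat, injective sigma -> {ae P, forall w,
        k.+1%:R^-1 * \sum_(l < k.+1) f_ (n_ (sigma l)) w @[k --> \oo] --> B w}].
Proof.
move=> ooU.
have [|B [mB B0 bB]] := ae_cvg_limit mb_ _ b_cvg.
  by move=> p w; have /andP[] := b_itv p w.
pose A0 b n := forall p, (p <= b)%N -> \int[P]_w (g p n w) ^+ 2 <= H p + 1 /\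
  \int[P]_w (g p n w - b_ p w) ^+ 2 <= H p + 1.
(* For fixed [a], [g p a - b_ p] is a bounded test function, against which [g q n - b_ q] tends to 0
   along [U]. *)
pose A b a n := forall q, (q <= b)%N -> forall p, (p <= b)%N ->
  `|\int[P]_w ((g p a w - b_ p w) * (g q n w - b_ q w))| <= 4^-1 ^+ b.
have [||n_ [n_lt nA0 nA]] := increasing_selection (A0 := A0) (A := A) ooU.
- move=> b; apply: filter_forall_leq => p.
  have /cvgrPdist_lt/(_ _ ltr01) := @H_cvg p.
  apply: filterS2 (@b_sqr p) => n h; rewrite ltr_distl => /andP[? ?]; split=> //.
  by apply: ltW; lra.
- move=> b a; apply: filter_forall_leq => q; apply: filter_forall_leq => p.
  have pos4 : 0 < 4^-1 ^+ b :> R by rewrite exprn_gt0// invr_gt0.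
  have bga : bounded_measurable (fun w => g p a w - b_ p w)
    by exact: bounded_measurableB.
  have /cvgrPdist_lt/(_ _ pos4) := @b_weak q _ bga.
  apply: filterS => n; rewrite sub0r normrN => /ltW.
  by under eq_Rintegral do rewrite mulrC.
exists n_ => //; exists B; split=> // sigma sI.
apply: (@injective_mean_cvg n_) => //.
- by move=> b p pb; have [] := nA0 b p pb.
- by move=> b p pb; have [] := nA0 b p pb.
- by move=> a b ab p q pb qb; exact: nA.
Qed.

End komlos.

(** Boundedness in L^1 is phrased through truncated means, so only bounded functions are integrated.
    The same ultrafilter serves every truncation level. *)
Theorem komlos_injective d (T : measurableType d) (R : realType)
    (P : probability T R) (f_ : nat -> T -> R) (C : R) :
  (forall n, measurable_fun setT (f_ n)) -> (forall n w, 0 <= f_ n w) ->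
  (forall n p, \int[P]_w Num.min (f_ n w) p.+1%:R <= C) ->
  exists2 n_, subsequence n_ & exists B : T -> R,
    [/\ measurable_fun setT B, forall w, 0 <= B w &
      forall sigma : nat -> nat, injective sigma -> {ae P, forall w,
        k.+1%:R^-1 * \sum_(l < k.+1) f_ (n_ (sigma l)) w @[k --> \oo] --> B w}].
Proof.
move=> mf f0 fC.
have [U [UU ooU]] := ultraFilterLemma (eventually_filter : ProperFilter \oo).
have trunc_itv p n w : 0 <= Num.min (f_ n w) p.+1%:R <= p.+1%:R.
  by rewrite le_min f0 ler0n/= ge_min lexx orbT.
have mtrunc p n : measurable_fun setT (fun w => Num.min (f_ n w) p.+1%:R).
  exact: measurable_minr.
have /choice[b_ bP] p := ultrafilter_weak_limit P (UU := UU) (mtrunc p) (trunc_itv p).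
apply: (@komlos_weak_limits _ _ _ P f_ C mf f0 fC U UU b_) => // p.
- by have [] := bP p.
- by have [] := bP p.
- by have [] := bP p.
Qed.

(** * The dual density of a convex solid set *)

Lemma measurable_funV_ge0 d (T : measurableType d) (R : realType) (f : T -> R) :
  measurable_fun setT f -> (forall w, 0 <= f w) ->
  measurable_fun setT (fun w => (f w)^-1).
Proof.
move=> mf f0; rewrite (_ : (fun w => _) = (fun x => x `^ (-1)) \o f).
  by apply: measurableT_comp => //; exact: measurable_powR.
by apply/funext => w /=; rewrite powR_inv1.
Qed.

(** * Almost sure descriptions of order and solid hull *)

Section L0_facts.
Context d (T : measurableType d) (R : realType) (P : probability T R).
Implicit Types (X Y : L0 P).

Lemma L0_measurable X : measurable_fun setT (X : T -> R).
Proof. exact: measurable_funPT. Qed.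

Lemma L0_lift (f : T -> R) : measurable_fun setT f ->
  exists X : L0 P, {ae P, forall w, X w = f w}.
Proof.
move=> mf.
pose g : {mfun T >-> R} := HB.pack_for {mfun T >-> R} f (isMeasurableFun.Build _ _ _ _ f mf).
by exists (L0_class P g); exact: L0_classP.
Qed.

Lemma probability1_ae (A : set T) : measurable A ->
  P A = 1%E <-> {ae P, forall w, A w}.
Proof.
move=> mA; split=> [PA|].
  exists (~` A); split; [exact: measurableC| |by []].
  by rewrite probability_setC// PA subee.
move=> [N [mN N0 AN]].
have : P (~` A) = 0%E.
  by apply: (subset_measure0 _ mN AN N0); exact: measurableC.
rewrite probability_setC// => /eqP; rewrite sube_eq ?fin_num_measure// add0e.
by move=> /eqP.
Qed.

Lemma L0_leP X Y : L0_le X Y <-> {ae P, forall w, X w <= Y w}.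
Proof.
apply: probability1_ae; rewrite -[X in measurable X]setTI.
by apply: measurable_fun_le => //; exact: L0_measurable.
Qed.

Lemma L0_plusP X : L0_plus X <-> {ae P, forall w, 0 <= X w}.
Proof.
split=> [/L0_leP|] h; last apply/L0_leP.
  by apply: filterS2 h (L0_0E P) => w + e; rewrite e.
by apply: filterS2 h (L0_0E P) => w + e; rewrite e.
Qed.

Lemma solid_hullP (K : set (L0 P)) X : solid_hull K X <->
  L0_plus X /\ exists2 Y, K Y & {ae P, forall w, X w <= Y w}.
Proof.
split=> [[[Y KY [Z /L0_plusP Z0 <-]] X0]|[X0 [Y KY XY]]].
  split=> //; exists Y => //.
  apply: filterS3 Z0 (L0_DE Y (- Z)) (L0_NE Z) => w Zw -> ->.
  by rewrite gerBl.
split=> //; exists Y => //; exists (Y - X); last by rewrite opprB addrC subrK.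
apply/L0_plusP; apply: filterS3 XY (L0_DE Y (- X)) (L0_NE X) => w Zw -> ->.
by rewrite subr_ge0.
Qed.

End L0_facts.

(** * Minimisation of E[1 / (1 + X)] over a convex solid set *)

Section convex_solid.
Context d (T : measurableType d) (R : realType) (P : probability T R).
Variable B : set (L0 P).
Hypothesis B0 : B !=set0.
Hypothesis B_plus : B `<=` @L0_plus _ _ _ P.
Hypothesis B_solid : forall X Y, B Y -> L0_plus X ->
  {ae P, forall w, X w <= Y w} -> B X.
Hypothesis B_convex : forall t X Y, 0 <= t <= 1 -> B X -> B Y ->
  B ((1 - t) *: X + t *: Y).
Hypothesis B_bounded : forall X, L0_plus X ->
  (forall c, 0 < c -> B (c *: X)) -> X = 0.

(** Elements of [B] are nonnegative only almost everywhere; clipping gives [1 <= num X] at every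
    point, and so an everywhere bounded [inv1 X]. *)
Let num (X : L0 P) w : R := 1 + Num.max (X w) 0.
Let inv1 (X : L0 P) w : R := (num X w)^-1.

Let num1 X w : 1 <= num X w.
Proof. by rewrite lerDl le_max lexx orbT. Qed.

Let inv1_itv X w : 0 <= inv1 X w <= 1.
Proof. by rewrite invr_ge0 invf_le1 ?num1 ?(le_trans ler01)// (lt_le_trans ltr01). Qed.

Let numE X : B X -> {ae P, forall w, num X w = 1 + X w}.
Proof.
by move=> /B_plus/L0_plusP; apply: filterS => w X0; rewrite /num max_l.
Qed.

Let mnum X : measurable_fun setT (num X).
Proof.
apply: measurable_funD => //; apply: measurable_maxr => //; exact: L0_measurable.
Qed.

Let minv1 X : measurable_fun setT (inv1 X).
Proof.
apply: measurable_funV_ge0; first exact: mnum.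
by move=> w; rewrite (le_trans ler01) ?num1.
Qed.

Let num_convex t X Y : 0 <= t <= 1 -> B X -> B Y ->
  {ae P, forall w, num ((1 - t) *: X + t *: Y) w = (1 - t) * num X w + t * num Y w}.
Proof.
move=> t01 BX BY.
apply: filterS3 (filterI (numE BX) (numE BY))
  (filterI (numE (B_convex t01 BX BY)) (L0_DE ((1 - t) *: X) (t *: Y)))
  (filterI (L0_ZE (1 - t) X) (L0_ZE t Y)) => w [-> ->] [-> ->] [-> ->].
by ring.
Qed.

Let binv1 X : bounded_measurable (inv1 X).
Proof. exact: bounded_measurable_itv (inv1_itv X). Qed.

Let minimizers : exists (X_ : nat -> L0 P) (Z : T -> R),
  [/\ measurable_fun setT Z /\ (forall w, 0 <= Z w <= 1), forall n, B (X_ n),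
   forall n X, B X -> \int[P]_w inv1 (X_ n) w <= \int[P]_w inv1 X w + 4^-1 ^+ n &
   {ae P, forall w, inv1 (X_ n) w @[n --> \oo] --> Z w}].
Proof.
have [||||f_ [Z [mZ Cf f_min fZ]]] := @ae_cvg_minimizers _ _ _ P (inv1 @` B) 1 0
   (fun f => \int[P]_w f w).
- by case: B0 => X BX; exists (inv1 X), X.
- by move=> _ [X BX <-]; split=> // w; exact: inv1_itv.
- by move=> _ [X BX <-]; apply: Rintegral_ge0 => w _; have /andP[] := inv1_itv X w.
- move=> _ _ [X BX <-] [Y BY <-].
  have h01 : 0 <= (2^-1 : R) <= 1 by rewrite invr_ge0 ler0n/= invf_le1 ?ler1n.
  have BW := B_convex h01 BX BY; set W := _ + _ in BW.
  exists (inv1 W); first by exists W.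
  have b1 : bounded_measurable (fun w => inv1 X w + inv1 Y w)
    by exact: bounded_measurableD.
  have b2 : bounded_measurable (fun w => (inv1 X w - inv1 Y w) ^+ 2).
    by apply: bounded_measurable_sqr; exact: bounded_measurableB.
  have b3 : bounded_measurable (fun w => ((num X w + num Y w) / 2)^-1 : R).
    have mN : measurable_fun setT (fun w => ((num X w + num Y w) / 2)^-1 : R).
      apply: measurable_funV_ge0.
        by apply: measurable_funM => //; exact: measurable_funD.
      by move=> w; have := num1 X w; have := num1 Y w; lra.
    apply: (bounded_measurable_itv (a := 0) (b := 1)) => // w.
    have h : 1 <= (num X w + num Y w) / 2 by have := num1 X w; have := num1 Y w; lra.
    by rewrite invr_ge0 invf_le1 ?h ?(le_trans ler01)// (lt_le_trans ltr01).
  rewrite (@ae_eq_Rintegral _ _ _ P _ (fun w => ((num X w + num Y w) / 2)^-1)) //;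
    last first.
    apply: filterS (num_convex h01 BX BY) => w; rewrite /inv1 => ->.
    by congr (_^-1); field.
  rewrite -bounded_RintegralD// mulrC [X in _ - X]mulrC.
  rewrite -!bounded_RintegralZ// -bounded_RintegralB; last 2 first.
    by apply: bounded_measurableM => //; exact: bounded_measurable_cst.
    by apply: bounded_measurableM => //; exact: bounded_measurable_cst.
  apply: bounded_le_Rintegral => //.
    apply: bounded_measurableB; apply: bounded_measurableM => //;
      exact: bounded_measurable_cst.
  move=> w; rewrite /inv1; have := num1 X w; have := num1 Y w.
  move: (num X w) (num Y w) => a b b1' a1.
  have a0 : 0 < a by lra.
  have b0 : 0 < b by lra.
  have ab0 : 0 < a + b by lra.
  rewrite -subr_ge0.
  (* The modulus of convexity of the inverse in terms of its own values. The last factor is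
     [(a - 1) * b + a * (b - 1)], nonnegative because [a] and [b] are at least 1. *)
  have -> : 2^-1 * (a^-1 + b^-1) - 4^-1 * (a^-1 - b^-1) ^+ 2 - ((a + b) / 2)^-1 =
    (a - b) ^+ 2 / (4 * a ^+ 2 * b ^+ 2 * (a + b)) * (2 * a * b - a - b).
    by field; rewrite !gt_eqF.
  rewrite mulr_ge0//.
    by rewrite divr_ge0 ?sqr_ge0// !mulr_ge0 ?exprn_ge0// ltW.
  by have : 0 <= (a - 1) * b + a * (b - 1); [apply: addr_ge0; apply: mulr_ge0; lra|lra].
have /choice[X_ X_P] n : exists X, B X /\ inv1 X = f_ n.
  by have [X BX fX] := Cf n; exists X.
exists X_, Z; split=> //.
- by move=> n; have [] := X_P n.
- move=> n X BX; have [_ ->] := X_P n.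
  by apply: f_min; exists X.
- apply: filterS fZ => w; apply: cvg_trans; apply: near_eq_cvg; apply: nearW => n.
  by have [_ ->] := X_P n.
Qed.

Let indic_null (G : set T) : measurable G ->
  (forall c : R, 0 < c -> exists2 X, B X & forall w, G w -> c <= X w) ->
  {ae P, forall w, ~ G w}.
Proof.
move=> mG hG; have mI : measurable_fun setT (\1_G : T -> R) by exact: measurable_indic.
have [Y YG] := L0_lift P mI.
have Y0 : Y = 0.
  apply: B_bounded.
    by apply/L0_plusP; apply: filterS YG => w ->; rewrite indicE.
  move=> c c0; have [X BX Xc] := hG c c0.
  apply: (B_solid BX).
    apply/L0_plusP; apply: filterS2 YG (L0_ZE c Y) => w -> ->.
    by rewrite mulr_ge0// ?ltW// indicE.
  apply: filterS3 YG (L0_ZE c Y) ((L0_plusP X).1 (B_plus BX)) => w -> -> X0.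
  rewrite indicE; case: (boolP (w \in G)); rewrite ?inE ?mulr0// mulr1.
  exact: Xc.
rewrite Y0 in YG; apply: filterS2 YG (L0_0E P) => w -> h Gw.
by move: h; rewrite indicE mem_set//= => /eqP; rewrite oner_eq0.
Qed.

Lemma exists_dual_density : exists Z : T -> R,
  [/\ measurable_fun setT Z, forall w, 0 <= Z w <= 1, {ae P, forall w, 0 < Z w} &
   forall X, B X -> (\int[P]_w (Num.max (X w) 0 * (Z w) ^+ 2)%:E <= 2)%E].
Proof.
have [X_ [Z [[mZ Z01] BX_ X_min X_Z]]] := minimizers.
exists Z; split=> //.
  pose N := [set w | Z w <= 0].
  have mN : measurable N.
    by rewrite -[N]setTI; apply: measurable_fun_le => //.
  have bN := bounded_measurable_indic R mN.
  have cN : \int[P]_w (inv1 (X_ n) w * \1_N w) @[n --> \oo] --> 0.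
    rewrite -[X in _ --> X](Rintegral_probability_cst P).
    apply: (@bounded_dominated_cvg _ _ _ _ _ _ 1) => //.
    - by move=> n; apply: measurable_funM => //; exact: measurable_indic.
    - move=> n w; have /andP[? ?] := inv1_itv (X_ n) w.
      rewrite ger0_norm ?mulr_ge0// ?indicE//.
      by rewrite mulr_ile1//; case: (_ \in _).
    - apply: filterS X_Z => w Zw; rewrite indicE; case: (boolP (w \in N)) => [|_].
        rewrite inE /N/= => Zw0; have Z0 : Z w = 0.
          by apply/eqP; rewrite eq_le Zw0; have /andP[] := Z01 w.
        rewrite -Z0; apply: cvg_trans Zw; apply: near_eq_cvg; apply: nearW => n.
        by rewrite mulr1.
      by apply: cvg_near_cst; apply: nearW => n; rewrite mulr0.
  (* A subsequence growing at a definite rate on [N]: summability makes [k.+1 / (1 + X_ (n_ k)) < 1]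
     eventually, that is [k < X_ (n_ k)]. *)
  have /choice[n_ n_P] k : exists n, k.+1%:R * \int[P]_w (inv1 (X_ n) w * \1_N w) <= 2^-1 ^+ k.
    have e0 : 0 < 2^-1 ^+ k / k.+1%:R :> R by rewrite divr_gt0// exprn_gt0// invr_gt0.
    have /cvgrPdist_le/(_ _ e0)[n _ nP] := cN.
    exists n; rewrite mulrC -ler_pdivlMr//; have := nP n (leqnn n).
    by rewrite sub0r normrN; apply: le_trans; exact: ler_norm.
  pose h k w := k.+1%:R * (inv1 (X_ (n_ k)) w * \1_N w).
  have bh k : bounded_measurable (h k).
    apply: bounded_measurableM; first exact: bounded_measurable_cst.
    exact: bounded_measurableM.
  have h0 k w : 0 <= h k w.
    by rewrite mulr_ge0// mulr_ge0// ?indicE//; have /andP[] := inv1_itv (X_ (n_ k)) w.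
  have ch : {ae P, forall w, cvgn (series (fun k => h k w))}.
    apply: (@ae_cvg_series _ _ _ P _ 2) => // M.
    apply: (@le_trans _ _ (\sum_(i < M) 2^-1 ^+ i)); last exact: sum_half_le.
    apply: ler_sum => k _; under eq_Rintegral do rewrite (ger0_norm (h0 _ _)).
    by rewrite /h bounded_RintegralZ//; exact: bounded_measurableM.
  (* Up to a null set the [G m] exhaust [N], and on each of them one single element of [B] exceeds
     any given constant, as [indic_null] requires. *)
  pose G m := \bigcap_(k in [set k | (m <= k)%N]) (N `&` [set w | k%:R <= X_ (n_ k) w]).
  have mG m : measurable (G m).
    apply: bigcap_measurableType => k _; apply: measurableI => //.
    by rewrite -[X in measurable X]setTI; apply: measurable_fun_le => //;
      exact: L0_measurable.
  have nG : {ae P, forall w m, ~ G m w}.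
    apply: ae_foralln => m; apply: indic_null => // c c0.
    pose k := maxn m (Num.bound c); exists (X_ (n_ k)); first exact: BX_.
    move=> w /(_ k); rewrite /= leq_maxl => /(_ isT)[_]; apply: le_trans.
    apply: ltW; apply: (lt_le_trans (archi_boundP (ltW c0))).
    by rewrite ler_nat leq_maxr.
  have aX : {ae P, forall w n, num (X_ n) w = 1 + X_ n w}.
    by apply: ae_foralln => n; exact: numE.
  apply: filterS3 ch nG aX => w /cvg_series_cvg_0 hw nGw Xw.
  rewrite ltNge; apply/negP => Zw.
  have /cvgrPdist_lt/(_ _ ltr01)[m _ mP] := hw.
  apply: (nGw m) => k /= mk; split=> //.
  have := mP k mk; rewrite sub0r normrN ger0_norm// /h indicE mem_set// mulr1.
  rewrite /inv1 ltr_pdivrMr ?(lt_le_trans ltr01 (num1 _ _))// mul1r Xw.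
  by rewrite -natr1 addrC ltrD2l => /ltW.
move=> X BX.
pose t n : R := 2^-1 ^+ n.
have t0 n : 0 < t n by rewrite exprn_gt0// invr_gt0.
have t1 n : 0 <= t n <= 1 by rewrite ltW//= exprn_ile1// ?invf_le1// ler1n.
pose W n : L0 P := (1 - t n) *: X_ n + t n *: X.
have BW n : B (W n) by exact: B_convex.
pose F n w := num X w * inv1 (X_ n) w * inv1 (W n) w.
have F0 n w : 0 <= F n w.
  rewrite !mulr_ge0//; first by rewrite (le_trans ler01).
    by have /andP[] := inv1_itv (X_ n) w.
  by have /andP[] := inv1_itv (W n) w.
have mF n : measurable_fun setT (F n) by do 2 apply: measurable_funM => //.
have WE : {ae P, forall w n, num (W n) w = (1 - t n) * num (X_ n) w + t n * num X w}.
  by apply: ae_foralln => n; exact: num_convex.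
(* The first-order condition at the minimiser: moving from [X_ n] towards [X]
   by [t n] gains at most [4 ^- n] = [t n ^+ 2]. *)
have intF n : (\int[P]_w (F n w)%:E <= 2)%E.
  (* Since [W n - X_ n] is [t n] times [X - X_ n], the difference quotient equals [F n - inv1 (W n)]
     almost surely. The quotient and [inv1 (W n)] each have mean at most 1, whence the bound 2. *)
  pose G w := (t n)^-1 * (inv1 (X_ n) w - inv1 (W n) w) + inv1 (W n) w.
  have bD : bounded_measurable (fun w => inv1 (X_ n) w - inv1 (W n) w)
    by exact: bounded_measurableB.
  have bD' : bounded_measurable (fun w => (t n)^-1 * (inv1 (X_ n) w - inv1 (W n) w)).
    by apply: bounded_measurableM => //; exact: bounded_measurable_cst.
  have bG : bounded_measurable G by exact: bounded_measurableD.
  rewrite (@ae_eq_integral _ _ _ P setT (fun w => (G w)%:E)) //; last 3 first.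
    exact/measurable_EFinP.
    by apply/measurable_EFinP; case: bG.
    apply: filterS WE => w Ww _; congr EFin.
    rewrite /F /G /inv1 Ww; have := num1 (X_ n) w; have := num1 X w.
    have := t1 n; have := t0 n; move: (t n) (num (X_ n) w) (num X w) =>
      s a x s0 /andP[_ s1] x1 a1.
    have p : 0 < (1 - s) * a + s * x.
      by rewrite ltr_wpDl// ?mulr_gt0 ?mulr_ge0 ?subr_ge0// ?(le_trans ler01)// (lt_le_trans ltr01).
    by field; rewrite !gt_eqF// (lt_le_trans ltr01).
  rewrite bounded_RintegralE// lee_fin /G bounded_RintegralD// bounded_RintegralZ// bounded_RintegralB//.
  have h1 : \int[P]_w inv1 (W n) w <= 1.
    rewrite -[leRHS](Rintegral_probability_cst P); apply: bounded_le_Rintegral => //.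
      exact: bounded_measurable_cst.
    by move=> w; have /andP[] := inv1_itv (W n) w.
  have h2 : (t n)^-1 * (\int[P]_w inv1 (X_ n) w - \int[P]_w inv1 (W n) w) <= 1.
    rewrite mulrC ler_pdivrMr// mul1r lerBlDl; apply: le_trans (X_min n _ (BW n)) _.
    rewrite lerD2l /t !exprVn lef_pV2 ?posrE ?exprn_gt0//.
    by rewrite lerXn2r ?nnegrE// ler_nat.
  by apply: le_trans (lerD h2 h1) _; rewrite -natr1.
have Flim : {ae P, forall w, F n w @[n --> \oo] --> num X w * Z w * Z w}.
  apply: filterS2 WE X_Z => w Ww Zw.
  have ct : t n @[n --> \oo] --> 0.
    by apply: cvg_expr; rewrite ger0_norm ?invr_ge0// invf_lt1// ltr1n.
  have cW : inv1 (W n) w @[n --> \oo] --> Z w.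
    rewrite (_ : (fun n => inv1 (W n) w) = fun n =>
        inv1 (X_ n) w / ((1 - t n) + t n * (num X w * inv1 (X_ n) w))).
      have ZE : Z w = Z w / ((1 - 0) + 0 * (num X w * Z w)).
        by rewrite mul0r addr0 subr0 divr1.
      rewrite [X in _ --> X]ZE.
      apply: cvgM => //; apply: cvgV; first by rewrite mul0r addr0 subr0 oner_eq0.
      apply: cvgD; first by apply: cvgB => //; exact: cvg_cst.
      by apply: cvgM => //; apply: cvgM => //; exact: cvg_cst.
    apply/funext => n; rewrite /inv1 Ww.
    have := num1 (X_ n) w; have := num1 X w.
    have := t1 n; have := t0 n; move: (t n) (num (X_ n) w) (num X w) =>
      s a x s0 /andP[_ s1] x1 a1.
    have p : 0 < (1 - s) * a + s * x.
      by rewrite ltr_wpDl// ?mulr_gt0 ?mulr_ge0 ?subr_ge0// ?(le_trans ler01)// (lt_le_trans ltr01).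
    by field; rewrite !gt_eqF// (lt_le_trans ltr01).
  by apply: cvgM => //; apply: cvgM => //; exact: cvg_cst.
have mZ2 (f : T -> R) : measurable_fun setT f -> measurable_fun setT (fun w =>
  (f w * Z w * Z w)%:E).
  by move=> mf; apply/measurable_EFinP; do 2 apply: measurable_funM => //.
apply: (@le_trans _ _ (\int[P]_w (num X w * Z w * Z w)%:E)%E).
  apply: ge0_le_integral => //.
  - move=> w _; rewrite lee_fin mulr_ge0 ?sqr_ge0// le_max lexx orbT//.
  - apply/measurable_EFinP; apply: measurable_funM.
      by apply: measurable_maxr => //; exact: L0_measurable.
    exact: measurable_funX.
  - exact: mZ2.
  - move=> w _; rewrite lee_fin expr2 mulrA.
    have /andP[? _] := Z01 w.
    by rewrite ler_wpM2r// ler_wpM2r// lerDr.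
rewrite (@ae_eq_integral _ _ _ P setT (fun w => limn_einf (fun n => (F n w)%:E))) //;
  last 3 first.
- exact: mZ2.
- rewrite /limn_einf; apply: measurableT_comp => //.
  apply: measurable_fun_limn_esup => n; apply: measurableT_comp => //.
  exact/measurable_EFinP.
- apply: filterS Flim => w Fw _.
  have /cvg_limn_einf_sup[-> //] : (F n w)%:E @[n --> \oo] --> (num X w * Z w * Z w)%:E.
  by apply: cvg_EFin => //; exact: nearW.
have mFE n : measurable_fun setT (fun w => (F n w)%:E) by exact/measurable_EFinP.
have FE0 n w : setT w -> (0 <= (F n w)%:E)%E by rewrite lee_fin.
apply: le_trans (fatou P measurableT mFE FE0) _.
rewrite limn_einf_lim; apply: lime_le.
  exact: is_cvg_einfs.
by apply: nearW => n; rewrite (le_trans _ (intF n))// ereal_inf_lbound//; exists n =>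
  /=.
Qed.

End convex_solid.

(** * Helly's selection principle *)

(** Heine-Cantor by contradiction: counterexamples at distance at most [N.+1%:R^-1] converge along
    an ultrafilter to a common point, against continuity there. *)
Lemma uniform_modulus (R : realType) (f : R -> R) (A e : R) :
  continuous f -> 0 < e ->
  exists N : nat, forall x y, `|x| <= A -> `|y| <= A -> `|x - y| <= N.+1%:R^-1 ->
    `|f x - f y| <= e.
Proof.
move=> cf e0; apply: contrapT => nN.
have /choice[xy xyP] N : exists xy : R * R, [/\ `|xy.1| <= A, `|xy.2| <= A,
    `|xy.1 - xy.2| <= N.+1%:R^-1 & e < `|f xy.1 - f xy.2|].
  apply: contrapT => h; apply: nN; exists N => x y xA yA xyN.
  by rewrite leNgt; apply/negP => xye; apply: h; exists (x, y).
have [U [UU ooU]] := ultraFilterLemma (eventually_filter : ProperFilter \oo).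
have /cvg_ex[/= l cx] : cvg ((fun N => (xy N).1) @ U).
  by apply: (@ultrafilter_cvg_bounded _ _ _ _ _ A) => N; have [] := xyP N.
have cxy : (xy N).1 - (xy N).2 @[N --> U] --> 0.
  apply/cvgrPdist_le => r r0; apply: ooU.
  have /cvgrPdist_le/(_ _ r0) := @cvg_harmonic R; apply: filterS => N.
  rewrite !sub0r !normrN => h; have [_ _ h2 _] := xyP N.
  by apply: le_trans h2 (le_trans (ler_norm _) h).
have cy : (xy N).2 @[N --> U] --> l.
  have c : (xy N).1 - ((xy N).1 - (xy N).2) @[N --> U] --> l.
    by rewrite -[l]subr0; apply: cvgB.
  by apply: cvg_trans c; apply: near_eq_cvg; apply: nearW => N; rewrite subKr.
have cfx : f (xy N).1 @[N --> U] --> f l by exact: (cvg_comp _ _ cx (cf l)).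
have cfy : f (xy N).2 @[N --> U] --> f l by exact: (cvg_comp _ _ cy (cf l)).
have cd : f (xy N).1 - f (xy N).2 @[N --> U] --> 0 by rewrite -(subrr (f l));
  exact: cvgB.
have /cvgrPdist_lt/(_ _ e0)/(@filter_ex _ U)[N] := cd.
by rewrite sub0r normrN => h; have [_ _ _] := xyP N; rewrite ltNge ltW.
Qed.

(** * Distribution functions and weak convergence *)

Section real_probability.
Context (R : realType).
Implicit Types (nu mu : probability R R) (f : R -> R).

Definition dist_fun nu (x : R) : R := fine (nu `]-oo, x]%classic).

Lemma dist_fun_itv nu x : 0 <= dist_fun nu x <= 1.
Proof.
rewrite fine_ge0//= -lee_fin fineK ?fin_num_measure//; exact: probability_le1.
Qed.

Lemma dist_fun_nd nu x y : x <= y -> dist_fun nu x <= dist_fun nu y.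
Proof.
move=> xy; rewrite fine_le ?fin_num_measure// le_measure ?inE//.
by apply: subset_itvl; rewrite bnd_simp.
Qed.

Let e (t : nat -> R) i x : R := \1_(`]-oo, t i]%classic) x.

Let be t i : bounded_measurable (e t i).
Proof. by apply: bounded_measurable_indic. Qed.

Let int_e nu t i : \int[nu]_x e t i x = dist_fun nu (t i).
Proof. by rewrite /Rintegral integral_indic// setIT. Qed.

(** The sum is the integral of the step function equal to [f (t i.+1)] on []t i, t i.+1]] and 0
    elsewhere: the error is [eps] on these cells and at most [M] on the mass left outside. *)
Lemma step_approximation nu f (M eps : R) (t : nat -> R) n :
  measurable_fun setT f -> (forall x, `|f x| <= M) ->
  {homo t : i j / (i <= j)%N >-> i <= j} ->
  (forall i x, (i < n)%N -> t i < x <= t i.+1 -> `|f x - f (t i.+1)| <= eps) ->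
  0 <= eps ->
  `|\int[nu]_x f x - \sum_(i < n) f (t i.+1) * (dist_fun nu (t i.+1) - dist_fun nu (t i))|
    <= eps + M * (1 - dist_fun nu (t n) + dist_fun nu (t 0%N)).
Proof.
move=> mf fM tnd feps eps0.
have bf : bounded_measurable f by split=> //; exists M.
have M0 : 0 <= M by exact: le_trans (fM 0).
pose s x := \sum_(i < n) f (t i.+1) * (e t i.+1 x - e t i x).
have bd i : bounded_measurable (fun x => e t i.+1 x - e t i x)
  by exact: bounded_measurableB.
have bfd i : bounded_measurable (fun x => f (t i.+1) * (e t i.+1 x - e t i x)).
  by apply: bounded_measurableM => //; exact: bounded_measurable_cst.
have bs : bounded_measurable s by exact: bounded_measurable_sum.
have <- : \int[nu]_x s x =
    \sum_(i < n) f (t i.+1) * (dist_fun nu (t i.+1) - dist_fun nu (t i)).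
  rewrite bounded_Rintegral_sum//; apply: eq_bigr => i _.
  by rewrite bounded_RintegralZ// bounded_RintegralB// !int_e.
rewrite -bounded_RintegralB//.
apply: le_trans (le_normr_Rintegral measurableT (bounded_integrable nu (bounded_measurableB bf bs))) _.
have bc (c : R) : bounded_measurable (fun=> c : R) := @bounded_measurable_cst _ R R c.
have b1 : bounded_measurable (fun x => 1 - e t n x) by exact: bounded_measurableB.
have b2 : bounded_measurable (fun x => 1 - e t n x + e t 0%N x)
  by exact: bounded_measurableD.
have b3 : bounded_measurable (fun x => M * (1 - e t n x + e t 0%N x))
  by exact: bounded_measurableM.
rewrite -!int_e -[X in M * (X - _ + _)](Rintegral_probability_cst nu).
rewrite -bounded_RintegralB// -bounded_RintegralD// -bounded_RintegralZ//.
rewrite -[X in X + _](Rintegral_probability_cst nu) -bounded_RintegralD//.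
apply: bounded_le_Rintegral.
- exact/bounded_measurable_norm/bounded_measurableB.
- exact: bounded_measurableD.
move=> x.
have eE i : e t i x = (x <= t i)%R%:R.
  rewrite /e indicE; congr (_%:R); congr nat_of_bool.
  by apply/idP/idP; rewrite inE/= in_itv.
have e01 i : 0 <= e t i x <= 1 by rewrite eE; case: (x <= t i); rewrite /= ?lexx ?ler01.
have end_ i j : (i <= j)%N -> e t i x <= e t j x.
  move=> ij; rewrite !eE ler_nat; case: (leP x (t i)) => // xi.
  by rewrite (le_trans xi)// tnd.
have tele : \sum_(i < n) (e t i.+1 x - e t i x) = e t n x - e t 0%N x.
  by rewrite -(big_mkord xpredT (fun i => e t i.+1 x - e t i x)) telescope_sumr.
have -> : f x - s x = \sum_(i < n) (f x - f (t i.+1)) * (e t i.+1 x - e t i x) +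
    f x * (1 - e t n x + e t 0%N x).
  under eq_bigr do rewrite mulrBl.
  rewrite sumrB -mulr_sumr tele -/(s x); ring.
apply: le_trans (ler_normD _ _) (lerD _ _); last first.
  have h : 0 <= 1 - e t n x + e t 0%N x.
    by have /andP[? ?] := e01 n; have /andP[? ?] := e01 0%N; lra.
  by rewrite normrM (ger0_norm h) ler_wpM2r.
apply: le_trans (ler_norm_sum _ _ _) _.
apply: (@le_trans _ _ (\sum_(i < n) eps * (e t i.+1 x - e t i x))).
  apply: ler_sum => i _; have h : 0 <= e t i.+1 x - e t i x by rewrite subr_ge0 end_.
  rewrite normrM (ger0_norm h).
  rewrite !eE; have [x1|x1] := leP x (t i); have [x2|x2] := leP x (t i.+1);
    rewrite ?subrr ?mulr0//.
  - by move: x2; rewrite ltNge (le_trans x1)// tnd.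
  - by rewrite subr0 !mulr1 feps// x1.
rewrite -mulr_sumr tele ler_piMr//.
by have /andP[? ?] := e01 n; have /andP[? ?] := e01 0%N; lra.
Qed.

(* [G] is a limit of distribution functions along a dense set; it differs from
   the distribution function of [mu] at most at the atoms of [mu]. *)
Lemma dist_fun_weak_cvg (mu_ : nat -> probability R R) mu (G : R -> R) f (M : R) :
  (forall q : rat, dist_fun (mu_ k) (ratr q) @[k --> \oo] --> G (ratr q)) ->
  (forall x y, x < y -> dist_fun mu x <= G y) ->
  (forall x, G x <= dist_fun mu x) ->
  (forall r, 0 < r -> exists A : nat, 1 - r <= G A%:R /\ dist_fun mu (- A%:R) <= r) ->
  continuous f -> (forall x, `|f x| <= M) ->
  \int[mu_ k]_x f x @[k --> \oo] --> \int[mu]_x f x.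
Proof.
move=> muG FG GF Gtight cf fM.
have M0 : 0 <= M by exact: le_trans (fM 0).
have mf : measurable_fun setT f by exact: continuous_measurable_fun.
apply/cvgrPdist_le => e0_ e00.
have c0 : 0 < 5 + 9 * M by rewrite ltr_pwDl// mulr_ge0.
(* The four errors estimated below add up to at most [4 * r + 8 * M * r]. *)
pose r := e0_ / (5 + 9 * M).
have r0 : 0 < r by rewrite divr_gt0.
have [A [A1 A2]] := Gtight r r0.
have [N NP] := @uniform_modulus R f (A%:R) r cf r0.
(* Grid points are rational because convergence is assumed only there; the mesh comes from the
   uniform continuity of [f]. *)
pose tq i : rat := (i%:R / N.+1%:R - A%:R).
pose t i : R := ratr (tq i).
have tE i : t i = i%:R / N.+1%:R - A%:R.
  by rewrite /t /tq rmorphB/= fmorph_div/= !ratr_nat.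
pose n := (2 * A * N.+1)%N.
have N0 : 0 < N.+1%:R :> R by rewrite ltr0n.
have tn : t n = A%:R.
  by rewrite tE /n !natrM; field; rewrite gt_eqF.
have t0 : t 0%N = - A%:R by rewrite tE mul0r sub0r.
have tnd : {homo t : i j / (i <= j)%N >-> i <= j}.
  by move=> i j ij; rewrite !tE lerD2r ler_pM2r ?invr_gt0// ler_nat.
have tS i : t i.+1 = t i + N.+1%:R^-1.
  by rewrite !tE -[i.+1%:R]natr1 mulrDl mul1r addrAC.
have tA i : (i <= n)%N -> `|t i| <= A%:R.
  move=> i_n; rewrite ler_norml; apply/andP; split.
    by rewrite -t0 tnd.
  by rewrite -tn tnd.
have feps i x : (i < n)%N -> t i < x <= t i.+1 -> `|f x - f (t i.+1)| <= r.
  move=> i_n /andP[x1 x2]; apply: NP.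
  - have := tA _ i_n; have := tA _ (ltnW i_n); rewrite !ler_norml =>
      /andP[? ?] /andP[? ?].
    by apply/andP; split; lra.
  - exact: tA.
  - by rewrite distrC ger0_norm ?subr_ge0// tS addrAC gerDr subr_le0 ltW.
pose S (F : R -> R) := \sum_(i < n) f (t i.+1) * (F (t i.+1) - F (t i)).
have app nu := step_approximation nu mf fM tnd feps (ltW r0).
pose F := dist_fun mu.
have G0 x : 0 <= G x.
  have /andP[h _] := dist_fun_itv mu (x - 1); apply: le_trans h (FG _ _ _).
  by rewrite gtrBl.
(* [F] and [G] may differ much at a grid point that is an atom. But [F (t i) <= G (t i.+1)] makes
   the differences sum to at most 1, so after summation by parts the small increments of [f] control
   the error. *)
have SFG : `|S F - S G| <= r + 2 * M * r.
  pose D i := F (t i) - G (t i).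
  have D0 i : 0 <= D i by rewrite subr_ge0 GF.
  have -> : S F - S G = \sum_(i < n) f (t i.+1) * (D i.+1 - D i).
    by rewrite /S -sumrB; apply: eq_bigr => i _; rewrite /D; ring.
  have -> : \sum_(i < n) f (t i.+1) * (D i.+1 - D i) =
      f (t n) * D n - f (t 0%N) * D 0%N - \sum_(i < n) (f (t i.+1) - f (t i)) * D i.
    elim: n {tn tA feps S app} => [|m IH]; first by rewrite !big_ord0 subr0 subrr.
    by rewrite !big_ord_recr/= IH; ring.
  have Dn : D n <= r.
    have /andP[_ ?] : 0 <= F A%:R <= 1 by exact: dist_fun_itv.
    by rewrite /D tn; lra.
  have Dz : D 0%N <= r.
    by rewrite /D t0; have := G0 (- A%:R); rewrite -/F in A2; lra.
  have sumD : \sum_(i < n) D i <= 1.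
    apply: (@le_trans _ _ (\sum_(i < n) (G (t i.+1) - G (t i)))).
      apply: ler_sum => i _; rewrite lerD2r FG// tS ltrDl invr_gt0//.
    rewrite -(big_mkord xpredT (fun i => G (t i.+1) - G (t i))) telescope_sumr//.
    have := GF (t n); have /andP[_ h] := dist_fun_itv mu (t n) => h'.
    by have := G0 (t 0%N); lra.
  apply: le_trans (ler_normB _ _) _.
  have s1 : `|f (t n) * D n - f (t 0%N) * D 0%N| <= M * r + M * r.
    by apply: le_trans (ler_normB _ _) (lerD _ _); rewrite normrM ler_pM// ger0_norm.
  have s2 : `|\sum_(i < n) (f (t i.+1) - f (t i)) * D i| <= r.
    apply: le_trans (ler_norm_sum _ _ _) _.
    apply: (@le_trans _ _ (\sum_(i < n) r * D i)); last first.
      by rewrite -mulr_sumr ler_piMr// ltW.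
    apply: ler_sum => i _; rewrite normrM (ger0_norm (D0 i)) ler_wpM2r//.
    apply: NP; [exact: tA|by apply: tA; exact: ltnW|].
    by rewrite tS addrAC subrr add0r ger0_norm// invr_ge0.
  by move: s1 s2; lra.
have cF i : dist_fun (mu_ k) (t i) @[k --> \oo] --> G (t i) by exact: muG.
have cS : S (dist_fun (mu_ k)) @[k --> \oo] --> S G.
  apply: cvg_big => [|i _]; first exact: add_continuous.
  by apply: cvgM; [exact: cvg_cst|apply: cvgB].
have /cvgrPdist_le/(_ _ r0) n1 := cS.
have /cvgrPdist_le/(_ _ r0) n2 := cF n.
have /cvgrPdist_le/(_ _ r0) n3 := cF 0%N.
apply: filterS3 n1 n2 n3 => k; rewrite tn t0 => k1 k2 k3.
have a1 := app mu; have a2 := app (mu_ k).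
rewrite -/(S (dist_fun (mu_ k))) tn t0 in a2;
  rewrite -/(S (dist_fun mu)) -/F tn t0 in a1.
have FA : G A%:R <= F A%:R by exact: GF.
have GA : G (- A%:R) <= F (- A%:R) by exact: GF.
have b1 : M * (1 - F A%:R + F (- A%:R)) <= M * (2 * r).
  by rewrite ler_wpM2l//; rewrite -/F in A2; lra.
have b2 : M * (1 - dist_fun (mu_ k) A%:R + dist_fun (mu_ k) (- A%:R)) <= M * (4 * r).
  rewrite ler_wpM2l//; rewrite -/F in A2.
  by move: k2 k3; rewrite !ler_distl => /andP[? ?] /andP[? ?]; lra.
have e_r : e0_ = 5 * r + 9 * (M * r).
  by rewrite /r; field; rewrite gt_eqF.
have Mr : 0 <= M * r by rewrite mulr_ge0// ltW.
have -> : \int[mu]_x f x - \int[mu_ k]_x f x = (\int[mu]_x f x - S F) + (S F - S G) +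
    (S G - S (dist_fun (mu_ k))) - (\int[mu_ k]_x f x - S (dist_fun (mu_ k))) by ring.
apply: le_trans (ler_normB _ _) _; apply: le_trans (lerD (ler_normD _ _) (lexx _)) _.
apply: le_trans (lerD (lerD (ler_normD _ _) (lexx _)) (lexx _)) _.
rewrite e_r; move: a1 a2 SFG k1 b1 b2; lra.
Qed.

End real_probability.

(** The Lebesgue-Stieltjes measure of [F], pushed forward by the identity from [measurableTypeR R],
    where it is declared, to [R]. *)
Lemma exists_dist_fun (R : realType) (F : R -> R) :
  {homo F : x y / x <= y} -> right_continuous F ->
  F @ -oo --> (0 : R) -> F @ +oo --> (1 : R) ->
  exists mu : probability R R, forall x, dist_fun mu x = F x.
Proof.
move=> nd rc Ny y.
pose FC : cumulativeBounded (0 : R) (1 : R) :=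
  HB.pack_for (cumulativeBounded (0 : R) (1 : R)) F
    (isCumulative.Build R _ R F nd rc) (isCumulativeBounded.Build R 0 1 F Ny y).
pose id_ : {mfun measurableTypeR R >-> R} :=
  HB.pack_for {mfun measurableTypeR R >-> R} (idfun : measurableTypeR R -> R)
   (@isMeasurableFun.Build _ _ _ _ (idfun : measurableTypeR R -> R) (@measurable_id _ _ setT)).
exists (distribution (lebesgue_stieltjes_measure FC) id_) => x.
rewrite /dist_fun.
have := cdf_lebesgue_stieltjes_id FC x; rewrite /cdf => h.
rewrite (_ : _ `]-oo, x]%classic = (F x)%:E)//.
Qed.

(** * Tight sequences of laws on the half-line *)

Section tight.
Context d (T : measurableType d) (R : realType) (P : probability T R).
Variable X_ : nat -> L0 P.
Hypothesis X0 : forall n, {ae P, forall w, 0 <= X_ n w}.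
Hypothesis X_tight : forall r, 0 < r ->
  exists A : R, forall n, (P [set w | (A < X_ n w)%R] <= r%:E)%E.

Let Fn n x : R := dist_fun (law (X_ n)) x.

Let FnE n x : (Fn n x)%:E = P [set w | X_ n w <= x].
Proof.
by rewrite /Fn /dist_fun fineK ?fin_num_measure// /law /distribution /pushforward.
Qed.

Let mX n : measurable_fun setT (X_ n : T -> R).
Proof. exact: L0_measurable. Qed.

Let Fn_lt0 n x : x < 0 -> Fn n x = 0.
Proof.
move=> x0; apply: EFin_inj; rewrite FnE; apply/eqP; rewrite eq_le measure_ge0 andbT.
have [N [mN N0 NX]] := X0 n.
apply: (@le_trans _ _ (P N)); last by rewrite N0.
apply: le_measure; rewrite ?inE//.
  by rewrite -[X in measurable X]setTI; exact: measurable_fun_le.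
by move=> w /= Xx; apply: NX => /= /le_trans /(_ Xx); rewrite leNgt x0.
Qed.

Let Fn_tight r : 0 < r -> exists A : R, forall n, 1 - r <= Fn n A.
Proof.
move=> /X_tight[A AP]; exists A => n.
rewrite -lee_fin FnE (_ : [set w | X_ n w <= A] = ~` [set w | (A < X_ n w)%R]);
  last first.
  by apply/seteqP; split=> w /=; rewrite leNgt => /negP.
rewrite probability_setC; last first.
  rewrite (_ : [set w | _] = ~` [set w | X_ n w <= A]).
    by apply: measurableC; rewrite -[X in measurable X]setTI; exact: measurable_fun_le.
  by apply/seteqP; split=> w /=; rewrite ltNge => /negP.
by rewrite EFinB leeB// AP.
Qed.

(** Along an ultrafilter the distribution functions converge at every point; tightness prevents loss
    of mass at infinity. A true subsequence is then needed at the countably many rationals only. *)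
Lemma tight_laws_weakly_precompact : exists2 n_, subsequence n_ &
  exists2 mu : probability R R, mu (@Rplus R) = 1%E &
    weak_cvg_Rplus (fun k => law (X_ (n_ k))) mu.
Proof.
have [U [UU ooU]] := ultraFilterLemma (eventually_filter : ProperFilter \oo).
have Fn01 n x : 0 <= Fn n x <= 1 by exact: dist_fun_itv.
pose G x : R := lim (Fn n x @[n --> U]).
have cG x : Fn n x @[n --> U] --> G x.
  apply: (@ultrafilter_cvg_bounded _ _ _ _ _ 1) => n.
  by have /andP[? ?] := Fn01 n x; rewrite ger0_norm.
have isG x : cvg (Fn n x @[n --> U]) by apply/cvg_ex; exists (G x).
have G0 x : 0 <= G x by apply: limr_ge => //; apply: nearW => n;
  have /andP[] := Fn01 n x.
have G1 x : G x <= 1 by apply: limr_le => //; apply: nearW => n;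
  have /andP[] := Fn01 n x.
have Gnd x y : x <= y -> G x <= G y.
  by move=> xy; apply: (ler_cvg_to (cG x) (cG y)); apply: nearW => n;
    exact: dist_fun_nd.
have Glt0 x : x < 0 -> G x = 0.
  move=> x0; apply: cvg_lim => //; apply: cvg_near_cst; apply: nearW => n.
  exact: Fn_lt0.
have Gtight r : 0 < r -> exists A : R, 1 - r <= G A.
  move=> /Fn_tight[A AP]; exists A.
  by apply: limr_ge => //; apply: nearW => n; exact: AP.
(* A limit of distribution functions need not be right-continuous; the infimum of its values to the
   right of [x] is. *)
pose S x := [set G y | y in [set y | x < y]].
have S_inf x : has_inf (S x).
  split; first by exists (G (x + 1)), (x + 1) => //=; rewrite ltrDl.
  by exists 0 => _ [y _ <-].
pose F x := inf (S x).
have FG x y : x < y -> F x <= G y.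
  by move=> xy; apply: ge_inf; [exact: (S_inf x).2|exists y].
have GF x : G x <= F x.
  by apply: lb_le_inf; [exact: (S_inf x).1|move=> _ [y /= /ltW xy <-]; exact: Gnd].
have Fnd : {homo F : x y / x <= y}.
  move=> x y xy; apply: lb_le_inf; first exact: (S_inf y).1.
  by move=> _ [z /= yz <-]; apply: FG; exact: le_lt_trans yz.
have Frc : right_continuous F.
  move=> x; apply/cvgrPdist_lt => e e0.
  have [_ [y /= xy <-] Gy] := inf_adherent e0 (S_inf x).
  near=> z.
  have xz : x < z by near: z; exact: nbhs_right_gt.
  rewrite distrC ger0_norm ?subr_ge0 ?Fnd ?ltW// ltrBlDl.
  apply: le_lt_trans Gy; apply: FG; near: z; exact: nbhs_right_lt.
have Flt0 x : x < 0 -> F x = 0.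
  move=> x0; apply/eqP; rewrite eq_le (le_trans (G0 x) (GF x)) andbT.
  have h : x < x / 2 by lra.
  by rewrite -(Glt0 (x / 2)) ?FG//; lra.
have FNy : F @ -oo --> (0 : R).
  apply: cvg_near_cst; exists 0; split=> [|x x0]; first exact: num_real.
  exact: Flt0.
have Fy : F @ +oo --> (1 : R).
  apply/cvgrPdist_le => e e0; have [A eA] := Gtight e e0.
  exists A; split=> [|x Ax]; first exact: num_real.
  have F1 : F x <= 1 by apply: le_trans (FG x (x + 1) _) (G1 _); rewrite ltrDl.
  have := le_trans eA (le_trans (GF A) (Fnd _ _ (ltW Ax))).
  by rewrite ger0_norm ?subr_ge0//; lra.
have [mu muF] := exists_dist_fun Fnd Frc FNy Fy.
(* An enumeration of the rationals, with 0 for the numbers that code none. *)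
pose qn i : rat := odflt 0 (unpickle i).
pose A0 b n := forall i, (i <= b)%N -> `|G (ratr (qn i)) - Fn n (ratr (qn i))| <= 2^-1 ^+ b.
have [||n_ [n_lt n_P _]] := increasing_selection (A0 := A0) (A := fun _ _ _ =>
  True) ooU.
- move=> b; apply: filter_forall_leq => i.
  have e0 : 0 < 2^-1 ^+ b :> R by rewrite exprn_gt0// invr_gt0.
  by have /cvgrPdist_le/(_ _ e0) := cG (ratr (qn i)).
- by move=> b m; apply: nearW.
have mu0 : {ae mu, forall x, 0 <= x}.
  have : {ae mu, forall x n, - n.+1%:R^-1 < x}.
    apply: ae_foralln => n; exists `]-oo, - n.+1%:R^-1]%classic; split => //.
      have /eqP : dist_fun mu (- n.+1%:R^-1) = 0.
        by rewrite muF Flt0// oppr_lt0 invr_gt0.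
      by rewrite /dist_fun fine_eq0 ?fin_num_measure// => /eqP.
    by move=> x /= /negP; rewrite -leNgt in_itv.
  apply: filterS => x xn; rewrite leNgt; apply/negP => x0.
  have := xn (Num.bound (- x)^-1); rewrite ltrNl; apply/negP; rewrite -leNgt.
  rewrite -[leRHS]invrK lef_pV2 ?posrE ?invr_gt0 ?oppr_gt0//.
  apply: ltW; apply: lt_le_trans (archi_boundP _) _; last by rewrite ler_nat.
  by rewrite invr_ge0 oppr_ge0 ltW.
have mRp : measurable (@Rplus R) by exact: measurable_itv.
have RplusP (x : R) : Rplus x <-> 0 <= x by rewrite /Rplus/= in_itv/= andbT.
have intE (nu : probability R R) (f : R -> R) : {ae nu, forall x, 0 <= x} ->
    bounded_measurable (fun x : R => f (Num.max x 0)) ->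
    (\int[nu]_(x in @Rplus R) (f x)%:E)%E = (\int[nu]_x f (Num.max x 0))%:E.
  move=> nu0 bf; rewrite -bounded_RintegralE// integral_mkcond.
  have mR : measurable_fun setT ((fun x : R => (f x)%:E) \_ (@Rplus R)).
    have -> : (fun x : R => (f x)%:E) \_ (@Rplus R) =
        (fun x : R => (f (Num.max x 0))%:E) \_ (@Rplus R).
      apply/funext => x; rewrite /patch; case: ifPn => //.
      by rewrite inE => /RplusP x0; rewrite max_l.
    apply/(measurable_restrictT _ mRp); apply: measurable_funTS.
    by apply: measurableT_comp => //; case: bf.
  apply: ae_eq_integral => //; first by apply/measurable_EFinP; case: bf.
  apply: filterS nu0 => x x0 _; rewrite /patch ifT ?max_l//.
  by rewrite inE; apply/RplusP.
exists n_ => //; exists mu.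
  by apply/probability1_ae => //; apply: filterS mu0 => x /RplusP.
move=> f cf [M fM].
(* Extending [f] by its value at 0 makes it continuous and bounded on the whole line, without
   changing integrals against laws carried by [Rplus]. *)
pose g (x : R) : R := f (Num.max x 0).
have gM (x : R) : `|g x| <= M by apply: fM; rewrite RplusP le_max lexx orbT.
have cg : continuous g.
  move=> x; apply/cvgrPdist_lt => e e0.
  have x0 : Rplus (Num.max x 0) by rewrite RplusP le_max lexx orbT.
  have /(_ _ x0)/cvgrPdist_lt/(_ _ e0) := (subspace_continuousP (@Rplus R) f).1 cf.
  rewrite near_withinE => -[r /= r0 rP]; exists r => //= y xy.
  apply: rP; last by rewrite RplusP le_max lexx orbT.
  apply: le_lt_trans xy; rewrite /=.
  have h1 := ler_norm (x - y); have h2 := ler_norm (- (x - y)); rewrite normrN in h2.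
  have h3 := normr_ge0 (x - y); move: `|x - y| h1 h2 h3 => a h1 h2 h3.
  by rewrite ler_norml; case: (leP x 0) => ?; case: (leP y 0) => ?; apply/andP;
    split; lra.
have bg : bounded_measurable g.
  by split; [exact: continuous_measurable_fun|exists M].
have law0 n : {ae law (X_ n), forall x, 0 <= x}.
  apply: filterS ((probability1_ae (law (X_ n)) mRp).1 _) => [x /RplusP//|].
  have mA : measurable ((X_ n : T -> R) @^-1` @Rplus R).
    by rewrite -[X in measurable X]setTI; exact: (@mX n measurableT _ mRp).
  rewrite /law /distribution /pushforward; apply/(probability1_ae P mA).
  by apply: filterS (X0 n) => w h; apply/RplusP.
rewrite intE//.
have cint : \int[law (X_ (n_ k))]_x g x @[k --> \oo] --> \int[mu]_x g x.
  apply: (@dist_fun_weak_cvg _ _ _ G _ M) => //.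
  - move=> q; apply/cvgrPdist_le => e e0.
    have : (2^-1 : R) ^+ k @[k --> \oo] --> 0.
      by apply: cvg_expr; rewrite ger0_norm ?invr_ge0// invf_lt1 ?ltr1n.
    move=> /cvgrPdist_le/(_ _ e0)[K _ KP].
    exists (maxn K (pickle q)) => // k /=; rewrite geq_max => /andP[Kk qk].
    have := n_P k _ qk; rewrite /qn pickleK/= => h; apply: le_trans h _.
    have := KP k Kk; rewrite sub0r normrN; apply: le_trans; exact: ler_norm.
  - by move=> x y xy; rewrite muF FG.
  - by move=> x; rewrite muF.
  - move=> r r0; have [A AP] := Gtight r r0.
    exists (Num.bound `|A|).+1; split.
      apply: le_trans AP (Gnd _ _ _); apply: le_trans (ler_norm _) _.
      apply: ltW; apply: lt_le_trans (archi_boundP (normr_ge0 _)) _.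
      by rewrite ler_nat.
    by rewrite muF Flt0 ?ltW// oppr_lt0.
apply: cvg_EFin.
  by apply: nearW => k; rewrite intE//; exact: law0.
apply: cvg_trans cint; apply: near_eq_cvg; apply: nearW => k /=.
rewrite intE//; exact: law0.
Unshelve. all: by end_near.
Qed.

End tight.

(** * Changes of measure and convergence in L0 *)

Section density.
Local Open Scope charge_scope.
Context d (T : measurableType d) (R : realType) (P : probability T R).
Variable D : T -> R.
Hypothesis mD : measurable_fun setT D.
Hypothesis D0 : forall w, 0 <= D w.
Hypothesis D1 : (\int[P]_w (D w)%:E = 1)%E.

Definition density_measure (A : set T) : \bar R := (\int[P]_(w in A) (D w)%:E)%E.

Let mDE : measurable_fun setT (fun w => (D w)%:E).
Proof. exact/measurable_EFinP. Qed.

Let dens0 : density_measure set0 = 0%E.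
Proof. exact: integral_set0. Qed.

Let dens_ge0 A : (0 <= density_measure A)%E.
Proof. by apply: integral_ge0 => w _; rewrite lee_fin. Qed.

Let dens_sigma : semi_sigma_additive density_measure.
Proof.
move=> F mF tF mUF; rewrite /density_measure ge0_integral_bigcup//.
- by apply: is_cvg_nneseries => n _ _; exact: dens_ge0.
- exact: measurable_funTS.
- by move=> w _; rewrite lee_fin.
Qed.

HB.instance Definition _ := isMeasure.Build _ _ _ density_measure
  dens0 dens_ge0 dens_sigma.

HB.instance Definition _ := @Measure_isProbability.Build _ _ _ density_measure D1.

Let Q : probability T R := density_measure.

Let QP : Q `<< P.
Proof.
apply/null_content_dominatesP => A mA PA.
by rewrite /Q/= /density_measure null_set_integral//; exact: measurable_funTS.
Qed.

Let RN : ae_eq P setT ('d (charge_of_finite_measure Q) '/d P) (fun w => (D w)%:E).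
Proof.
apply: integral_ae_eq => //; first exact: Radon_Nikodym_integrable.
by move=> A _ mA; rewrite -Radon_Nikodym_integral.
Qed.

Lemma density_probability M : (forall w, D w <= M) -> {ae P, forall w, 0 < D w} ->
  exists Q : probability T R, [/\ equivalent_probability P Q, bounded_density P Q &
    forall f : T -> R, measurable_fun setT f -> (forall w, 0 <= f w) ->
      (\int[Q]_w (f w)%:E = \int[P]_w (f w * D w)%:E)%E].
Proof.
move=> DM Dpos; exists Q; split.
- split=> //; apply/null_content_dominatesP => A mA QA.
  have : ae_eq P A (fun w => (D w)%:E) (cst 0%E).
    apply/ae_eq_integral_abs => //; first exact: measurable_funTS.
    by under eq_integral do rewrite /= ger0_norm//.
  move=> DA; have nA : {ae P, forall w, ~ A w}.
    apply: filterS2 DA Dpos => w DA D0w Aw.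
    by have [D0'] := DA Aw; move: D0w; rewrite D0' ltxx.
  have [N [mN N0 AN]] := nA.
  apply: (subset_measure0 mA mN _ N0) => w Aw; apply: AN => /=; exact.
- exists M; apply: filterS RN => w /(_ I) ->.
  by rewrite lee_fin ger0_norm.
- move=> f mf f0.
  have mfE : measurable_fun setT (fun w => (f w)%:E) by exact/measurable_EFinP.
  have fE0 w : (0 <= (f w)%:E)%E by rewrite lee_fin.
  rewrite -(Radon_Nikodym_SigmaFinite.change_of_variables QP fE0 measurableT mfE).
  apply: ae_eq_integral => //.
  + apply: emeasurable_funM; first exact/measurable_EFinP.
    exact: measurable_int (Radon_Nikodym_SigmaFinite.f_integrable _).
  + by apply/measurable_EFinP; exact: measurable_funM.
  have := ae_eq_Radon_Nikodym_SigmaFinite QP measurableT.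
  by apply: filterS2 RN => w /(_ I) h1 /(_ I) h2 _; rewrite h2 h1.
Qed.

End density.

(** * Boundedness and convergence in L0 *)

Section L0_convergence.
Context d (T : measurableType d) (R : realType) (P : probability T R).
Implicit Types (X Y : L0 P) (B : set (L0 P)).

Lemma ae_le_measure (A C : set T) : measurable A -> measurable C ->
  {ae P, forall w, A w -> C w} -> (P A <= P C)%E.
Proof.
move=> mA mC [N [mN N0 AC]].
apply: (@le_trans _ _ (P (C `|` N))).
  apply: le_measure; rewrite ?inE//; first exact: measurableU.
  move=> w Aw; have [Cw|nCw] := pselect (C w); [by left|right].
  by apply: AC => /= /(_ Aw).
by apply: le_trans (measureU2 P mC mN) _; rewrite [X in (_ + X)%E]N0 adde0.
Qed.

Lemma measure_cvg0 (A : nat -> set T) : (forall n, measurable (A n)) ->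
  {ae P, forall w, \forall n \near \oo, ~ A n w} -> P (A n) @[n --> \oo] --> 0%E.
Proof.
move=> mA nA.
have h : \int[P]_w (\1_(A n) w : R) @[n --> \oo] --> 0.
  rewrite -[X in _ --> X](Rintegral_probability_cst P).
  apply: (@bounded_dominated_cvg _ _ _ _ _ _ 1) => //.
  - by move=> n; exact: measurable_indic.
  - by move=> n w; rewrite indicE; case: (_ \in _); rewrite ?normr1// normr0.
  - apply: filterS nA => w Aw; apply: cvg_near_cst; apply: filterS Aw => n ?.
    by rewrite indicE memNset.
rewrite (_ : (fun n => P (A n)) = fun n => (\int[P]_w (\1_(A n) w : R))%:E).
  by apply: cvg_EFin => //; exact: nearW.
apply/funext => n; rewrite -bounded_RintegralE; last exact: bounded_measurable_indic.
by rewrite integral_indic// setIT.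
Qed.

Lemma L0_gap_measurable X Y (e : R) : measurable [set w | e <= `|X w - Y w|].
Proof.
rewrite -[X in measurable X]setTI; apply: measurable_fun_le => //.
apply: measurableT_comp => //; apply: measurable_funB; exact: L0_measurable.
Qed.

Lemma L0_eq0 X : (forall e, 0 < e -> P [set w | e <= `|X w|] = 0%E) -> X = 0.
Proof.
move=> X0; apply/L0_eqP.
have : {ae P, forall w n, `|X w| < n.+1%:R^-1}.
  apply: ae_foralln => n; exists [set w | n.+1%:R^-1 <= `|X w|]; split.
  - rewrite -[X in measurable X]setTI; apply: measurable_fun_le => //.
    by apply: measurableT_comp => //; exact: L0_measurable.
  - by apply: X0; rewrite invr_gt0.
  - by move=> w /= /negP; rewrite -leNgt.
apply: filterS2 (L0_0E P) => w -> Xw; apply/eqP;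
  rewrite -normr_eq0 eq_le normr_ge0 andbT.
rewrite leNgt; apply/negP => Xpos.
have := Xw (Num.bound `|X w|^-1); apply/negP; rewrite -leNgt.
rewrite -[leRHS]invrK lef_pV2 ?posrE ?invr_gt0//.
apply: ltW; apply: lt_le_trans (archi_boundP _) _; last by rewrite ler_nat.
by rewrite invr_ge0.
Qed.

Lemma as_cvg_prob_cvg (Y_ : nat -> L0 P) X : as_cvg Y_ X -> prob_cvg Y_ X.
Proof.
move=> YX; apply/L0_cvgP => e e0.
pose A n := [set w | e <= `|X w - Y_ n w|].
have mA n : measurable (A n) by exact: L0_gap_measurable.
apply: measure_cvg0 => //; apply: filterS YX => w /cvgrPdist_lt/(_ _ e0).
by apply: filterS => n h; apply/negP; rewrite -ltNge.
Qed.

Lemma cesaro_meanE (Y_ : nat -> L0 P) : {ae P, forall w k,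
  cesaro_mean Y_ k w = k.+1%:R^-1 * \sum_(l < k.+1) Y_ l w}.
Proof.
apply: ae_foralln => k; rewrite /cesaro_mean.
have sumE n : {ae P, forall w, (\sum_(l < n) Y_ l : L0 P) w = \sum_(l < n) Y_ l w}.
  elim: n => [|n IH].
    by rewrite big_ord0; apply: filterS (L0_0E P) => w ->; rewrite big_ord0.
  rewrite big_ord_recr/=.
  apply: filterS2 (L0_DE (\sum_(l < n) Y_ l) (Y_ n)) IH => w -> ->.
  by rewrite big_ord_recr.
by apply: filterS2 (L0_ZE k.+1%:R^-1 (\sum_(l < k.+1) Y_ l)) (sumE k.+1) => w -> ->.
Qed.

Lemma dominates_ae (Q : probability T R) (A : T -> Prop) : Q `<< P ->
  {ae P, forall w, A w} -> {ae Q, forall w, A w}.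
Proof.
move=> /null_content_dominatesP QP [N [mN N0 AN]].
by exists N; split=> //; exact: QP.
Qed.

(** Balls around 0 are balanced: once [|a n| * c <= 1], multiplying a point of the ball by [a n * c]
    only lowers its absolute value. *)
Lemma topologically_bounded_sequentially B :
  topologically_bounded B -> sequentially_bounded B.
Proof.
move=> tB X_ a BX a0; apply/cvg_ballP => e e0.
have [c c0 Bc] := tB _ (nbhsx_ballx (0 : L0 P) e e0).
have ci : 0 < c^-1 by rewrite invr_gt0.
have /cvgrPdist_le/(_ _ ci) := a0; apply: filterS => n; rewrite sub0r normrN => an.
have [Y YB <-] := Bc _ (BX n).
change (P [set w | (e <= `|(0 : L0 P) w - (a n *: (c *: Y) : L0 P) w|)%R] < e%:E)%E.
have {}YB : (P [set w | (e <= `|(0 : L0 P) w - (Y : L0 P) w|)%R] < e%:E)%E by exact: YB.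
apply: le_lt_trans YB; apply: ae_le_measure; [exact: L0_gap_measurable..|].
rewrite scalerA; apply: filterS2 (L0_0E P) (L0_ZE (a n * c) Y) => w /= -> ->.
rewrite !sub0r !normrN normrM => h; apply: le_trans h _.
rewrite ler_piMl// normrM (gtr0_norm c0) -(mulVf (lt0r_neq0 c0)).
by rewrite ler_pM2r.
Qed.

Definition tight B := forall r, 0 < r ->
  exists A : R, forall X, B X -> (P [set w | (A < X w)%R] <= r%:E)%E.

Lemma L0_above_measurable X (a : R) : measurable [set w | a < X w].
Proof.
rewrite (_ : [set w | _] = ~` [set w | X w <= a]).
  apply: measurableC; rewrite -[X in measurable X]setTI.
  by apply: measurable_fun_le => //; exact: L0_measurable.
by apply/seteqP; split=> w /=; rewrite ltNge => /negP.
Qed.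

Lemma tight_topologically_bounded B : B `<=` @L0_plus _ _ _ P ->
  tight B -> topologically_bounded B.
Proof.
move=> B0 tB V /nbhs_ballP[e /= e0 eV].
have e2 : 0 < e / 2 by rewrite divr_gt0.
have [A AP] := tB _ e2.
(* With this scale [e <= a^-1 * X] means [|A| + 1 <= X], hence [A < X]; the level [e / 2] for [A]
   leaves room for the strict inequality defining the ball. *)
pose a := (`|A| + 1) / e.
have a0 : 0 < a by rewrite divr_gt0// ltr_wpDl.
exists a => // X BX; exists (a^-1 *: X); last first.
  by rewrite /= scalerA mulfV ?scale1r// gt_eqF.
apply: eV; change (P [set w | (e <= `|(0 : L0 P) w - (a^-1 *: X : L0 P) w|)%R] < e%:E)%E.
apply: (@le_lt_trans _ _ (e / 2)%:E); last by rewrite lte_fin; lra.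
apply: le_trans (AP _ BX); apply: ae_le_measure.
- exact: L0_gap_measurable.
- exact: L0_above_measurable.
- apply: filterS3 (L0_0E P) (L0_ZE a^-1 X) ((L0_plusP X).1 (B0 _ BX)) => w /= -> -> Xw.
  rewrite sub0r normrN normrM (ger0_norm Xw) gtr0_norm ?invr_gt0//.
  rewrite mulrC ler_pdivlMr// /a mulrCA mulfV ?mulr1 ?gt_eqF// => h.
  by apply: lt_le_trans h; rewrite ltr_pwDr// ler_norm.
Qed.

(** If the gauge vanished, [X] would be [a n *: Y n] with [Y n] in [B] and [a n] tending to 0, so
    the constant sequence [X] would tend to 0. *)
Lemma sequentially_bounded_gauge B X : sequentially_bounded B -> X <> 0 ->
  (0 < gauge B X)%E.
Proof.
move=> sB X0; rewrite ltNge; apply/negP => gX; apply: X0.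
have /choice[aY aYP] n : exists aY : R * L0 P,
    [/\ 0 < aY.1, aY.1 < n.+1%:R^-1, B aY.2 & aY.1 *: aY.2 = X].
  have : (gauge B X < (n.+1%:R^-1)%:E)%E by rewrite (le_lt_trans gX)// lte_fin invr_gt0.
  move=> /ereal_inf_lt[_ [a [a0 [Y BY YX]] <-]]; rewrite lte_fin => an.
  by exists (a, Y).
have a0 : (aY n).1 @[n --> \oo] --> 0.
  apply/cvgrPdist_le => e e0.
  have /cvgrPdist_le/(_ _ e0) := @cvg_harmonic R; apply: filterS => n.
  rewrite !sub0r !normrN => h; have [h1 h2 _ _] := aYP n.
  rewrite gtr0_norm//; apply: le_trans (ltW h2) (le_trans (ler_norm _) h).
have BY n : B (aY n).2 by have [] := aYP n.
have /L0_cvgP h := sB _ _ BY a0.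
apply: L0_eq0 => e e0.
have hX : P [set w | e <= `|(0 : L0 P) w - X w|] = 0%E.
  have := h e e0; rewrite (_ : (fun n =>
    _) = fun=> P [set w | e <= `|(0 : L0 P) w - X w|]).
    by move=> /(cvg_unique _ (cvg_cst _)) <-.
  by apply/funext => n; have [_ _ _ ->] := aYP n.
apply/eqP; rewrite -measure_le0 -hX; apply: ae_le_measure.
- rewrite -[X in measurable X]setTI; apply: measurable_fun_le => //.
  by apply: measurableT_comp => //; exact: L0_measurable.
- exact: L0_gap_measurable.
- by apply: filterS (L0_0E P) => w /= ->; rewrite sub0r normrN.
Qed.

(** The Komlos theorem is applied under [Q] to representatives clipped at 0; almost sure convergence
    returns to [P] because the null sets agree. *)
Lemma L1_bounded_komlos (Q : probability T R) B : B `<=` @L0_plus _ _ _ P ->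
  equivalent_probability P Q -> L1_bounded Q B ->
  forall X_ : nat -> L0 P, (forall n, B (X_ n)) ->
    exists2 n_, subsequence n_ & exists2 X, L0_plus X &
      forall sigma : nat -> nat, injective sigma ->
        as_cvg (cesaro_mean (X_ \o (n_ \o sigma))) X.
Proof.
move=> B0 [PQ QP] QB X_ BX.
have [C CP] : exists C : R, forall X, B X -> ('E_Q[L0_fun X] <= C%:E)%E.
  have ub X : B X -> ('E_Q[L0_fun X] <= ereal_sup [set 'E_Q[L0_fun X] | X in B])%E.
    by move=> BX'; apply: ereal_sup_ubound; exists X.
  move: QB ub; rewrite /L1_bounded; case: (ereal_sup _) => [C _ ub|//|_ ub].
    by exists C.
  by exists 0 => X /ub /le_trans; apply; rewrite leNye.
pose f n w := Num.max (X_ n w) 0.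
have mf n : measurable_fun setT (f n).
  by apply: measurable_maxr => //; exact: L0_measurable.
have f0 n w : 0 <= f n w by rewrite le_max lexx orbT.
have fX n : {ae P, forall w, f n w = X_ n w}.
  by apply: filterS ((L0_plusP _).1 (B0 _ (BX n))) => w h; rewrite /f max_l.
have fC n p : \int[Q]_w Num.min (f n w) p.+1%:R <= C.
  have bfp : bounded_measurable (fun w => Num.min (f n w) p.+1%:R).
    apply: (bounded_measurable_itv (a := 0) (b := p.+1%:R)).
      exact: measurable_minr.
    by move=> w; rewrite le_min f0 ler0n/= ge_min lexx orbT.
  rewrite -lee_fin -bounded_RintegralE//; apply: le_trans (CP _ (BX n)).
  rewrite expectation_def.
  have <- : (\int[Q]_w (f n w)%:E = \int[Q]_w (X_ n w)%:E)%E.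
    apply: ae_eq_integral => //.
    - exact/measurable_EFinP.
    - by apply/measurable_EFinP; exact: L0_measurable.
    - by apply: (dominates_ae QP); apply: filterS (fX n) => w -> _.
  apply: ge0_le_integral => //.
  - by move=> w _; rewrite lee_fin le_min f0 ler0n.
  - by apply/measurable_EFinP; case: bfp.
  - exact/measurable_EFinP.
  - by move=> w _; rewrite lee_fin ge_min lexx.
have [n_ n_lt [F [mF F0 Fcvg]]] := komlos_injective mf f0 fC.
have [X XF] := L0_lift P mF.
exists n_ => //; exists X.
  by apply/L0_plusP; apply: filterS XF => w ->.
move=> sigma sI.
have FcvgP : {ae P, forall w,
    k.+1%:R^-1 * \sum_(l < k.+1) f (n_ (sigma l)) w @[k --> \oo] --> F w}.
  have [N [mN N0 FN]] := Fcvg sigma sI.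
  by exists N; split=> //; move/null_content_dominatesP : PQ; exact.
have fXall : {ae P, forall w n, f n w = X_ n w} by exact: ae_foralln.
apply: filterS3 (filterI FcvgP XF) fXall
  (cesaro_meanE (X_ \o (n_ \o sigma))) => w [Fw ->] fw cw.
apply: cvg_trans Fw; apply: near_eq_cvg; apply: nearW => k; rewrite cw.
by congr (_ * _); apply: eq_bigr => l _; rewrite fw.
Qed.

Lemma subsequence_geq (n_ : nat -> nat) k : subsequence n_ -> (k <= n_ k)%N.
Proof. by move=> nl; elim: k => // k IH; rewrite (leq_ltn_trans IH)// nl. Qed.

Lemma subsequence_inj (n_ : nat -> nat) : subsequence n_ -> injective n_.
Proof.
by move=> nl i j ij; case: (ltngtP i j) => // /nl; rewrite ij ltnn.
Qed.

Lemma L0_plus_eq0 X : L0_plus X ->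
  (forall e, 0 < e -> P [set w | e < X w] = 0%E) -> X = 0.
Proof.
move=> /L0_plusP X0 h; apply: L0_eq0 => e e0.
have e2 : 0 < e / 2 by rewrite divr_gt0.
apply/eqP; rewrite -measure_le0 -(h _ e2); apply: ae_le_measure.
- rewrite -[X in measurable X]setTI; apply: measurable_fun_le => //.
  by apply: measurableT_comp => //; exact: L0_measurable.
- exact: L0_above_measurable.
- by apply: filterS X0 => w Xw /=; rewrite ger0_norm//; lra.
Qed.

(** As [l <= n_ l], the [k]-th mean is at least [k / 2] times [X]. On [e < X] either it is at
    distance at least 1 from the limit [Y], or [Y + 1 > k * e / 2]; both events have vanishing
    probability. *)
Lemma banach_saks_no_ray B X : banach_saks (@prob_cvg _ _ _ P) B -> L0_plus X ->
  (forall n, B (n.+1%:R *: X)) -> X = 0.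
Proof.
move=> bs X0 BX; have [n_ n_lt [Y _ cY]] := bs _ BX.
apply: L0_plus_eq0 => // e e0.
pose e2 := e / 2; have e20 : 0 < e2 by rewrite divr_gt0.
pose A k := [set w | k%:R * e2 < Y w + 1].
have mA k : measurable (A k).
  rewrite (_ : A k = ~` [set w | Y w + 1 <= k%:R * e2]).
    apply: measurableC; rewrite -[X in measurable X]setTI.
    by apply: measurable_fun_le => //; apply: measurable_funD => //;
      exact: L0_measurable.
  by apply/seteqP; split=> w; rewrite /A/= ltNge => /negP.
have PA : P (A k) @[k --> \oo] --> 0%E.
  apply: measure_cvg0 => //; apply: aeW => w.
  exists (Num.bound `|(Y w + 1) / e2|) => // k /= kb.
  rewrite /A/=; apply/negP; rewrite -leNgt -ler_pdivrMr//.
  apply: le_trans (ler_norm _) _; apply: ltW.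
  by apply: lt_le_trans (archi_boundP (normr_ge0 _)) _; rewrite ler_nat.
have PB := (L0_cvgP _ _).1 cY 1 ltr01.
have PAB : (P [set w | (1 <= `|Y w - cesaro_mean ((fun n =>
  n.+1%:R *: X) \o n_) k w|)%R] +
    P (A k))%E @[k --> \oo] --> 0%E.
  by rewrite -[X in _ --> X]adde0; apply: cvgeD.
apply/eqP; rewrite -measure_le0 -(cvg_lim _ PAB)//.
apply: lime_ge; first by apply/cvg_ex; exists 0%E.
apply: nearW => k.
have mG := L0_gap_measurable Y (cesaro_mean ((fun n => n.+1%:R *: X) \o n_) k) 1.
apply: le_trans (measureU2 P mG (mA k)).
apply: ae_le_measure; [exact: L0_above_measurable|exact: measurableU|].
have aX : {ae P, forall w n, (n.+1%:R *: X : L0 P) w = n.+1%:R * X w}.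
  by apply: ae_foralln => n; exact: L0_ZE.
apply: filterS3 aX (cesaro_meanE ((fun n => n.+1%:R *: X) \o n_)) ((L0_plusP X).1 X0).
move=> w Xw cw X0w Xe /=.
have mean_ge : k%:R * e2 <= cesaro_mean ((fun n => n.+1%:R *: X) \o n_) k w.
  rewrite cw; under eq_bigr do rewrite /= Xw.
  have sumge : k.+1%:R * k%:R / 2 <= \sum_(l < k.+1) (n_ l).+1%:R :> R.
    apply: (@le_trans _ _ (\sum_(l < k.+1) l%:R)).
      elim: (k) => [|j IH]; first by rewrite big_ord1 mulr0 mul0r.
      rewrite big_ord_recr/=; apply: le_trans _ (lerD IH (lexx _)).
      by rewrite -[j.+2%:R]natr1 -[j.+1%:R]natr1 le_eqVlt; apply/orP; left;
        apply/eqP; field.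
    by apply: ler_sum => l _; rewrite ler_nat leqW// subsequence_geq.
  rewrite -mulr_suml ler_pdivlMl ?ltr0n//.
  apply: (@le_trans _ _ (k.+1%:R * k%:R / 2 * e)); first by rewrite /e2 le_eqVlt;
    apply/orP; left; apply/eqP; ring.
  by apply: ler_pM => //; exact: ltW.
have [h|h] := leP 1 `|Y w - cesaro_mean ((fun n => n.+1%:R *: X) \o n_) k w|;
  [by left|right].
rewrite /A/=; move: h; rewrite ltr_distl => /andP[h1 h2].
by apply: le_lt_trans mean_ge _; lra.
Qed.

End L0_convergence.

(** * Escape of mass along rays, and consequences of the dual density *)

Section rays_and_densities.
Context d (T : measurableType d) (R : realType) (P : probability T R).
Implicit Types (X Y : L0 P) (B : set (L0 P)).

(* The mass [P (X > 0)] of the laws of [n X] escapes to infinity. *)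
Lemma laws_weakly_precompact_no_ray B X : laws_weakly_precompact B -> L0_plus X ->
  (forall n, B (n.+1%:R *: X)) -> X = 0.
Proof.
move=> wB X0 BX; have [n_ n_lt [mu muR cmu]] := wB _ BX.
apply: L0_plus_eq0 => // e e0.
(* A ramp from 0 at [M] to 1 at [M + 1], the continuous substitute for an indicator. Its
   [mu]-integral is at least [P (e < X)] for every [M], yet tends to 0 with [M]. *)
pose f (M : nat) (x : R) : R := Num.max 0 (Num.min (x - M%:R) 1).
have f01 M x : 0 <= f M x <= 1.
  by rewrite /f le_max lexx/= ge_max ler01 ge_min lexx orbT.
have cf M : continuous (f M).
  move=> x; apply/cvgrPdist_lt => r r0; exists r => //= y.
  apply: le_lt_trans; rewrite /f.
  have h1 := ler_norm (x - y); have h2 := ler_norm (- (x - y)); rewrite normrN in h2.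
  have h3 := normr_ge0 (x - y); move: `|x - y| h1 h2 h3 => a h1 h2 h3.
  rewrite ler_norml /Num.max /Num.min.
  by case: (ltP (x - M%:R) 1) => ?; case: (ltP (y - M%:R) 1) => ?;
    do ?case: (ltP 0 _) => ?; apply/andP; split; lra.
have mf M : measurable_fun setT (f M) by exact: continuous_measurable_fun.
have bf M : bounded_measurable (f M) by exact: bounded_measurable_itv (f01 M).
have f_le M x : x <= M%:R -> f M x = 0.
  by move=> xM; rewrite /f max_l// ge_min subr_le0 xM.
have f_ge M x : M%:R + 1 <= x -> f M x = 1.
  by move=> xM; rewrite /f min_r ?max_r//; lra.
have mRp : measurable (@Rplus R) by exact: measurable_itv.
have intE (nu : probability R R) M :
    (\int[nu]_(x in @Rplus R) (f M x)%:E)%E = (\int[nu]_x f M x)%:E.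
  rewrite -bounded_RintegralE// integral_mkcond; apply: eq_integral => x _.
  rewrite /patch; case: ifPn => //; rewrite notin_setE /Rplus/= in_itv/= andbT.
  by move=> /negP; rewrite -ltNge => x0; rewrite f_le// (le_trans (ltW x0)).
have lb M : (P [set w | (e < X w)%R] <= (\int[mu]_x f M x)%:E)%E.
  have cM : {within @Rplus R, continuous (f M)} by exact: continuous_subspaceT.
  have bM : exists M0 : R, forall x, Rplus x -> `|f M x| <= M0.
    by exists 1 => x _; have /andP[? ?] := f01 M x; rewrite ger0_norm.
  have := cmu _ cM bM; rewrite intE => c.
  rewrite -(cvg_lim _ c)//; apply: lime_ge; first by apply/cvg_ex; eexists; exact: c.
  exists (Num.bound `|(M%:R + 1) / e|) => // k /= kb.
  have ke : M%:R + 1 <= k%:R * e.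
    rewrite -ler_pdivrMr//; apply: le_trans (ler_norm _) _; apply: ltW.
    by apply: lt_le_trans (archi_boundP (normr_ge0 _)) _; rewrite ler_nat.
  rewrite intE -bounded_RintegralE//.
  have mfE : measurable_fun setT (fun x => (f M x)%:E) by exact/measurable_EFinP.
  have fE0 x : (0 <= (f M x)%:E)%E by rewrite lee_fin; have /andP[] := f01 M x.
  rewrite (ge0_integral_distribution _ mfE fE0).
  rewrite -[X in (P X <= _)%E]setIT -integral_indic//; last exact: L0_above_measurable.
  apply: ae_ge0_le_integral => //.
  - by apply/measurable_EFinP; apply: measurable_indic; exact: L0_above_measurable.
  - by move=> w _; exact: fE0.
  - apply/measurable_EFinP; apply: measurableT_comp => //; exact: L0_measurable.
  apply: filterS (L0_ZE (n_ k).+1%:R X) => w Xw _ /=.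
  rewrite indicE; case: (boolP (w \in _)) => [|_]; last exact: fE0.
  rewrite inE/= => eX; rewrite lee_fin f_ge//.
  change (M%:R + 1 <= ((n_ k).+1%:R *: X : L0 P) w); rewrite Xw.
  apply: le_trans ke _; apply: ler_pM => //; [exact: ltW| |exact: ltW].
  by rewrite ler_nat leqW// subsequence_geq.
have mu_to0 : \int[mu]_x f M x @[M --> \oo] --> 0.
  rewrite -[X in _ --> X](Rintegral_probability_cst mu).
  apply: (@bounded_dominated_cvg _ _ _ _ _ _ 1) => //.
  - by move=> M x; have /andP[? ?] := f01 M x; rewrite ger0_norm.
  - apply: aeW => x; apply: cvg_near_cst.
    exists (Num.bound `|x|) => // M /= Mb; apply: f_le; apply: le_trans (ler_norm _) _.
    by apply: ltW; apply: lt_le_trans (archi_boundP (normr_ge0 _)) _; rewrite ler_nat.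
have cE : (\int[mu]_x f M x)%:E @[M --> \oo] --> 0%E by apply: cvg_EFin => //;
  exact: nearW.
apply/eqP; rewrite -measure_le0 -(cvg_lim _ cE)//.
by apply: lime_ge; [apply/cvg_ex; exists 0%E|exact: nearW].
Qed.

Variables (B : set (L0 P)) (Z : T -> R).
Hypothesis B_plus : B `<=` @L0_plus _ _ _ P.
Hypothesis mZ : measurable_fun setT Z.
Hypothesis Z01 : forall w, 0 <= Z w <= 1.
Hypothesis Z_pos : {ae P, forall w, 0 < Z w}.
Hypothesis Z_int : forall X, B X ->
  (\int[P]_w (Num.max (X w) 0 * (Z w) ^+ 2)%:E <= 2)%E.

(** Markov's inequality for [X * Z ^+ 2], away from a set [S n] where [Z] is small; that set is the
    same for all [X] in [B], which makes the estimate uniform. *)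
Lemma dual_density_tight : tight B.
Proof.
move=> r r0.
pose S n := [set w | Z w ^+ 2 <= n.+1%:R^-1].
have mZ2 : measurable_fun setT (fun w => Z w ^+ 2) by exact: measurable_funX.
have mS n : measurable (S n).
  by rewrite -[X in measurable X]setTI; apply: measurable_fun_le.
have c0 : P (S n) @[n --> \oo] --> 0%E.
  apply: measure_cvg0 => //; apply: filterS Z_pos => w Zw.
  have Z20 : 0 < Z w ^+ 2 by rewrite exprn_gt0.
  have /cvgrPdist_lt/(_ _ Z20) := @cvg_harmonic R; apply: filterS => n.
  rewrite sub0r normrN => h; rewrite /S/=; apply/negP; rewrite -ltNge.
  by apply: le_lt_trans h; exact: ler_norm.
have r2 : 0 < r / 2 by rewrite divr_gt0.
have [n Sn] : exists n, (P (S n) <= (r / 2)%:E)%E.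
  have /fine_cvgP[_ /cvgrPdist_le/(_ _ r2)[n _ /(_ n (leqnn n))]] := c0.
  rewrite sub0r normrN => Sn; exists n.
  by rewrite -[leLHS]fineK ?fin_num_measure// lee_fin (le_trans (ler_norm _) Sn).
(* Off [S n], [A < X] yields [1 <= r / 4 * (X * Z ^+ 2)], whose mean is at most [r / 2]; the other
   half of [r] pays for [S n]. *)
pose A : R := 4 * n.+1%:R / r.
have A0 : 0 < A by rewrite divr_gt0// mulr_gt0.
exists A => X BX.
have mX : measurable_fun setT (fun w => Num.max (X w) 0).
  by apply: measurable_maxr => //; exact: L0_measurable.
have mXZ : measurable_fun setT (fun w => (Num.max (X w) 0 * Z w ^+ 2)%:E).
  by apply/measurable_EFinP; exact: measurable_funM.
have XZ0 w : (0 <= (Num.max (X w) 0 * Z w ^+ 2)%:E)%E.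
  by rewrite lee_fin mulr_ge0 ?sqr_ge0// le_max lexx orbT.
rewrite -[X in (P X <= _)%E]setIT -integral_indic//; last exact: L0_above_measurable.
apply: (@le_trans _ _ (\int[P]_w ((\1_(S n) w)%:E +
    (r / 4)%:E * (Num.max (X w) 0 * Z w ^+ 2)%:E))%E).
  apply: ge0_le_integral => //.
  - by apply/measurable_EFinP; apply: measurable_indic; exact: L0_above_measurable.
  - apply: emeasurable_funD; first by apply/measurable_EFinP; exact: measurable_indic.
    exact: measurable_funeM.
  move=> w _; rewrite -EFinM -EFinD lee_fin [leLHS]indicE.
  have h0 : 0 <= r / 4 * (Num.max (X w) 0 * Z w ^+ 2).
    apply: mulr_ge0; first by rewrite divr_ge0// ltW.
    by have := XZ0 w; rewrite lee_fin.
  case: (boolP (w \in _)) => [|_]; last by rewrite addr_ge0// indicE.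
  rewrite inE/= => AX; rewrite indicE; case: (boolP (w \in S n)) => [_|].
    by rewrite lerDl.
  rewrite notin_setE /S/= => /negP; rewrite -ltNge => Zn; rewrite add0r.
  rewrite (max_l (le_trans (ltW A0) (ltW AX))).
  apply: (@le_trans _ _ (r / 4 * (A * n.+1%:R^-1))).
    suff -> : r / 4 * (A * n.+1%:R^-1) = 1 by [].
    rewrite /A; have : 0 < n.+1%:R :> R by rewrite ltr0n.
    by move: n.+1%:R => x x0; field; rewrite !gt_eqF.
  rewrite ler_wpM2l//; first by rewrite divr_ge0// ltW.
  by apply: ler_pM => //; [exact: ltW|exact: ltW|exact: ltW].
rewrite ge0_integralD//; last 3 first.
- by apply/measurable_EFinP; exact: measurable_indic.
- by move=> w _; rewrite mule_ge0// lee_fin divr_ge0// ltW.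
- exact: measurable_funeM.
rewrite ge0_integralZl_EFin//; last by rewrite divr_ge0// ltW.
rewrite integral_indic// setIT.
have r4 : (0 <= (r / 4)%:E)%E by rewrite lee_fin divr_ge0// ltW.
apply: le_trans (leeD Sn (lee_wpmul2l r4 (Z_int BX))) _.
by rewrite -EFinM -EFinD lee_fin; lra.
Qed.

Lemma dual_density_L1_bounded : exists Q : probability T R,
  [/\ equivalent_probability P Q, bounded_density P Q & L1_bounded Q B].
Proof.
have bZ2 : bounded_measurable (fun w => Z w ^+ 2).
  by apply/bounded_measurable_sqr; exact: bounded_measurable_itv Z01.
pose c := \int[P]_w (Z w ^+ 2).
have c_pos : 0 < c.
  rewrite lt_neqAle Rintegral_ge0 ?andbT; last by move=> w _; exact: sqr_ge0.
  apply/eqP => c0.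
  have : ae_eq P setT (fun w => (Z w ^+ 2)%:E) (cst 0%E).
    apply/ae_eq_integral_abs => //; first by apply/measurable_EFinP; case: bZ2.
    under eq_integral do rewrite /= ger0_norm ?sqr_ge0//.
    by rewrite bounded_RintegralE// -/c -c0.
  move=> Z0; have : {ae P, forall w : T, False}.
    apply: filterS2 Z0 Z_pos => w /(_ I)[/eqP]; rewrite sqrf_eq0 => /eqP ->.
    by rewrite ltxx.
  move=> [N [mN N0 NF]]; have : P setT = 0%E.
    by apply: (subset_measure0 measurableT mN _ N0) => w _; apply: NF.
  by rewrite probability_setT => /eqP; rewrite onee_eq0.
pose D w := c^-1 * Z w ^+ 2.
have mD : measurable_fun setT D by apply: measurable_funM => //; case: bZ2.
have D0 w : 0 <= D w by rewrite mulr_ge0 ?sqr_ge0// invr_ge0 ltW.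
have DM w : D w <= c^-1.
  apply: ler_piMr; first by rewrite invr_ge0 ltW.
  by have /andP[? ?] := Z01 w; rewrite exprn_ile1.
have D1 : (\int[P]_w (D w)%:E = 1)%E.
  rewrite bounded_RintegralE; last first.
    by apply: (bounded_measurable_itv (a := 0) (b := c^-1)) => // w; rewrite D0 DM.
  by rewrite bounded_RintegralZ// -/c mulVf// gt_eqF.
have Dpos : {ae P, forall w, 0 < D w}.
  by apply: filterS Z_pos => w Zw; rewrite mulr_gt0 ?invr_gt0// exprn_gt0.
have [Q [PQ dQ intQ]] := density_probability mD D0 D1 DM Dpos.
exists Q; split=> //; apply: (@le_lt_trans _ _ (c^-1 * 2)%:E); last exact: ltry.
apply: ge_ereal_sup => _ [X BX <-].
have mX : measurable_fun setT (fun w => Num.max (X w) 0).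
  by apply: measurable_maxr => //; exact: L0_measurable.
rewrite expectation_def.
have -> : (\int[Q]_w (X w)%:E = \int[Q]_w (Num.max (X w) 0)%:E)%E.
  apply: ae_eq_integral => //.
  - by apply/measurable_EFinP; exact: L0_measurable.
  - exact/measurable_EFinP.
  - apply: (dominates_ae PQ.2).
    by apply: filterS ((L0_plusP X).1 (B_plus BX)) => w ? _; rewrite max_l.
rewrite intQ//; last by move=> w; rewrite le_max lexx orbT.
rewrite (_ : (\int[P]_w _)%E = (\int[P]_w (c^-1%:E * (Num.max (X w) 0 * Z w ^+ 2)%:E))%E); last first.
  by apply: eq_integral => w _; rewrite -EFinM; congr EFin; rewrite /D mulrCA.
have ci0 : 0 <= c^-1 by rewrite invr_ge0 ltW.
have mXZ : measurable_fun setT (fun w => (Num.max (X w) 0 * Z w ^+ 2)%:E).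
  by apply/measurable_EFinP; apply: measurable_funM => //; case: bZ2.
have XZ0 w : setT w -> (0 <= (Num.max (X w) 0 * Z w ^+ 2)%:E)%E.
  by move=> _; rewrite lee_fin mulr_ge0 ?sqr_ge0// le_max lexx orbT.
rewrite (ge0_integralZl_EFin P measurableT XZ0 mXZ ci0).
by rewrite EFinM; apply: lee_wpmul2l; rewrite ?lee_fin//; exact: Z_int.
Qed.

End rays_and_densities.

(** * The equivalences *)

Theorem theorem5p12 (d : measure_display) (T : measurableType d) (R : realType)
  (P : probability T R) (K : R -> set (L0 P))
  (K_plus : forall alpha : R, 0 < alpha -> K alpha `<=` @L0_plus d T R P)
  (K_nonempty : forall alpha : R, 0 < alpha -> K alpha !=set0)
  (K_comb : forall a b alpha beta : R,
     0 <= a -> 0 <= b -> 0 < alpha -> 0 < beta ->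
     0 < a * alpha + b * beta ->
     forall X Y : L0 P, K alpha X -> K beta Y ->
       K (a * alpha + b * beta) (a *: X + b *: Y)) :
  let B_ := fun alpha : R => solid_hull (K alpha) in
  let B := B_ 1 in
  [<-> NUPBR (K 1);
       NAA1 (K 1);
       NA1 (K 1);
       \bigcap_(alpha in [set alpha : R | 0 < alpha]) B_ alpha = [set 0];
       exists2 Q : probability T R,
         equivalent_probability P Q & L1_bounded Q B;
       exists Q : probability T R,
         [/\ equivalent_probability P Q, bounded_density P Q & L1_bounded Q B];
       permutation_von_weizsacker (@as_cvg d T R P) B;
       permutation_von_weizsacker (@prob_cvg d T R P) B;
       subsequence_von_weizsacker (@as_cvg d T R P) B;
       subsequence_von_weizsacker (@prob_cvg d T R P) B;
       banach_saks (@as_cvg d T R P) B;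
       banach_saks (@prob_cvg d T R P) B;
       laws_weakly_precompact B].
Proof.
move=> B_ B.
have K_scale a alpha X : 0 < a -> 0 < alpha -> K alpha X -> K (a * alpha) (a *: X).
  move=> a0 alpha0 KX; have := @K_comb a 0 alpha alpha (ltW a0) (lexx _) alpha0 alpha0.
  by rewrite mul0r addr0 mulr_gt0// => /(_ isT X X KX KX); rewrite scale0r addr0.
have B_plus alpha : B_ alpha `<=` @L0_plus _ _ _ P by move=> X /solid_hullP[].
have plus_scale c X : 0 <= c -> @L0_plus _ _ _ P X -> @L0_plus _ _ _ P (c *: X).
  move=> c0 /L0_plusP X0; apply/L0_plusP.
  by apply: filterS2 X0 (L0_ZE c X) => w Xw ->; rewrite mulr_ge0.
have B_scale a alpha X : 0 < a -> 0 < alpha -> B_ alpha X -> B_ (a * alpha) (a *: X).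
  move=> a0 alpha0 /solid_hullP[X0 [Y KY XY]]; apply/solid_hullP; split.
    by apply: plus_scale => //; exact: ltW.
  exists (a *: Y); first exact: K_scale.
  by apply: filterS3 XY (L0_ZE a X) (L0_ZE a Y) => w ? -> ->; rewrite ler_pM2l.
have B_normalize alpha X : 0 < alpha -> B_ alpha X -> B (alpha^-1 *: X).
  move=> alpha0 BX; have := B_scale alpha^-1 alpha X; rewrite mulVf ?gt_eqF//.
  by apply; rewrite ?invr_gt0.
have zero_plus : @L0_plus _ _ _ P 0 by apply/L0_plusP; apply: filterS (L0_0E P) => w ->.
have B_zero alpha : 0 < alpha -> B_ alpha 0.
  move=> alpha0; have [Y KY] := K_nonempty _ alpha0; apply/solid_hullP; split=> //.
  exists Y => //; apply: filterS2 (L0_0E P) ((L0_plusP Y).1 (K_plus _ alpha0 _ KY)).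
  by move=> w ->.
have B_solid X Y : B Y -> L0_plus X -> {ae P, forall w, X w <= Y w} -> B X.
  move=> /solid_hullP[_ [Z KZ YZ]] X0 XY; apply/solid_hullP; split=> //.
  by exists Z => //; apply: filterS2 XY YZ => w; exact: le_trans.
have B_convex t X Y : 0 <= t <= 1 -> B X -> B Y -> B ((1 - t) *: X + t *: Y).
  move=> /andP[t0 t1] /solid_hullP[X0 [X' KX' XX']] /solid_hullP[Y0 [Y' KY' YY']].
  have s0 : 0 <= 1 - t by rewrite subr_ge0.
  apply/solid_hullP; split.
    apply/L0_plusP; apply: filterS3 (filterI ((L0_plusP X).1 X0) ((L0_plusP Y).1 Y0))
      (L0_DE ((1 - t) *: X) (t *: Y)) (filterI (L0_ZE (1 - t) X) (L0_ZE t Y)).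
    by move=> w [? ?] -> [-> ->]; rewrite addr_ge0// mulr_ge0.
  exists ((1 - t) *: X' + t *: Y').
    have := @K_comb (1 - t) t 1 1 s0 t0 ltr01 ltr01.
    by rewrite !mulr1 subrK => /(_ ltr01 X' Y' KX' KY').
  apply: filterS3 (filterI XX' YY')
    (filterI (L0_DE ((1 - t) *: X) (t *: Y)) (L0_DE ((1 - t) *: X') (t *: Y')))
    (filterI (filterI (L0_ZE (1 - t) X) (L0_ZE t Y))
      (filterI (L0_ZE (1 - t) X') (L0_ZE t Y'))).
  by move=> w [? ?] [-> ->] [[-> ->] [-> ->]]; rewrite lerD// ler_wpM2l.
set iv := _ = [set 0].
have ivP : iv <-> forall X, (forall alpha, 0 < alpha -> B_ alpha X) -> X = 0.
  split=> [ivE X BX|h].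
    by have : [set 0] X by rewrite -ivE => alpha /= /BX.
  apply/seteqP; split=> [X BX|_ -> alpha /=]; first exact: h.
  exact: B_zero.
(* Membership at level [n.+1%:R^-1], rescaled to level 1. *)
have ray X : (forall alpha, 0 < alpha -> B_ alpha X) -> forall n, B (n.+1%:R *: X).
  move=> BX n; have n0 : 0 < n.+1%:R^-1 :> R by rewrite invr_gt0.
  by have := B_normalize _ _ n0 (BX _ n0); rewrite invrK.
have iv_dual : iv -> exists Z : T -> R,
  [/\ measurable_fun setT Z, forall w, 0 <= Z w <= 1, {ae P, forall w, 0 < Z w} &
   forall X, B X -> (\int[P]_w (Num.max (X w) 0 * (Z w) ^+ 2)%:E <= 2)%E].
  move=> /ivP h; apply: exists_dual_density => //.
  - by exists 0; exact: B_zero.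
  - exact: B_plus.
  - move=> X X0 BX; apply: h => alpha alpha0.
    have ai : 0 < alpha^-1 by rewrite invr_gt0.
    have := B_scale _ 1 _ alpha0 ltr01 (BX _ ai).
    by rewrite mulr1 scalerA mulfV ?gt_eqF// scale1r.
have iv_tight : iv -> tight B.
  by move=> /iv_dual[Z [mZ Z01 Zpos intZ]]; exact: dual_density_tight intZ.
have iv_vi : iv -> exists Q : probability T R,
    [/\ equivalent_probability P Q, bounded_density P Q & L1_bounded Q B].
  move=> /iv_dual[Z [mZ Z01 Zpos intZ]].
  exact: (dual_density_L1_bounded (B_plus 1) mZ Z01 Zpos intZ).
have v_komlos : (exists2 Q : probability T R,
    equivalent_probability P Q & L1_bounded Q B) ->
    forall X_ : nat -> L0 P, (forall n, B (X_ n)) ->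
    exists2 n_, subsequence n_ & exists2 X, L0_plus X &
      forall sigma : nat -> nat, injective sigma ->
        as_cvg (cesaro_mean (X_ \o (n_ \o sigma))) X.
  by move=> [Q PQ QB]; exact: (L1_bounded_komlos (B_plus 1) PQ QB).
have xii_iv : banach_saks (@prob_cvg d T R P) B -> iv.
  move=> h; apply/ivP => X BX; apply: banach_saks_no_ray h _ (ray _ BX).
  exact: (B_plus 1 _ (BX _ ltr01)).
have xiii_iv : laws_weakly_precompact B -> iv.
  move=> h; apply/ivP => X BX; apply: laws_weakly_precompact_no_ray h _ (ray _ BX).
  exact: (B_plus 1 _ (BX _ ltr01)).
have iv_komlos : iv -> forall X_ : nat -> L0 P, (forall n, B (X_ n)) ->
    exists2 n_, subsequence n_ & exists2 X, L0_plus X &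
      forall sigma : nat -> nat, injective sigma ->
        as_cvg (cesaro_mean (X_ \o (n_ \o sigma))) X.
  by move=> /iv_vi[Q [PQ _ QB]]; apply: v_komlos; exists Q.
have sub_as_prob : subsequence_von_weizsacker (@as_cvg d T R P) B ->
    subsequence_von_weizsacker (@prob_cvg d T R P) B.
  move=> h X_ /h[n_ n_lt [X X0 cX]]; exists n_ => //; exists X => // k_ k_lt.
  exact/as_cvg_prob_cvg/cX.
have perm_as_prob : permutation_von_weizsacker (@as_cvg d T R P) B ->
    permutation_von_weizsacker (@prob_cvg d T R P) B.
  move=> h X_ /h[n_ n_lt [X X0 cX]]; exists n_ => //; exists X => // pi_ pi_b.
  exact/as_cvg_prob_cvg/cX.
have bs_as_prob : banach_saks (@as_cvg d T R P) B -> banach_saks (@prob_cvg d T R P) B.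
  move=> h X_ /h[n_ n_lt [X X0 cX]]; exists n_ => //; exists X => //.
  exact/as_cvg_prob_cvg/cX.
have iv_vii : iv -> permutation_von_weizsacker (@as_cvg d T R P) B.
  move=> /iv_komlos h X_ /h[n_ n_lt [X X0 cX]]; exists n_ => //; exists X =>
    // pi_ pi_b.
  exact/cX/bij_inj.
have iv_ix : iv -> subsequence_von_weizsacker (@as_cvg d T R P) B.
  move=> /iv_komlos h X_ /h[n_ n_lt [X X0 cX]]; exists n_ => //; exists X => // k_ k_lt.
  exact/cX/subsequence_inj.
have iv_xi : iv -> banach_saks (@as_cvg d T R P) B.
  move=> /iv_komlos h X_ /h[n_ n_lt [X X0 cX]]; exists n_ => //; exists X => //.
  exact: (cX id (fun _ _ => id)).
have viii_iv : permutation_von_weizsacker (@prob_cvg d T R P) B -> iv.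
  move=> h; apply: xii_iv => X_ /h[n_ n_lt [X X0 cX]]; exists n_ => //; exists X => //.
  by apply: (cX id); exists id.
have x_iv : subsequence_von_weizsacker (@prob_cvg d T R P) B -> iv.
  move=> h; apply: xii_iv => X_ /h[n_ n_lt [X X0 cX]]; exists n_ => //; exists X => //.
  exact: (cX id).
(* The route leads through the Komlos subsequence: it gives Cesaro convergence in probability, which
   excludes rays. *)
have v_iv : (exists2 Q : probability T R,
    equivalent_probability P Q & L1_bounded Q B) -> iv.
  move=> /v_komlos h; apply: x_iv; apply: sub_as_prob => X_ /h[n_ n_lt [X X0 cX]].
  by exists n_ => //; exists X => // k_ k_lt; exact/cX/subsequence_inj.
(* From [L1_bounded] on, an item that does not give the next one by weakening the mode of
   convergence goes back to [iv] and out again. *)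
tfae.
- exact: topologically_bounded_sequentially.
- by move=> sB X _ X0; exact: sequentially_bounded_gauge.
- move=> na; apply/ivP => X BX; apply: contrapT => X0.
  have := na X (B_plus 1 _ (BX _ ltr01)) X0; rewrite ltNge => /negP; apply.
  apply/lee_addgt0Pr => e e0; rewrite add0e; apply: ereal_inf_lbound.
  exists e => //; split=> //; exists (e^-1 *: X); first exact: B_normalize (BX _ e0).
  by rewrite scalerA mulfV ?gt_eqF// scale1r.
- by move=> /iv_vi[Q [PQ _ QB]]; exists Q.
- by move=> /v_iv/iv_vi.
- by move=> [Q [PQ _ QB]]; apply/iv_vii/v_iv; exists Q.
- exact: perm_as_prob.
- by move=> /viii_iv/iv_ix.
- exact: sub_as_prob.
- by move=> /x_iv/iv_xi.
- exact: bs_as_prob.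
- move=> /xii_iv/iv_tight tB X_ BX; apply: tight_laws_weakly_precompact.
    by move=> n; apply/L0_plusP; exact: B_plus (BX n).
  by move=> r r0; have [A AP] := tB r r0; exists A => n; exact: AP.
- move=> /xiii_iv/iv_tight; apply: tight_topologically_bounded.
  exact: B_plus.
Qed.
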